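(* Let $a>0$, let $\boldsymbol\rho:\mathbb{R}^2\to\mathbb{R}^3$ be $C^\infty$ with $\boldsymbol\rho_u(\mathbf 0),\boldsymbol\rho_v(\mathbf 0)$ linearly independent and $\boldsymbol\rho(\mathbf u)\neq\boldsymbol\rho(\mathbf 0)$ for $\mathbf u\in[-a,a]^2\setminus\{\mathbf 0\}$; set $r(\mathbf u):=|\boldsymbol\rho(\mathbf u)-\boldsymbol\rho(\mathbf 0)|$ and let $Q$ be the first fundamental form at $\mathbf 0$. Let $p$ be a positive odd integer, $q\ge0$ an integer and $P$ a positive integer. Let $\varphi$ be $C^\infty$ and either compactly supported in $(-a,a)^2$ or such that $\varphi/r^p$ is doubly periodic on $[-a,a]^2$, and suppose $\varphi(\mathbf u)=O(|\mathbf u|^{2q})$ as $\mathbf u\to\mathbf 0$. For $N\in\mathbb{Z}^+$ let $h=a/N$. Assume the linear systems defining the weights $\tau^m_{\mu,\nu}$ below are uniquely solvable. Then $$\int_{[-a,a]^2}\frac{\varphi(\mathbf u)}{r(\mathbf u)^p}\,\mathrm d\mathbf u=\sum_{\substack{-N\le i,j\le N-1\\(i,j)\ne(0,0)}}\frac{\varphi(ih,jh)}{r(ih,jh)^p}h^2+C^h_p[\varphi;P,q]+O(h^P)\qquad(h\to0),$$ where, with $M:=2\lceil\frac{P+p}{2}\rceil-2q-4$, $K_1^m:=q+\lceil\frac{3m}{2}\rceil$, $K_2^m:=\lceil\frac{P+p}{2}\rceil+m-2$ and $\tilde\varphi_m(\mathbf u):=[r(\mathbf u)^2-Q(\mathbf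 u)]^m\varphi(\mathbf u)$, $$C^h_p[\varphi;P,q]:=\sum_{m=0}^{M}\ \sum_{(\mu,\nu)\in U(K_1^m,K_2^m)}\binom{-p/2}{m}\tilde\varphi_m(\mu h,\nu h)\,\tau^m_{\mu,\nu}\,h^{2-p-2m}$$ (and $C^h_p:=0$ if $M<0$).
   Context: First fundamental form at $\mathbf 0$: $Q(\mathbf u)=Eu^2+2Fuv+Gv^2$ with $E=\boldsymbol\rho_u(\mathbf 0)\cdot\boldsymbol\rho_u(\mathbf 0)$, $F=\boldsymbol\rho_u(\mathbf 0)\cdot\boldsymbol\rho_v(\mathbf 0)$, $G=\boldsymbol\rho_v(\mathbf 0)\cdot\boldsymbol\rho_v(\mathbf 0)$. Notation: $|\mathbf u|:=\max(|u|,|v|)$, $|\mathbf i|:=\max(|i|,|j|)$. Wigner limit: for $s\in\mathbb{C}$, $s\ne 2$, and a polynomial $f$, $$\mathcal W^s[f]:=\lim_{h\to0}\lim_{N\to\infty}\Big\{\sum_{\mathbf i\in\mathbb{Z}^2,\,0<|\mathbf i|\le N}\frac{f(\mathbf i)}{Q(\mathbf i)^{s/2}}\eta(\mathbf i h)-\int_{|\mathbf u|\le N+\frac12}\frac{f(\mathbf u)}{Q(\mathbf u)^{s/2}}\eta(\mathbf u h)\,\mathrm d\mathbf u\Big\},$$ with $\eta$ any $C^\infty$ compactly supported even function with $\eta(\mathbf 0)=1$, the integral in the Hadamard finite-part sense when needed. Stencil: for integers $0\le K_1\le K_2$, $U(K_1,K_2):=\{(\mu,\nu)\in\mathbb{Z}^2: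 K_1\le|\mu|+|\nu|\le K_2+1,\ \max(|\mu|,|\nu|)\le K_2\}$. Weights: for each $m$ with $0\le m\le M$, let $s:=2m+p$, $K_1=K_1^m$, $K_2=K_2^m$; the weights $\tau^m_{\mu,\nu}$, $(\mu,\nu)\in U(K_1,K_2)$, are the solution of the linear system consisting of (i) the moment conditions $\sum_{(\mu,\nu)\in U(K_1,K_2)}\mu^{2k-l}\nu^{l}\,\tau^m_{\mu,\nu}=-\mathcal W^{s}[u^{2k-l}v^{l}]$ for all $K_1\le k\le K_2$ and $0\le l\le 2k$; and (ii) the symmetry conditions $\tau^m_{\mu,\nu}=\tau^m_{-\mu,-\nu}$ for all $(\mu,\nu)\in U(K_1,K_2)$, $\tau^m_{\mu,\nu}=-\tau^m_{-\mu,\nu}$ whenever $|\mu|+|\nu|=K_2+1$, and $\tau^m_{\mu,\nu}=\tau^m_{-\mu,\nu}$ whenever $|\mu|+|\nu|=K_1$. *)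

(* Defs.v *)
From Stdlib Require Import Reals Lra List ZArith Bool.
From Coquelicot Require Import Coquelicot.
Open Scope R_scope.

Fixpoint pd (ds : list bool) (f : R -> R -> R) : R -> R -> R :=
  match ds with
  | nil => f
  | d :: ds' =>
      let g := pd ds' f in
      if d then fun x y => Derive (fun t => g t y) x
      else fun x y => Derive (fun t => g x t) y
  end.

Definition smooth_on (U : R -> R -> Prop) (f : R -> R -> R) : Prop :=
  forall (ds : list bool) (x y : R), U x y ->
    ex_derive (fun t => pd ds f t y) x /\
    ex_derive (fun t => pd ds f x t) y /\
    continuity_2d_pt (pd ds f) x y.

Definition smooth (f : R -> R -> R) : Prop := smooth_on (fun _ _ => True) f.

Definition rsum (n : nat) (f : nat -> R) : R :=
  fold_right Rplus 0 (map f (seq 0 n)).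

(* sum_{n = lo}^{hi} f n  (empty if hi < lo) *)
Definition zsum (lo hi : Z) (f : Z -> R) : R :=
  fold_right Rplus 0
    (map (fun n => f (lo + Z.of_nat n)%Z) (seq 0 (Z.to_nat (hi - lo + 1)))).

Definition gbinom (x : R) (m : nat) : R :=
  fold_right Rmult 1 (map (fun i => x - INR i) (seq 0 m)) / INR (fact m).

Definition iint (g : R -> R -> R) (x1 x2 y1 y2 : R) : R :=
  RInt (fun x => RInt (fun y => g x y) y1 y2) x1 x2.

Definition sq_annulus_int (g : R -> R -> R) (eps Rr : R) : R :=
  iint g (-Rr) Rr eps Rr + iint g (-Rr) Rr (-Rr) (-eps)
  + iint g (-Rr) (-eps) (-eps) eps + iint g eps Rr (-eps) eps.

(* L is the Hadamard finite part of the integral of g over [-R,R]^2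
   (singularity only at the origin): after removing the divergent terms
   (negative powers of eps and a log eps term), the truncated integrals
   tend to L as eps -> 0+.  When g is integrable this is the ordinary
   (improper) integral. *)
Definition fp_square_int (g : R -> R -> R) (Rr L : R) : Prop :=
  exists (K : nat) (c : nat -> R) (c0 : R),
    filterlim
      (fun eps => sq_annulus_int g eps Rr
                  - rsum K (fun k => c k / eps ^ (S k)) - c0 * ln eps)
      (at_right 0) (locally L).

Definition cutoff (eta : R -> R -> R) : Prop :=
  smooth eta /\
  (exists B, 0 < B /\ forall x y, B < Rmax (Rabs x) (Rabs y) -> eta x y = 0) /\
  (forall x y, eta (- x) (- y) = eta x y) /\
  eta 0 0 = 1.

Definition wigner_sum (Q : R -> R -> R) (s : R) (f : R -> R -> R)
  (eta : R -> R -> R) (h : R) (N : Z) : R :=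
  zsum (- N) N (fun i => zsum (- N) N (fun j =>
    if (Z.eqb i 0 && Z.eqb j 0)%bool then 0
    else f (IZR i) (IZR j) / Rpower (Q (IZR i) (IZR j)) (s / 2)
         * eta (IZR i * h) (IZR j * h))).

Definition is_wigner (Q : R -> R -> R) (s : R) (f : R -> R -> R) (L : R) : Prop :=
  forall eta, cutoff eta ->
    exists I : nat -> R -> R,
      (forall (N : nat) (h : R), h <> 0 ->
         fp_square_int (fun x y => f x y / Rpower (Q x y) (s / 2) * eta (x * h) (y * h))
                       (INR N + / 2) (I N h)) /\
      exists (delta : R) (inner : R -> R), 0 < delta /\
        (forall h, 0 < Rabs h < delta ->
           is_lim_seq (fun N => wigner_sum Q s f eta h (Z.of_nat N) - I N h) (inner h)) /\
        is_lim inner 0 L.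

Definition inU (K1 K2 mu nu : Z) : bool :=
  (Z.leb K1 (Z.abs mu + Z.abs nu) && Z.leb (Z.abs mu + Z.abs nu) (K2 + 1)
   && Z.leb (Z.abs mu) K2 && Z.leb (Z.abs nu) K2)%bool.

Definition Usum (K1 K2 : Z) (f : Z -> Z -> R) : R :=
  zsum (- K2) K2 (fun mu => zsum (- K2) K2 (fun nu =>
    if inU K1 K2 mu nu then f mu nu else 0)).

Definition weight_system (Q : R -> R -> R) (s : R) (K1 K2 : Z)
  (tau : Z -> Z -> R) : Prop :=
  (forall k l : nat, (K1 <= Z.of_nat k <= K2)%Z -> (l <= 2 * k)%nat ->
     is_wigner Q s (fun x y => x ^ (2 * k - l) * y ^ l)
       (- Usum K1 K2 (fun mu nu => IZR mu ^ (2 * k - l) * IZR nu ^ l * tau mu nu))) /\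
  (forall mu nu, inU K1 K2 mu nu = true -> tau mu nu = tau (- mu)%Z (- nu)%Z) /\
  (forall mu nu, inU K1 K2 mu nu = true -> (Z.abs mu + Z.abs nu = K2 + 1)%Z ->
     tau mu nu = - tau (- mu)%Z nu) /\
  (forall mu nu, inU K1 K2 mu nu = true -> (Z.abs mu + Z.abs nu = K1)%Z ->
     tau mu nu = tau (- mu)%Z nu).

(** * Surface quantities; rho = (rx, ry, rz) : R^2 -> R^3 *)

Definition du (f : R -> R -> R) : R := Derive (fun t => f t 0) 0.
Definition dv (f : R -> R -> R) : R := Derive (fun t => f 0 t) 0.

Definition Qform (rx ry rz : R -> R -> R) (u v : R) : R :=
  let E := du rx * du rx + du ry * du ry + du rz * du rz in
  let F := du rx * dv rx + du ry * dv ry + du rz * dv rz in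
  let G := dv rx * dv rx + dv ry * dv ry + dv rz * dv rz in
  E * u ^ 2 + 2 * F * u * v + G * v ^ 2.

Definition rdist (rx ry rz : R -> R -> R) (u v : R) : R :=
  sqrt ((rx u v - rx 0 0) ^ 2 + (ry u v - ry 0 0) ^ 2 + (rz u v - rz 0 0) ^ 2).

Definition cP (P p : nat) : Z := ((Z.of_nat (P + p) + 1) / 2)%Z.
Definition Mmax (P p q : nat) : Z := (2 * cP P p - 2 * Z.of_nat q - 4)%Z.
Definition K1m (q : nat) (m : Z) : Z := (Z.of_nat q + (3 * m + 1) / 2)%Z.
Definition K2m (P p : nat) (m : Z) : Z := (cP P p + m - 2)%Z.

(* C^h_p[phi; P, q]  (empty sum, i.e. 0, if M < 0) *)
Definition Ccorr (rx ry rz : R -> R -> R) (phi : R -> R -> R) (p q P : nat)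
  (tau : Z -> Z -> Z -> R) (h : R) : R :=
  zsum 0 (Mmax P p q) (fun m =>
    Usum (K1m q m) (K2m P p m) (fun mu nu =>
      gbinom (- INR p / 2) (Z.to_nat m)
      * ((rdist rx ry rz (IZR mu * h) (IZR nu * h) ^ 2
          - Qform rx ry rz (IZR mu * h) (IZR nu * h)) ^ (Z.to_nat m)
         * phi (IZR mu * h) (IZR nu * h))
      * tau m mu nu
      * powerRZ h (2 - Z.of_nat p - 2 * m)%Z)).

Definition trap_sum (F : R -> R -> R) (N : Z) (h : R) : R :=
  zsum (- N) (N - 1) (fun i => zsum (- N) (N - 1) (fun j =>
    if (Z.eqb i 0 && Z.eqb j 0)%bool then 0
    else F (IZR i * h) (IZR j * h) * h ^ 2)).

(* Main.v *)
(** The integrand is [phi (Q + S)^(-p/2)] with [S = r^2 - Q = O(|u|^3)].  Expanding binomially in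
    [S/Q] and each [S^m phi] in its Taylor polynomials writes it as a finite sum of homogeneous
    functions (monomials over half-integral powers of [Q]) times a cutoff [eta], plus a remainder of
    class [C^P] that is periodic on the square, or vanishes near its boundary; the trapezoidal rule
    integrates that remainder up to [O(h^P)].

    Let [g] be homogeneous of degree [d], [D = d + 2 <> 0], and let [E h] be the punctured
    trapezoidal error of [g eta] with respect to the Hadamard integral.  By homogeneity
    [E h - 2^D E (h/2)] is the error for [g (eta u - eta (u/2))], a smooth function with compact
    support, hence smaller than any power of [h].  Telescoping turns the mere convergence
    [h^(-D) E h -> W] in the definition of the Wigner limit into [E h = h^D W + O(h^k)] for all [k].
    Odd numerators contribute nothing; for even ones [D] is odd, as [p] is.  The moment conditions
    on the weights cancel exactly the terms [h^D W] with [D < P] in the Taylor expansion of the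
    correction. *)
Require Import Defs.
From Stdlib Require Import Reals Lra Lia ZArith List Bool FunctionalExtensionality.
From Coquelicot Require Import Coquelicot.
Open Scope R_scope.

(* [ring] does not see through the canonical structures that Coquelicot puts on [R]. *)
Ltac Rring := match goal with |- @eq _ ?u ?v => change (@eq R u v) end; ring.

(** The ranges in the statement are the bookkeeping of exponents. The Taylor term of degree [2 k] of
    [S^m phi] over [Q^(p/2 + m)] has [D = 2 k - p - 2 m + 2]. Since [S^m phi = O(|u|^(3 m + 2 q))],
    only [k >= K1^m] occur; [D < P] means [k <= K2^m]; and the two bounds are compatible exactly for
    [m <= M]. The symmetry of the weights removes the odd Taylor terms of the correction, whose
    powers of [h] no moment condition controls.

    A Wigner limit is supplied only for [D < P]. Terms with [D >= P] are bounded without one: there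
    the telescoping relates [h] to a step of order 1, and the contraction [2^(-D)] does the work.
    Everything rests on [D <> 0]: for [D = 0] the finite part may contain a logarithm and then does
    not scale under dilation.

    The integrand is singular at the origin, so derivatives are controlled by symbol estimates
    [|D^al f| <= C |u|^(d - |al|)], a calculus closed under products and suitable compositions; it
    turns the size of the remainder at the origin into differentiability there. *)

Lemma is_derive_cst (c x : R) : is_derive (fun _ : R => c) x 0.
Proof. apply (is_derive_const (K := R_AbsRing) (V := R_NormedModule)). Qed.

Lemma is_derive_idR (x : R) : is_derive (fun t : R => t) x 1.
Proof. apply (is_derive_id (K := R_AbsRing)). Qed.

(** * Finite sums *)

Lemma rsum_0 (f : nat -> R) : rsum 0 f = 0.
Proof. reflexivity. Qed.

Lemma rsum_S (n : nat) (f : nat -> R) : rsum (S n) f = rsum n f + f n.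
Proof.
  unfold rsum. rewrite seq_S, map_app, fold_right_app. simpl.
  assert (H : forall l z, fold_right Rplus z l = fold_right Rplus 0 l + z).
  { induction l as [|x l IH]; intros z; simpl; [lra|]. rewrite (IH z). lra. }
  rewrite H. lra.
Qed.

Lemma rsum_ext (n : nat) (f g : nat -> R) :
  (forall i, (i < n)%nat -> f i = g i) -> rsum n f = rsum n g.
Proof.
  induction n as [|n IH]; intros H; [reflexivity|].
  rewrite !rsum_S, IH, H; auto.
Qed.

Lemma rsum_plus (n : nat) (f g : nat -> R) :
  rsum n (fun i => f i + g i) = rsum n f + rsum n g.
Proof. induction n as [|n IH]; [rewrite !rsum_0; lra | rewrite !rsum_S, IH; lra]. Qed.

Lemma rsum_scal (n : nat) (c : R) (f : nat -> R) :
  rsum n (fun i => c * f i) = c * rsum n f.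
Proof. induction n as [|n IH]; [rewrite !rsum_0; lra | rewrite !rsum_S, IH; lra]. Qed.

Lemma rsum_eq0 (n : nat) (f : nat -> R) :
  (forall i, (i < n)%nat -> f i = 0) -> rsum n f = 0.
Proof. induction n as [|n IH]; intros H; [apply rsum_0|]. rewrite rsum_S, IH, H; auto; lra. Qed.

Lemma rsum_le (n : nat) (f g : nat -> R) :
  (forall i, (i < n)%nat -> f i <= g i) -> rsum n f <= rsum n g.
Proof.
  induction n as [|n IH]; intros H; [rewrite !rsum_0; lra|].
  rewrite !rsum_S. apply Rplus_le_compat; auto.
Qed.

Lemma rsum_Rabs (n : nat) (f : nat -> R) : Rabs (rsum n f) <= rsum n (fun i => Rabs (f i)).
Proof.
  induction n as [|n IH]; [rewrite !rsum_0, Rabs_R0; lra|].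
  rewrite !rsum_S. eapply Rle_trans; [apply Rabs_triang|]. lra.
Qed.

Lemma rsum_const (n : nat) (c : R) : rsum n (fun _ => c) = INR n * c.
Proof. induction n as [|n IH]; [rewrite rsum_0; simpl; lra|]. rewrite rsum_S, IH, S_INR; lra. Qed.

Lemma rsum_Rabs_le (n : nat) (f : nat -> R) (c : R) :
  (forall i, (i < n)%nat -> Rabs (f i) <= c) -> Rabs (rsum n f) <= INR n * c.
Proof.
  intros H. eapply Rle_trans; [apply rsum_Rabs|]. rewrite <- rsum_const. now apply rsum_le.
Qed.

Lemma rsum_Sl (n : nat) (f : nat -> R) : rsum (S n) f = f 0%nat + rsum n (fun i => f (S i)).
Proof.
  induction n as [|n IH]; [rewrite rsum_S, !rsum_0; lra|].
  rewrite rsum_S, IH, rsum_S; lra.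
Qed.

Lemma rsum_add (n k : nat) (f : nat -> R) :
  rsum (n + k) f = rsum n f + rsum k (fun i => f (n + i)%nat).
Proof.
  induction k as [|k IH]; [rewrite Nat.add_0_r, rsum_0; lra|].
  rewrite Nat.add_succ_r, !rsum_S, IH; lra.
Qed.

Lemma rsum_rev (n : nat) (f : nat -> R) : rsum n f = rsum n (fun i => f (n - 1 - i)%nat).
Proof.
  induction n as [|n IH]; [reflexivity|].
  rewrite (rsum_Sl n (fun i => f (S n - 1 - i)%nat)), rsum_S, IH.
  replace (S n - 1 - 0)%nat with n by lia. rewrite Rplus_comm. f_equal.
  apply rsum_ext. intros i Hi. f_equal. lia.
Qed.

Lemma rsum_telescope (n : nat) (f : nat -> R) :
  rsum n (fun i => f (S i) - f i) = f n - f 0%nat.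
Proof. induction n as [|n IH]; [rewrite rsum_0; lra|]. rewrite rsum_S, IH; lra. Qed.

Lemma zsum_rsum (lo hi : Z) (f : Z -> R) :
  zsum lo hi f = rsum (Z.to_nat (hi - lo + 1)) (fun n => f (lo + Z.of_nat n)%Z).
Proof. reflexivity. Qed.

Lemma zsum_ext (lo hi : Z) (f g : Z -> R) :
  (forall i, (lo <= i <= hi)%Z -> f i = g i) -> zsum lo hi f = zsum lo hi g.
Proof. intros H. rewrite !zsum_rsum. apply rsum_ext. intros i Hi. apply H. lia. Qed.

Lemma zsum_plus (lo hi : Z) (f g : Z -> R) :
  zsum lo hi (fun i => f i + g i) = zsum lo hi f + zsum lo hi g.
Proof. rewrite !zsum_rsum. apply rsum_plus. Qed.

Lemma zsum_scal (lo hi : Z) (c : R) (f : Z -> R) :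
  zsum lo hi (fun i => c * f i) = c * zsum lo hi f.
Proof. rewrite !zsum_rsum. apply rsum_scal. Qed.

Lemma zsum_eq0 (lo hi : Z) (f : Z -> R) :
  (forall i, (lo <= i <= hi)%Z -> f i = 0) -> zsum lo hi f = 0.
Proof. intros H. rewrite zsum_rsum. apply rsum_eq0. intros i Hi. apply H. lia. Qed.

Lemma zsum_Rabs_le (lo hi : Z) (f g : Z -> R) :
  (forall i, (lo <= i <= hi)%Z -> Rabs (f i) <= g i) -> Rabs (zsum lo hi f) <= zsum lo hi g.
Proof.
  intros H. rewrite !zsum_rsum. eapply Rle_trans; [apply rsum_Rabs|].
  apply rsum_le. intros i Hi. apply H. lia.
Qed.

Lemma zsum_split (lo mid hi : Z) (f : Z -> R) : (lo <= mid + 1)%Z -> (mid <= hi)%Z ->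
  zsum lo hi f = zsum lo mid f + zsum (mid + 1) hi f.
Proof.
  intros H1 H2. rewrite !zsum_rsum.
  replace (Z.to_nat (hi - lo + 1)) with
    (Z.to_nat (mid - lo + 1) + Z.to_nat (hi - (mid + 1) + 1))%nat by lia.
  rewrite rsum_add. f_equal. apply rsum_ext. intros i Hi. f_equal. lia.
Qed.

Lemma zsum_opp_index (n : Z) (f : Z -> R) :
  zsum (- n) n (fun i => f (- i)%Z) = zsum (- n) n f.
Proof.
  rewrite !zsum_rsum. rewrite rsum_rev. apply rsum_ext. intros i Hi. f_equal. lia.
Qed.

Lemma zsum_support (lo hi lo' hi' : Z) (f : Z -> R) :
  (lo' <= lo)%Z -> (hi <= hi')%Z -> (lo <= hi + 1)%Z ->
  (forall i, (i < lo \/ hi < i)%Z -> f i = 0) ->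
  zsum lo' hi' f = zsum lo hi f.
Proof.
  intros H1 H2 H3 H.
  rewrite (zsum_split lo' (lo - 1) hi') by lia.
  rewrite (zsum_eq0 lo' (lo - 1)) by (intros; apply H; lia).
  replace (lo - 1 + 1)%Z with lo by lia.
  rewrite (zsum_split lo hi hi') by lia.
  rewrite (zsum_eq0 (hi + 1) hi') by (intros; apply H; lia). lra.
Qed.

(** * The sup norm on the plane *)

Definition nrm (x y : R) : R := Rmax (Rabs x) (Rabs y).

Lemma nrm_ge0 (x y : R) : 0 <= nrm x y.
Proof. unfold nrm. eapply Rle_trans; [apply Rabs_pos|apply Rmax_l]. Qed.

Lemma Rabs_le_nrm_l (x y : R) : Rabs x <= nrm x y.
Proof. apply Rmax_l. Qed.

Lemma Rabs_le_nrm_r (x y : R) : Rabs y <= nrm x y.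
Proof. apply Rmax_r. Qed.

Lemma nrm_lt (x y b : R) : Rabs x < b -> Rabs y < b -> nrm x y < b.
Proof. intros; now apply Rmax_lub_lt. Qed.

Lemma nrm_le (x y b : R) : Rabs x <= b -> Rabs y <= b -> nrm x y <= b.
Proof. intros; now apply Rmax_lub. Qed.

Lemma nrm_00 : nrm 0 0 = 0.
Proof. unfold nrm. rewrite Rabs_R0. apply Rmax_left; lra. Qed.

Lemma nrm_eq0 (x y : R) : nrm x y = 0 -> x = 0 /\ y = 0.
Proof.
  intros H. generalize (Rabs_le_nrm_l x y) (Rabs_le_nrm_r x y) (Rabs_pos x) (Rabs_pos y).
  intros. split; apply Rabs_eq_0; lra.
Qed.

Lemma nrm_pos (x y : R) : (x, y) <> (0, 0) -> 0 < nrm x y.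
Proof.
  intros H. destruct (Rle_lt_or_eq_dec _ _ (nrm_ge0 x y)) as [h|h]; auto.
  symmetry in h. apply nrm_eq0 in h as [-> ->]. now destruct H.
Qed.

Lemma nrm_pos_neq (x y : R) : 0 < nrm x y -> (x, y) <> (0, 0).
Proof. intros H E. injection E as -> ->. rewrite nrm_00 in H. lra. Qed.

Lemma nrm_mult (t x y : R) : nrm (t * x) (t * y) = Rabs t * nrm x y.
Proof. unfold nrm. rewrite !Rabs_mult, RmaxRmult; [reflexivity|apply Rabs_pos]. Qed.

Lemma nrm_opp (x y : R) : nrm (- x) (- y) = nrm x y.
Proof. unfold nrm. now rewrite !Rabs_Ropp. Qed.

Lemma nrm_lipschitz (x y u v : R) : Rabs (nrm u v - nrm x y) <= nrm (u - x) (v - y).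
Proof.
  assert (T : forall x y u v, nrm u v <= nrm x y + nrm (u - x) (v - y)).
  { intros x' y' u' v'. unfold nrm at 1. apply Rmax_lub.
    - replace u' with (x' + (u' - x')) at 1 by ring. eapply Rle_trans; [apply Rabs_triang|].
      apply Rplus_le_compat; apply Rabs_le_nrm_l.
    - replace v' with (y' + (v' - y')) at 1 by ring. eapply Rle_trans; [apply Rabs_triang|].
      apply Rplus_le_compat; apply Rabs_le_nrm_r. }
  apply Rabs_le. generalize (T x y u v) (T u v x y).
  replace (nrm (x - u) (y - v)) with (nrm (u - x) (v - y)); [lra|].
  rewrite <- (nrm_opp (x - u) (y - v)). f_equal; ring.
Qed.

Lemma locally_2d_nrm_lt (x y b : R) : nrm x y < b -> locally_2d (fun u v => nrm u v < b) x y.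
Proof.
  intros H. exists (mkposreal (b - nrm x y) (Rlt_Rminus _ _ H)). simpl.
  intros u v Hu Hv. generalize (nrm_lipschitz x y u v) (nrm_lt _ _ _ Hu Hv).
  intros H1 H2. apply Rabs_le_between in H1. lra.
Qed.

Lemma locally_2d_nrm_gt (x y b : R) : b < nrm x y -> locally_2d (fun u v => b < nrm u v) x y.
Proof.
  intros H. exists (mkposreal (nrm x y - b) (Rlt_Rminus _ _ H)). simpl.
  intros u v Hu Hv. generalize (nrm_lipschitz x y u v) (nrm_lt _ _ _ Hu Hv).
  intros H1 H2. apply Rabs_le_between in H1. lra.
Qed.

Definition open2 (U : R -> R -> Prop) : Prop := forall x y, U x y -> locally_2d U x y.

Lemma open2_and (U V : R -> R -> Prop) :
  open2 U -> open2 V -> open2 (fun x y => U x y /\ V x y).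
Proof. intros HU HV x y [h1 h2]. apply locally_2d_and; auto. Qed.

Lemma open2_True : open2 (fun _ _ => True).
Proof. intros x y _. now exists (mkposreal 1 Rlt_0_1). Qed.

Lemma open2_nrm_lt (b : R) : open2 (fun x y => nrm x y < b).
Proof. intros x y; apply locally_2d_nrm_lt. Qed.

Lemma open2_nrm_gt (b : R) : open2 (fun x y => b < nrm x y).
Proof. intros x y; apply locally_2d_nrm_gt. Qed.

Definition pball (b : R) (x y : R) : Prop := 0 < nrm x y < b.

Lemma open2_pball (b : R) : open2 (pball b).
Proof. apply open2_and; [apply open2_nrm_gt|apply open2_nrm_lt]. Qed.

(** * Differentiability classes with weights *)

Definition dx (f : R -> R -> R) (x y : R) : R := Derive (fun t => f t y) x.
Definition dy (f : R -> R -> R) (x y : R) : R := Derive (fun t => f x t) y.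

(* [Gn False n d U f]: [f] is [C^n] on [U] ([d] is ignored).  [Gn True n d U f] adds the symbol
   estimates [|D^al f| <= C * nrm ^ (d - |al|)] for [|al| <= n]. *)
Fixpoint Gn (b : Prop) (n : nat) (d : Z) (U : R -> R -> Prop) (f : R -> R -> R) : Prop :=
  (forall x y, U x y -> continuity_2d_pt f x y) /\
  (b -> exists C, forall x y, U x y -> Rabs (f x y) <= C * powerRZ (nrm x y) d) /\
  match n with
  | O => True
  | S k => (forall x y, U x y -> ex_derive (fun t => f t y) x /\ ex_derive (fun t => f x t) y) /\
           Gn b k (d - 1) U (dx f) /\ Gn b k (d - 1) U (dy f)
  end.

Section GnTheory.

Variable b : Prop.
Variable U : R -> R -> Prop.
Hypothesis openU : open2 U.
Hypothesis Upos : b -> forall x y, U x y -> 0 < nrm x y <= 1.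

Lemma Gn_continuity n d f : Gn b n d U f -> forall x y, U x y -> continuity_2d_pt f x y.
Proof. destruct n; intros H; apply H. Qed.

Lemma Gn_bound n d f : Gn b n d U f ->
  b -> exists C, forall x y, U x y -> Rabs (f x y) <= C * powerRZ (nrm x y) d.
Proof. destruct n; intros H; apply H. Qed.

Lemma Gn_pred n : forall d f, Gn b (S n) d U f -> Gn b n d U f.
Proof.
  induction n as [|n IH]; intros d f (H1 & H2 & H3 & H4 & H5).
  - repeat split; auto.
  - split; [auto|]. split; [auto|]. split; [auto|]. split; apply IH; auto.
Qed.

Lemma locally_eq (P Q : R -> R -> R) x y :
  (forall x y, U x y -> P x y = Q x y) -> U x y -> locally_2d (fun u v => P u v = Q u v) x y.
Proof.
  intros H Hxy. destruct (openU x y Hxy) as [e He]. exists e. intros; apply H; auto.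
Qed.

(** Openness of [U] makes equality on [U] an equality of germs, which passes to [dx] and [dy]. *)
Lemma Gn_ext n : forall d f g, (forall x y, U x y -> f x y = g x y) -> Gn b n d U f -> Gn b n d U g.
Proof.
  induction n as [|n IH]; intros d f g E H.
  - destruct H as (H1 & H2 & _). split; [|split; [|exact I]].
    + intros x y h. eapply continuity_2d_pt_ext_loc; [|now apply H1]. now apply locally_eq.
    + intros hb. destruct (H2 hb) as [C HC]. exists C. intros x y h. rewrite <- E; auto.
  - destruct H as (H1 & H2 & H3 & H4 & H5).
    assert (Lx : forall x y, U x y -> locally x (fun t => f t y = g t y)).
    { intros x y h. apply (locally_2d_1d_const_y (fun u v => f u v = g u v)). now apply locally_eq. }
    assert (Ly : forall x y, U x y -> locally y (fun t => f x t = g x t)).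
    { intros x y h. apply (locally_2d_1d_const_x (fun u v => f u v = g u v)). now apply locally_eq. }
    split; [|split; [|split; [|split]]].
    + intros x y h. eapply continuity_2d_pt_ext_loc; [|now apply H1]. now apply locally_eq.
    + intros hb. destruct (H2 hb) as [C HC]. exists C. intros x y h. rewrite <- E; auto.
    + intros x y h. destruct (H3 x y h) as [h1 h2]. split.
      * exact (ex_derive_ext_loc _ _ _ (Lx x y h) h1).
      * exact (ex_derive_ext_loc _ _ _ (Ly x y h) h2).
    + apply (IH _ (dx f)); auto. intros x y h. apply Derive_ext_loc, Lx, h.
    + apply (IH _ (dy f)); auto. intros x y h. apply Derive_ext_loc, Ly, h.
Qed.

Lemma Gn_intro n d f fx fy :
  (forall x y, U x y -> continuity_2d_pt f x y) ->
  (b -> exists C, forall x y, U x y -> Rabs (f x y) <= C * powerRZ (nrm x y) d) ->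
  (forall x y, U x y -> is_derive (fun t => f t y) x (fx x y)) ->
  (forall x y, U x y -> is_derive (fun t => f x t) y (fy x y)) ->
  Gn b n (d - 1) U fx -> Gn b n (d - 1) U fy -> Gn b (S n) d U f.
Proof.
  intros H1 H2 H3 H4 H5 H6. split; [auto|]. split; [auto|]. split; [|split].
  - intros x y h. split; eexists; [now apply H3|now apply H4].
  - apply (Gn_ext n _ fx); auto. intros x y h. symmetry. apply is_derive_unique. now apply H3.
  - apply (Gn_ext n _ fy); auto. intros x y h. symmetry. apply is_derive_unique. now apply H4.
Qed.

Lemma Gn_is_derive n d f : Gn b (S n) d U f -> forall x y, U x y ->
  is_derive (fun t => f t y) x (dx f x y) /\ is_derive (fun t => f x t) y (dy f x y).
Proof.
  intros (_ & _ & H & _) x y h. destruct (H x y h) as [h1 h2].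
  split; [exact (Derive_correct _ _ h1)|exact (Derive_correct _ _ h2)].
Qed.

(** The norm is at most 1 on [U], so a bound by a higher power is the stronger one; without weights
    [d] carries no information. *)
Lemma Gn_weight n : forall d e f, ((e <= d)%Z \/ ~ b) -> Gn b n d U f -> Gn b n e U f.
Proof.
  assert (W : forall d e f, ((e <= d)%Z \/ ~ b) ->
     (b -> exists C, forall x y, U x y -> Rabs (f x y) <= C * powerRZ (nrm x y) d) ->
     (b -> exists C, forall x y, U x y -> Rabs (f x y) <= C * powerRZ (nrm x y) e)).
  { intros d e f Hde H hb. destruct Hde as [Hde|Hde]; [|contradiction].
    destruct (H hb) as [C HC]. exists (Rabs C). intros x y h.
    destruct (Upos hb x y h) as [h1 h2].
    eapply Rle_trans; [now apply HC|].
    apply Rle_trans with (Rabs C * powerRZ (nrm x y) d).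
    { apply Rmult_le_compat_r; [now apply powerRZ_le|apply Rle_abs]. }
    apply Rmult_le_compat_l; [apply Rabs_pos|].
    replace d with (e + (d - e))%Z by lia. rewrite powerRZ_add by lra.
    rewrite <- (Rmult_1_r (powerRZ (nrm x y) e)) at 2.
    apply Rmult_le_compat_l; [now apply powerRZ_le|].
    rewrite <- (Z2Nat.id (d - e)) by lia. rewrite <- pow_powerRZ.
    rewrite <- (pow1 (Z.to_nat (d - e))). apply pow_incr. lra. }
  induction n as [|n IH]; intros d e f Hde (H1 & H2 & H3).
  - split; [auto|]. split; [|exact I]. now apply (W d).
  - destruct H3 as (H3 & H4 & H5). split; [auto|]. split; [now apply (W d)|].
    split; [auto|].
    assert ((e - 1 <= d - 1)%Z \/ ~ b) by (destruct Hde; [left; lia|now right]).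
    split; now apply (IH (d - 1)%Z).
Qed.

Lemma Gn_plus n : forall d f g, Gn b n d U f -> Gn b n d U g -> Gn b n d U (fun x y => f x y + g x y).
Proof.
  assert (B : forall d f g,
     (b -> exists C, forall x y, U x y -> Rabs (f x y) <= C * powerRZ (nrm x y) d) ->
     (b -> exists C, forall x y, U x y -> Rabs (g x y) <= C * powerRZ (nrm x y) d) ->
     (b -> exists C, forall x y, U x y -> Rabs (f x y + g x y) <= C * powerRZ (nrm x y) d)).
  { intros d f g Hf Hg hb. destruct (Hf hb) as [C HC]; destruct (Hg hb) as [C' HC'].
    exists (C + C'). intros x y h. eapply Rle_trans; [apply Rabs_triang|].
    rewrite Rmult_plus_distr_r. apply Rplus_le_compat; auto. }
  induction n as [|n IH]; intros d f g Hf Hg.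
  - destruct Hf as (H1 & H2 & _); destruct Hg as (G1 & G2 & _).
    split; [|split; [now apply B|exact I]]. intros; apply continuity_2d_pt_plus; auto.
  - generalize (Gn_is_derive _ _ _ Hf) (Gn_is_derive _ _ _ Hg). intros Df Dg.
    destruct Hf as (H1 & H2 & H3 & H4 & H5); destruct Hg as (G1 & G2 & G3 & G4 & G5).
    apply (Gn_intro n d _ (fun x y => dx f x y + dx g x y) (fun x y => dy f x y + dy g x y)).
    + intros; apply continuity_2d_pt_plus; auto.
    + now apply B.
    + intros x y h. apply (is_derive_plus (fun t => f t y) (fun t => g t y)); [apply Df|apply Dg]; auto.
    + intros x y h. apply (is_derive_plus (fun t => f x t) (fun t => g x t)); [apply Df|apply Dg]; auto.
    + now apply IH.
    + now apply IH.
Qed.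

Lemma Gn_mult n : forall d e f g, Gn b n d U f -> Gn b n e U g ->
  Gn b n (d + e) U (fun x y => f x y * g x y).
Proof.
  assert (B : forall d e f g,
     (b -> exists C, forall x y, U x y -> Rabs (f x y) <= C * powerRZ (nrm x y) d) ->
     (b -> exists C, forall x y, U x y -> Rabs (g x y) <= C * powerRZ (nrm x y) e) ->
     (b -> exists C, forall x y, U x y -> Rabs (f x y * g x y) <= C * powerRZ (nrm x y) (d + e))).
  { intros d e f g Hf Hg hb. destruct (Hf hb) as [C HC]; destruct (Hg hb) as [C' HC'].
    exists (C * C'). intros x y h. rewrite Rabs_mult, powerRZ_add.
    2: { generalize (Upos hb x y h); lra. }
    replace (C * C' * (powerRZ (nrm x y) d * powerRZ (nrm x y) e)) with
      (C * powerRZ (nrm x y) d * (C' * powerRZ (nrm x y) e)) by ring.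
    apply Rmult_le_compat; auto using Rabs_pos. }
  induction n as [|n IH]; intros d e f g Hf Hg.
  - destruct Hf as (H1 & H2 & _); destruct Hg as (G1 & G2 & _).
    split; [|split; [now apply B|exact I]]. intros; apply continuity_2d_pt_mult; auto.
  - generalize (Gn_is_derive _ _ _ Hf) (Gn_is_derive _ _ _ Hg). intros Df Dg.
    generalize (Gn_pred _ _ _ Hf) (Gn_pred _ _ _ Hg). intros Pf Pg.
    destruct Hf as (H1 & H2 & H3 & H4 & H5); destruct Hg as (G1 & G2 & G3 & G4 & G5).
    apply (Gn_intro n (d + e) _ (fun x y => dx f x y * g x y + f x y * dx g x y)
              (fun x y => dy f x y * g x y + f x y * dy g x y)).
    + intros; apply continuity_2d_pt_mult; auto.
    + now apply B.
    + intros x y h. apply (is_derive_mult (fun t => f t y) (fun t => g t y)).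
      apply Df; auto. apply Dg; auto. intros; apply Rmult_comm.
    + intros x y h. apply (is_derive_mult (fun t => f x t) (fun t => g x t)).
      apply Df; auto. apply Dg; auto. intros; apply Rmult_comm.
    + apply Gn_plus; [replace (d + e - 1)%Z with (d - 1 + e)%Z by lia|
                      replace (d + e - 1)%Z with (d + (e - 1))%Z by lia]; now apply IH.
    + apply Gn_plus; [replace (d + e - 1)%Z with (d - 1 + e)%Z by lia|
                      replace (d + e - 1)%Z with (d + (e - 1))%Z by lia]; now apply IH.
Qed.

Lemma Gn_0 n : forall d, Gn b n d U (fun _ _ => 0).
Proof.
  assert (B : forall d, b -> exists C, forall x y, U x y -> Rabs 0 <= C * powerRZ (nrm x y) d).
  { intros d _. exists 0. intros. rewrite Rabs_R0. lra. }
  induction n as [|n IH]; intros d.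
  - split; [|split; [auto|exact I]]. intros; apply continuity_2d_pt_const.
  - apply (Gn_intro n d _ (fun _ _ => 0) (fun _ _ => 0)); auto.
    + intros; apply continuity_2d_pt_const.
    + intros; apply is_derive_cst.
    + intros; apply is_derive_cst.
Qed.

Lemma Gn_const n c : Gn b n 0 U (fun _ _ => c).
Proof.
  assert (B : b -> exists C, forall x y, U x y -> Rabs c <= C * powerRZ (nrm x y) 0).
  { intros _. exists (Rabs c). intros. simpl. lra. }
  destruct n as [|n].
  - split; [|split; [auto|exact I]]. intros; apply continuity_2d_pt_const.
  - apply (Gn_intro n 0 _ (fun _ _ => 0) (fun _ _ => 0)); auto using Gn_0.
    + intros; apply continuity_2d_pt_const.
    + intros; apply is_derive_cst.
    + intros; apply is_derive_cst.
Qed.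

Lemma Gn_scal n d c f : Gn b n d U f -> Gn b n d U (fun x y => c * f x y).
Proof. intros H. exact (Gn_mult n 0 d _ _ (Gn_const n c) H). Qed.

Lemma Gn_minus n d f g : Gn b n d U f -> Gn b n d U g -> Gn b n d U (fun x y => f x y - g x y).
Proof.
  intros H1 H2. apply (Gn_ext n d (fun x y => f x y + (-1) * g x y)); [intros; ring|].
  apply Gn_plus; auto. now apply Gn_scal.
Qed.

Lemma Gn_x n : Gn b n 1 U (fun x _ => x).
Proof.
  assert (B : b -> exists C, forall x y, U x y -> Rabs x <= C * powerRZ (nrm x y) 1).
  { intros _. exists 1. intros. simpl. generalize (Rabs_le_nrm_l x y). lra. }
  destruct n as [|n].
  - split; [|split; [auto|exact I]]. intros; apply continuity_2d_pt_id1.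
  - apply (Gn_intro n 1 _ (fun _ _ => 1) (fun _ _ => 0)); auto using Gn_0.
    + intros; apply continuity_2d_pt_id1.
    + intros; apply is_derive_idR.
    + intros; apply is_derive_cst.
    + apply Gn_const.
Qed.

Lemma Gn_y n : Gn b n 1 U (fun _ y => y).
Proof.
  assert (B : b -> exists C, forall x y, U x y -> Rabs y <= C * powerRZ (nrm x y) 1).
  { intros _. exists 1. intros. simpl. generalize (Rabs_le_nrm_r x y). lra. }
  destruct n as [|n].
  - split; [|split; [auto|exact I]]. intros; apply continuity_2d_pt_id2.
  - apply (Gn_intro n 1 _ (fun _ _ => 0) (fun _ _ => 1)); auto using Gn_0.
    + intros; apply continuity_2d_pt_id2.
    + intros; apply is_derive_cst.
    + intros; apply is_derive_idR.
    + apply Gn_const.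
Qed.

Lemma Gn_pow n d f k : Gn b n d U f -> Gn b n (d * Z.of_nat k) U (fun x y => f x y ^ k).
Proof.
  intros H. induction k as [|k IH].
  - replace (d * Z.of_nat 0)%Z with 0%Z by lia. simpl. apply Gn_const.
  - replace (d * Z.of_nat (S k))%Z with (d + d * Z.of_nat k)%Z by lia. simpl. now apply Gn_mult.
Qed.

Lemma Gn_rsum n d k (f : nat -> R -> R -> R) : (forall i, (i < k)%nat -> Gn b n d U (f i)) ->
  Gn b n d U (fun x y => rsum k (fun i => f i x y)).
Proof.
  induction k as [|k IH]; intros H.
  - apply (Gn_ext n d (fun _ _ => 0)); [reflexivity|apply Gn_0].
  - apply (Gn_ext n d (fun x y => rsum k (fun i => f i x y) + f k x y)).
    + intros; symmetry; apply rsum_S.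
    + apply Gn_plus; auto.
Qed.

(* Outer functions come as a class graded by the weight of the composite and closed under
   differentiation, which lowers the weight by that of the inner function. *)
Lemma Gn_comp (P : Z -> (R -> R) -> Prop) (V : R -> Prop) (e : Z) (f : R -> R -> R) :
  (forall d g, P d g -> exists g', P (d - e)%Z g' /\ forall z, V z -> is_derive g z (g' z)) ->
  (forall x y, U x y -> V (f x y)) ->
  (forall d g, P d g -> b -> exists C, forall x y, U x y ->
      Rabs (g (f x y)) <= C * powerRZ (nrm x y) d) ->
  forall n d g, P d g -> Gn b n e U f -> Gn b n d U (fun x y => g (f x y)).
Proof.
  intros HD HV HB. induction n as [|n IH]; intros d g Hg Hf.
  - destruct (HD d g Hg) as [g' [Pg' Dg]]. destruct Hf as (H1 & _).
    split; [|split; [now apply HB|exact I]].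
    intros x y h. apply continuity_1d_2d_pt_comp; auto.
    apply continuity_pt_filterlim. apply (ex_derive_continuous g). exists (g' (f x y)). apply Dg; auto.
  - destruct (HD d g Hg) as [g' [Pg' Dg]].
    generalize (Gn_is_derive _ _ _ Hf) (Gn_pred _ _ _ Hf); intros Df Pf.
    destruct Hf as (H1 & H2 & H3 & H4 & H5).
    apply (Gn_intro n d _ (fun x y => g' (f x y) * dx f x y) (fun x y => g' (f x y) * dy f x y)).
    + intros x y h. apply continuity_1d_2d_pt_comp; auto.
      apply continuity_pt_filterlim. apply (ex_derive_continuous g). exists (g' (f x y)). apply Dg; auto.
    + now apply HB.
    + intros x y h. rewrite Rmult_comm. apply (is_derive_comp g (fun t => f t y)); [now apply Dg, HV|now apply Df].
    + intros x y h. rewrite Rmult_comm. apply (is_derive_comp g (fun t => f x t)); [now apply Dg, HV|now apply Df].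
    + replace (d - 1)%Z with (d - e + (e - 1))%Z by lia. apply Gn_mult; auto.
    + replace (d - 1)%Z with (d - e + (e - 1))%Z by lia. apply Gn_mult; auto.
Qed.

End GnTheory.

Lemma Gn_mono (b : Prop) (U V : R -> R -> Prop) n : forall d f,
  (forall x y, V x y -> U x y) -> Gn b n d U f -> Gn b n d V f.
Proof.
  induction n as [|n IH]; intros d f HVU (H1 & H2 & H3).
  - split; [auto|]. split; [|exact I]. intros hb; destruct (H2 hb) as [C HC]; exists C; auto.
  - split; [auto|]. split; [intros hb; destruct (H2 hb) as [C HC]; exists C; auto|].
    destruct H3 as (H3 & H4 & H5). split; [auto|]. split; auto.
Qed.

(** * Differentiability classes without weights *)

Definition Cn (n : nat) (U : R -> R -> Prop) (f : R -> R -> R) : Prop := Gn False n 0 U f.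

Lemma Gn_Cn b n U : forall d f, Gn b n d U f -> Cn n U f.
Proof.
  unfold Cn. generalize 0%Z. induction n as [|n IH]; intros e d f (H1 & H2 & H3).
  - split; [auto|]. split; [contradiction|exact I].
  - split; [auto|]. split; [contradiction|]. destruct H3 as (H3 & H4 & H5). split; [auto|].
    split; [now apply (IH _ (d - 1)%Z)|now apply (IH _ (d - 1)%Z)].
Qed.

Lemma Cn_Gn n U d f : Cn n U f -> Gn False n d U f.
Proof.
  unfold Cn. generalize 0%Z. revert d f. induction n as [|n IH]; intros e f d (H1 & H2 & H3).
  - split; [auto|]. split; [contradiction|exact I].
  - split; [auto|]. split; [contradiction|]. destruct H3 as (H3 & H4 & H5). split; [auto|].
    split; [now apply (IH _ _ (d - 1)%Z)|now apply (IH _ _ (d - 1)%Z)].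
Qed.

Lemma Cn_dx n U f : Cn (S n) U f -> Cn n U (dx f).
Proof. intros (_ & _ & _ & H & _). now apply Gn_Cn in H. Qed.

Lemma Cn_dy n U f : Cn (S n) U f -> Cn n U (dy f).
Proof. intros (_ & _ & _ & _ & H). now apply Gn_Cn in H. Qed.

Lemma Cn_intro n U f :
  (forall x y, U x y -> continuity_2d_pt f x y) ->
  (forall x y, U x y -> ex_derive (fun t => f t y) x /\ ex_derive (fun t => f x t) y) ->
  Cn n U (dx f) -> Cn n U (dy f) -> Cn (S n) U f.
Proof.
  intros H1 H2 H3 H4. split; [auto|]. split; [contradiction|]. split; [auto|].
  split; now apply Cn_Gn.
Qed.

Lemma Cn_le n m U f : (m <= n)%nat -> Cn n U f -> Cn m U f.
Proof. induction 1 as [|n H IH]; intros; auto. apply IH. now apply Gn_pred. Qed.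

(** [Derive] is total, so [dx f] is the same function whichever set is considered, and every clause
    of the class is a condition at single points. Used to glue smoothness near the origin to
    smoothness away from it. *)
Lemma Cn_union n : forall (U V : R -> R -> Prop) f,
  Cn n U f -> Cn n V f -> Cn n (fun x y => U x y \/ V x y) f.
Proof.
  induction n as [|n IH]; intros U V f HU HV.
  - destruct HU as (HU & _), HV as (HV & _). split; [|split; [contradiction|exact I]].
    intros x y [h|h]; auto.
  - apply Cn_intro.
    + destruct HU as (HU & _), HV as (HV & _). intros x y [h|h]; auto.
    + destruct HU as (_ & _ & HU & _), HV as (_ & _ & HV & _). intros x y [h|h]; auto.
    + apply IH; now apply Cn_dx.
    + apply IH; now apply Cn_dy.
Qed.

Section CnTheory.

Variable U : R -> R -> Prop.
Hypothesis openU : open2 U.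

Let no_weight : False -> forall x y, U x y -> 0 < nrm x y <= 1.
Proof. contradiction. Qed.

Lemma Cn_ext n f g : (forall x y, U x y -> f x y = g x y) -> Cn n U f -> Cn n U g.
Proof. exact (Gn_ext False U openU n 0 f g). Qed.

Lemma Cn_const n c : Cn n U (fun _ _ => c).
Proof. exact (Gn_const False U openU n c). Qed.

Lemma Cn_plus n f g : Cn n U f -> Cn n U g -> Cn n U (fun x y => f x y + g x y).
Proof. exact (Gn_plus False U openU n 0 f g). Qed.

Lemma Cn_mult n f g : Cn n U f -> Cn n U g -> Cn n U (fun x y => f x y * g x y).
Proof. exact (Gn_mult False U openU no_weight n 0 0 f g). Qed.

Lemma Cn_scal n c f : Cn n U f -> Cn n U (fun x y => c * f x y).
Proof. exact (Gn_scal False U openU no_weight n 0 c f). Qed.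

Lemma Cn_minus n f g : Cn n U f -> Cn n U g -> Cn n U (fun x y => f x y - g x y).
Proof. exact (Gn_minus False U openU no_weight n 0 f g). Qed.

Lemma Cn_x n : Cn n U (fun x _ => x).
Proof. exact (Gn_Cn _ _ _ _ _ (Gn_x False U openU n)). Qed.

Lemma Cn_y n : Cn n U (fun _ y => y).
Proof. exact (Gn_Cn _ _ _ _ _ (Gn_y False U openU n)). Qed.

Lemma Cn_pow n f k : Cn n U f -> Cn n U (fun x y => f x y ^ k).
Proof. exact (Gn_pow False U openU no_weight n 0 f k). Qed.

Lemma Cn_rsum n k (f : nat -> R -> R -> R) : (forall i, (i < k)%nat -> Cn n U (f i)) ->
  Cn n U (fun x y => rsum k (fun i => f i x y)).
Proof. exact (Gn_rsum False U openU n 0 k f). Qed.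

Lemma Cn_monomial n i l : Cn n U (fun x y => x ^ i * y ^ l).
Proof.
  apply Cn_mult; [exact (Cn_pow n (fun x _ => x) i (Cn_x n))|exact (Cn_pow n (fun _ y => y) l (Cn_y n))].
Qed.

End CnTheory.

Lemma Cn_mono (U V : R -> R -> Prop) n f : (forall x y, V x y -> U x y) -> Cn n U f -> Cn n V f.
Proof. exact (Gn_mono False U V n 0 f). Qed.

Lemma Cn_pd (U : R -> R -> Prop) ds : forall k f, Cn (length ds + k) U f -> Cn k U (pd ds f).
Proof.
  induction ds as [|d ds IH]; intros k f H; [exact H|].
  assert (H' : Cn (S k) U (pd ds f)) by (apply IH; now rewrite Nat.add_succ_r).
  destruct d; simpl; [now apply Cn_dx in H'|now apply Cn_dy in H'].
Qed.

Lemma Cn_smooth_on (U : R -> R -> Prop) f : (forall n, Cn n U f) -> smooth_on U f.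
Proof.
  intros H ds x y h. generalize (Cn_pd U ds 1 f (H _)). intros (H1 & _ & H2 & _).
  destruct (H2 x y h) as [h1 h2]. auto.
Qed.

Lemma smooth_on_Cn (U : R -> R -> Prop) f : smooth_on U f -> forall n, Cn n U f.
Proof.
  (* [dx (pd ds f)] is [pd (true :: ds) f]: the induction on [n] closes only for all partials of [f]
     at once. *)
  intros H n. change f with (pd nil f). generalize (@nil bool).
  induction n as [|n IH]; intros ds.
  - split; [|split; [contradiction|exact I]]. intros x y h. now apply H.
  - apply Cn_intro.
    + intros x y h. now apply H.
    + intros x y h. destruct (H ds x y h) as (h1 & h2 & _). auto.
    + exact (IH (true :: ds)).
    + exact (IH (false :: ds)).
Qed.

(** Weight [d >= n + 1] leaves weight at least 1 to every derivative of order up to [n], hence the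
    limit 0 at the origin. While a derivative remains to be taken the weight is at least 2, so the
    function is [O(t^2)] along the axes and both partials at the origin exist and equal 0; this is
    the condition [f 0 0 = 0] of the next step. *)
Lemma Gn_extends_at_0 (r : R) n : 0 < r -> forall d f, (Z.of_nat n + 1 <= d)%Z -> f 0 0 = 0 ->
  Gn True n d (pball r) f -> Cn n (fun x y => nrm x y < r) f.
Proof.
  intros Hr.
  assert (Est : forall d f, (1 <= d)%Z -> f 0 0 = 0 ->
     (True -> exists C, forall x y, pball r x y -> Rabs (f x y) <= C * powerRZ (nrm x y) d) ->
     exists C, 0 <= C /\ forall x y, nrm x y < r -> Rabs (f x y) <= C * nrm x y ^ Z.to_nat d).
  { intros d f Hd f0 H. destruct (H Logic.I) as [C HC]. exists (Rabs C). split; [apply Rabs_pos|].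
    intros x y h. destruct (Rle_lt_or_eq_dec _ _ (nrm_ge0 x y)) as [h0|h0].
    - eapply Rle_trans; [apply HC; now split|]. rewrite pow_powerRZ, Z2Nat.id by lia.
      apply Rmult_le_compat_r; [now apply powerRZ_le|apply Rle_abs].
    - symmetry in h0. destruct (nrm_eq0 _ _ h0) as [-> ->]. rewrite f0, Rabs_R0.
      apply Rmult_le_pos; [apply Rabs_pos|apply pow_le, nrm_ge0]. }
  assert (Cont : forall d f, (1 <= d)%Z -> f 0 0 = 0 ->
     (forall x y, pball r x y -> continuity_2d_pt f x y) ->
     (True -> exists C, forall x y, pball r x y -> Rabs (f x y) <= C * powerRZ (nrm x y) d) ->
     forall x y, nrm x y < r -> continuity_2d_pt f x y).
  { intros d f Hd f0 Hc H x y h.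
    destruct (Rle_lt_or_eq_dec _ _ (nrm_ge0 x y)) as [h0|h0]; [apply Hc; now split|].
    symmetry in h0. destruct (nrm_eq0 _ _ h0) as [-> ->].
    destruct (Est d f Hd f0 H) as [C [C0 HC]].
    intros eps. assert (He : 0 < Rmin (Rmin r 1) (eps / (C + 1))).
    { repeat apply Rmin_pos; try lra. apply Rdiv_lt_0_compat; [apply cond_pos|lra]. }
    exists (mkposreal _ He). simpl. intros u v Hu Hv. rewrite Rminus_0_r in Hu, Hv.
    generalize (nrm_lt _ _ _ Hu Hv). intros Hn.
    assert (N1 : nrm u v < r) by (eapply Rlt_le_trans; [exact Hn|]; eapply Rle_trans; apply Rmin_l).
    assert (N2 : nrm u v < 1).
    { eapply Rlt_le_trans; [exact Hn|]. eapply Rle_trans; [apply Rmin_l|apply Rmin_r]. }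
    assert (N3 : nrm u v < eps / (C + 1)) by (eapply Rlt_le_trans; [exact Hn|]; apply Rmin_r).
    rewrite f0, Rminus_0_r. eapply Rle_lt_trans; [now apply HC|].
    generalize (nrm_ge0 u v); intros N0.
    replace (Z.to_nat d) with (S (Z.to_nat d - 1)) by lia. simpl.
    assert (P1 : 0 <= nrm u v ^ (Z.to_nat d - 1) <= 1).
    { split; [now apply pow_le|]. rewrite <- (pow1 (Z.to_nat d - 1)). apply pow_incr; lra. }
    apply Rle_lt_trans with ((C + 1) * nrm u v).
    - set (t := nrm u v) in *. assert (t * t ^ (Z.to_nat d - 1) <= t) by nra. nra.
    - apply Rmult_lt_compat_l with (r := C + 1) in N3; [|lra].
      replace ((C + 1) * (eps / (C + 1))) with (pos eps) in N3 by (field; lra). exact N3. }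
  (* Stated for a function [k] of one variable, to serve for both slices through the origin. *)
  assert (Der : forall d f (k : R -> R), (2 <= d)%Z -> f 0 0 = 0 ->
     (True -> exists C, forall x y, pball r x y -> Rabs (f x y) <= C * powerRZ (nrm x y) d) ->
     k 0 = 0 ->
     (forall t, Rabs t < r -> exists u v, nrm u v = Rabs t /\ k t = f u v) ->
     is_derive k 0 0).
  { intros d f k Hd f0 H k0 Hk. destruct (Est d f ltac:(lia) f0 H) as [C [C0 HC]].
    split; [apply is_linear_scal_l|]. intros x Hx.
    apply (is_filter_lim_locally_unique (K := R_AbsRing) (V := R_NormedModule)) in Hx. subst x.
    intros eps. assert (He : 0 < Rmin (Rmin r 1) (eps / (C + 1))).
    { repeat apply Rmin_pos; try lra. apply Rdiv_lt_0_compat; [apply cond_pos|lra]. }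
    exists (mkposreal _ He). intros t Ht.
    change (Rabs (t - 0) < Rmin (Rmin r 1) (eps / (C + 1))) in Ht.
    change (Rabs (k t - k 0 - (t - 0) * 0) <= eps * Rabs (t - 0)). rewrite Rminus_0_r in *.
    rewrite k0. replace (k t - 0 - t * 0) with (k t) by ring.
    assert (N1 : Rabs t < r) by (eapply Rlt_le_trans; [exact Ht|]; eapply Rle_trans; apply Rmin_l).
    assert (N2 : Rabs t < 1).
    { eapply Rlt_le_trans; [exact Ht|]. eapply Rle_trans; [apply Rmin_l|apply Rmin_r]. }
    assert (N3 : Rabs t < eps / (C + 1)) by (eapply Rlt_le_trans; [exact Ht|]; apply Rmin_r).
    destruct (Hk t N1) as (u & v & E & ->).
    eapply Rle_trans; [apply HC; lra|]. rewrite E.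
    replace (Z.to_nat d) with (S (S (Z.to_nat d - 2))) by lia. simpl.
    generalize (Rabs_pos t); intros N0.
    assert (P1 : 0 <= Rabs t ^ (Z.to_nat d - 2) <= 1).
    { split; [now apply pow_le|]. rewrite <- (pow1 (Z.to_nat d - 2)). apply pow_incr; lra. }
    apply Rmult_lt_compat_l with (r := C + 1) in N3; [|lra].
    replace ((C + 1) * (eps / (C + 1))) with (pos eps) in N3 by (field; lra).
    set (s := Rabs t) in *. assert (s * (s * s ^ (Z.to_nat d - 2)) <= s * s) by nra. nra. }
  induction n as [|n IH]; intros d f Hd f0 Hf.
  - destruct Hf as (H1 & H2 & _). split; [|split; [contradiction|exact I]].
    now apply (Cont d f ltac:(lia)).
  - generalize Hf; intros (H1 & H2 & H3 & H4 & H5).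
    assert (D1 : is_derive (fun t => f t 0) 0 0).
    { apply (Der d f (fun t => f t 0) ltac:(lia) f0 H2 f0). intros t Ht. exists t, 0. split; [|reflexivity].
      unfold nrm. rewrite Rabs_R0. apply Rmax_left, Rabs_pos. }
    assert (D2 : is_derive (fun t => f 0 t) 0 0).
    { apply (Der d f (fun t => f 0 t) ltac:(lia) f0 H2 f0). intros t Ht. exists 0, t. split; [|reflexivity].
      unfold nrm. rewrite Rabs_R0. apply Rmax_right, Rabs_pos. }
    apply Cn_intro.
    + now apply (Cont d f ltac:(lia)).
    + intros x y h. destruct (Rle_lt_or_eq_dec _ _ (nrm_ge0 x y)) as [h0|h0]; [now apply H3|].
      symmetry in h0. destruct (nrm_eq0 _ _ h0) as [-> ->]. split; eexists; eauto.
    + apply (IH (d - 1)%Z); [lia| |exact H4]. now apply is_derive_unique.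
    + apply (IH (d - 1)%Z); [lia| |exact H5]. now apply is_derive_unique.
Qed.

(** * Powers *)

Lemma is_derive_Rpower (al z : R) : 0 < z ->
  is_derive (fun t => Rpower t al) z (al * Rpower z (al - 1)).
Proof. intros H. apply is_derive_Reals. now apply derivable_pt_lim_power. Qed.

(** The power is monotone in [t], in the direction given by the sign of [al]; the sum of the end
    values covers both cases. *)
Lemma Rpower_le_ends (al lo hi t : R) : 0 < lo -> lo <= t <= hi ->
  Rpower t al <= Rpower lo al + Rpower hi al.
Proof.
  intros Hlo Ht. unfold Rpower.
  assert (L1 : ln lo <= ln t) by (destruct (Req_dec lo t) as [->|]; [lra|]; left; apply ln_increasing; lra).
  assert (L2 : ln t <= ln hi) by (destruct (Req_dec t hi) as [->|]; [lra|]; left; apply ln_increasing; lra).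
  assert (Mono : forall u v, u <= v -> exp u <= exp v).
  { intros u v [h|h]; [left; now apply exp_increasing|rewrite h; lra]. }
  generalize (exp_pos (al * ln lo)) (exp_pos (al * ln hi)).
  destruct (Rle_dec 0 al) as [h|h].
  - assert (exp (al * ln t) <= exp (al * ln hi)) by (apply Mono; nra). lra.
  - assert (exp (al * ln t) <= exp (al * ln lo)) by (apply Mono; nra). lra.
Qed.

Lemma Cn_Rpower (U : R -> R -> Prop) n f al : open2 U ->
  (forall x y, U x y -> 0 < f x y) -> Cn n U f -> Cn n U (fun x y => Rpower (f x y) al).
Proof.
  intros HU Hpos Hf.
  refine (Gn_comp False U HU _ (fun _ g => exists c a, g = fun z => c * Rpower z a)
     (fun z => 0 < z) 0 f _ Hpos _ n 0 (fun z => Rpower z al) _ Hf).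
  - contradiction.
  - intros d g (c & a & ->). exists (fun z => (c * a) * Rpower z (a - 1)). split; [eauto|].
    intros z hz. rewrite Rmult_assoc. apply (is_derive_scal (fun t => Rpower t a)). now apply is_derive_Rpower.
  - contradiction.
  - exists 1, al. apply functional_extensionality. intros; ring.
Qed.

Lemma Rpower_nrm2 (d : Z) (t : R) : 0 < t -> Rpower (t ^ 2) (IZR d / 2) = powerRZ t d.
Proof.
  intros H. rewrite powerRZ_Rpower by auto. rewrite <- Rpower_pow by auto. rewrite Rpower_mult.
  f_equal. simpl. field.
Qed.

(** The functions [c * z^(d/2)] form a graded class as [Gn_comp] asks: a derivative lowers [d] by 2,
    the weight of [f]. Their bounds hold because [f / nrm^2] stays in the compact interval from [lo]
    to [hi], away from 0. *)
Lemma Gn_Rpower_half (U : R -> R -> Prop) (lo hi : R) n f (d : Z) : open2 U ->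
  (forall x y, U x y -> 0 < nrm x y <= 1) -> 0 < lo ->
  (forall x y, U x y -> lo * nrm x y ^ 2 <= f x y <= hi * nrm x y ^ 2) ->
  Gn True n 2 U f -> Gn True n d U (fun x y => Rpower (f x y) (IZR d / 2)).
Proof.
  intros HU Hn Hlo Hf HG.
  assert (Hpos : forall x y, U x y -> 0 < f x y).
  { intros x y h. destruct (Hn x y h) as [h1 _]. generalize (Hf x y h) (pow_lt _ 2 h1). nra. }
  refine (Gn_comp True U HU (fun _ => Hn) (fun d g => exists c, g = fun z => c * Rpower z (IZR d / 2))
     (fun z => 0 < z) 2 f _ Hpos _ n d (fun z => Rpower z (IZR d / 2)) _ HG).
  - intros e g (c & ->). exists (fun z => (c * (IZR e / 2)) * Rpower z (IZR (e - 2) / 2)). split; [eauto|].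
    intros z hz. rewrite Rmult_assoc. apply (is_derive_scal (fun t => Rpower t (IZR e / 2))).
    replace (IZR (e - 2) / 2) with (IZR e / 2 - 1) by (rewrite minus_IZR; field).
    now apply is_derive_Rpower.
  - intros e g (c & ->) _. exists (Rabs c * (Rpower lo (IZR e / 2) + Rpower hi (IZR e / 2))).
    intros x y h. destruct (Hn x y h) as [h1 _]. assert (h2 : 0 < nrm x y ^ 2) by now apply pow_lt.
    rewrite Rabs_mult, Rmult_assoc. apply Rmult_le_compat_l; [apply Rabs_pos|].
    rewrite Rabs_pos_eq by (left; apply exp_pos).
    replace (f x y) with ((f x y / nrm x y ^ 2) * nrm x y ^ 2) by (field; lra).
    assert (h3 : lo <= f x y / nrm x y ^ 2 <= hi).
    { generalize (Hf x y h). intros [a1 a2].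
      split; [apply Rle_div_r|apply Rle_div_l]; auto. }
    rewrite <- Rpower_mult_distr by (auto; lra).
    rewrite Rpower_nrm2 by auto. apply Rmult_le_compat_r; [now apply powerRZ_le|].
    now apply Rpower_le_ends.
  - exists 1. apply functional_extensionality. intros; ring.
Qed.

(** * Taylor expansion at the origin *)

Definition Smooth (f : R -> R -> R) : Prop := forall n, Cn n (fun _ _ => True) f.

Lemma Smooth_dx f : Smooth f -> Smooth (dx f).
Proof. intros H n. apply Cn_dx, H. Qed.

Lemma Smooth_dy f : Smooth f -> Smooth (dy f).
Proof. intros H n. apply Cn_dy, H. Qed.

Lemma Smooth_is_derive f : Smooth f -> forall x y,
  is_derive (fun t => f t y) x (dx f x y) /\ is_derive (fun t => f x t) y (dy f x y).
Proof. intros H x y. exact (Gn_is_derive _ _ 0 0 f (H 1%nat) x y Logic.I). Qed.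

Lemma Smooth_continuity f : Smooth f -> forall x y, continuity_2d_pt f x y.
Proof. intros H x y. exact (Gn_continuity _ _ 0 0 f (H 0%nat) x y Logic.I). Qed.

Lemma dxdy_comm f : Smooth f -> dx (dy f) = dy (dx f).
Proof.
  intros H. apply functional_extensionality; intros x. apply functional_extensionality; intros y.
  apply Schwarz.
  - exists (mkposreal 1 Rlt_0_1). intros u v _ _.
    generalize (Smooth_is_derive f H u v) (Smooth_is_derive _ (Smooth_dx _ H) u v)
      (Smooth_is_derive _ (Smooth_dy _ H) u v).
    intros [h1 h2] [h3 h4] [h5 h6].
    split; [eexists; exact h1|]. split; [eexists; exact h2|].
    split; [eexists; exact h5|eexists; exact h4].
  - exact (Smooth_continuity _ (Smooth_dx _ (Smooth_dy _ H)) x y).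
  - exact (Smooth_continuity _ (Smooth_dy _ (Smooth_dx _ H)) x y).
Qed.

(* Euler's identity [j T_j = x (T_j)_x + y (T_j)_y], with [(T_j)_x] the Taylor term of [f_x]. *)
Fixpoint tc (j : nat) (f : R -> R -> R) (l : nat) : R :=
  match j with
  | O => match l with O => f 0 0 | S _ => 0 end
  | S k => (tc k (dx f) l + match l with O => 0 | S l' => tc k (dy f) l' end) / INR (S k)
  end.

Definition T (j : nat) (f : R -> R -> R) (x y : R) : R :=
  rsum (S j) (fun l => tc j f l * (x ^ (j - l) * y ^ l)).

Lemma tc_gt j : forall f l, (j < l)%nat -> tc j f l = 0.
Proof.
  induction j as [|j IH]; intros f l Hl; simpl.
  - destruct l; [lia|reflexivity].
  - destruct l as [|l]; [lia|]. rewrite !IH by lia. unfold Rdiv. ring.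
Qed.

Lemma T_0 f x y : T 0 f x y = f 0 0.
Proof. unfold T. rewrite rsum_S, rsum_0. simpl. ring. Qed.

Lemma T_S j f x y : T (S j) f x y = (x * T j (dx f) x y + y * T j (dy f) x y) / INR (S j).
Proof.
  unfold T. rewrite (rsum_ext (S (S j)) _ (fun l => / INR (S j) *
    (tc j (dx f) l * (x ^ (S j - l) * y ^ l) +
     match l with O => 0 | S l' => tc j (dy f) l' * (x ^ (S j - l) * y ^ l) end))).
  2: { intros l Hl. change (tc (S j) f l) with
         ((tc j (dx f) l + match l with O => 0 | S l' => tc j (dy f) l' end) / INR (S j)).
       unfold Rdiv. destruct l; ring. }
  rewrite rsum_scal, rsum_plus. unfold Rdiv. rewrite Rmult_comm. f_equal. f_equal.
  - rewrite rsum_S, (tc_gt j _ (S j)) by lia. rewrite Rmult_0_l, Rplus_0_r, <- rsum_scal.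
    apply rsum_ext. intros l Hl. replace (S j - l)%nat with (S (j - l)) by lia. simpl. ring.
  - rewrite rsum_Sl, Rplus_0_l, <- rsum_scal. apply rsum_ext. intros l Hl.
    replace (S j - S l)%nat with (j - l)%nat by lia. simpl. ring.
Qed.

Lemma T_homogeneous j f t x y : T j f (t * x) (t * y) = t ^ j * T j f x y.
Proof.
  unfold T. rewrite <- rsum_scal. apply rsum_ext. intros l Hl. rewrite !Rpow_mult_distr.
  replace (t ^ j) with (t ^ (j - l) * t ^ l) by (rewrite <- pow_add; f_equal; lia). ring.
Qed.

(** By Euler's identity [T_S], the product rule leaves terms in [dx (dx f)] and [dx (dy f)]; the
    symmetry of mixed partials then lets [T_S], applied to [dx f], collect them. The derivative in
    [y] is symmetric. *)
Lemma T_is_derive j : forall f, Smooth f -> forall x y,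
  is_derive (fun t => T (S j) f t y) x (T j (dx f) x y) /\
  is_derive (fun t => T (S j) f x t) y (T j (dy f) x y).
Proof.
  induction j as [|j IH]; intros f H x y.
  - rewrite !T_0. split.
    + apply (is_derive_ext (fun t => t * dx f 0 0 + y * dy f 0 0)).
      { intros t. rewrite T_S, !T_0. simpl. field. }
      auto_derive; auto. ring.
    + apply (is_derive_ext (fun t => x * dx f 0 0 + t * dy f 0 0)).
      { intros t. rewrite T_S, !T_0. simpl. field. }
      auto_derive; auto. ring.
  - assert (NZ : INR (S j) <> 0) by (apply not_0_INR; lia).
    assert (NZ' : INR (S (S j)) <> 0) by (apply not_0_INR; lia).
    destruct (IH (dx f) (Smooth_dx _ H) x y) as [A1 A2].
    destruct (IH (dy f) (Smooth_dy _ H) x y) as [B1 B2].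
    split.
    + apply (is_derive_ext (fun t => / INR (S (S j)) * (t * T (S j) (dx f) t y + y * T (S j) (dy f) t y))).
      { intros t. rewrite (T_S (S j)). apply Rmult_comm. }
      replace (T (S j) (dx f) x y) with (/ INR (S (S j)) *
        ((1 * T (S j) (dx f) x y + x * T j (dx (dx f)) x y) + y * T j (dx (dy f)) x y)).
      { apply (is_derive_scal (fun t => t * T (S j) (dx f) t y + y * T (S j) (dy f) t y)).
        apply (is_derive_plus (fun t => t * T (S j) (dx f) t y) (fun t => y * T (S j) (dy f) t y)).
        - apply (is_derive_mult (fun t => t) (fun t => T (S j) (dx f) t y)); auto.
          apply is_derive_idR. intros; apply Rmult_comm.
        - now apply (is_derive_scal (fun t => T (S j) (dy f) t y)). }
      rewrite dxdy_comm by auto. rewrite (T_S j (dx f)), !S_INR in *. field. auto.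
    + apply (is_derive_ext (fun t => / INR (S (S j)) * (t * T (S j) (dy f) x t + x * T (S j) (dx f) x t))).
      { intros t. rewrite (T_S (S j)), Rplus_comm. apply Rmult_comm. }
      replace (T (S j) (dy f) x y) with (/ INR (S (S j)) *
        ((1 * T (S j) (dy f) x y + y * T j (dy (dy f)) x y) + x * T j (dy (dx f)) x y)).
      { apply (is_derive_scal (fun t => t * T (S j) (dy f) x t + x * T (S j) (dx f) x t)).
        apply (is_derive_plus (fun t => t * T (S j) (dy f) x t) (fun t => x * T (S j) (dx f) x t)).
        - apply (is_derive_mult (fun t => t) (fun t => T (S j) (dy f) x t)); auto.
          apply is_derive_idR. intros; apply Rmult_comm.
        - now apply (is_derive_scal (fun t => T (S j) (dx f) x t)). }
      rewrite <- dxdy_comm by auto. rewrite (T_S j (dy f)), !S_INR in *. field. auto.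
Qed.

Definition Rem (k : nat) (f : R -> R -> R) (x y : R) : R := f x y - rsum k (fun j => T j f x y).

(** Remainders differentiate into remainders of one order less, so bounds on their size alone yield
    bounds on all their derivatives. *)
Lemma Rem_is_derive k f : Smooth f -> forall x y,
  is_derive (fun t => Rem (S k) f t y) x (Rem k (dx f) x y) /\
  is_derive (fun t => Rem (S k) f x t) y (Rem k (dy f) x y).
Proof.
  intros H x y. unfold Rem. induction k as [|k [IH1 IH2]].
  - destruct (Smooth_is_derive f H x y) as [h1 h2]. split.
    + apply (is_derive_ext (fun t => f t y + - f 0 0)).
      { intros t. rewrite rsum_S, rsum_0, T_0. Rring. }
      rewrite rsum_0. replace (dx f x y - 0) with (dx f x y + 0) by ring.
      apply (is_derive_plus (fun t => f t y) (fun _ => - f 0 0)); auto.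
      apply is_derive_cst.
    + apply (is_derive_ext (fun t => f x t + - f 0 0)).
      { intros t. rewrite rsum_S, rsum_0, T_0. Rring. }
      rewrite rsum_0. replace (dy f x y - 0) with (dy f x y + 0) by ring.
      apply (is_derive_plus (fun t => f x t) (fun _ => - f 0 0)); auto.
      apply is_derive_cst.
  - destruct (T_is_derive k f H x y) as [h1 h2]. split.
    + apply (is_derive_ext (fun t => minus (f t y - rsum (S k) (fun j => T j f t y)) (T (S k) f t y))).
      { intros t. rewrite (rsum_S (S k)). unfold minus, plus, opp; simpl. Rring. }
      rewrite rsum_S. match goal with |- is_derive _ _ ?v =>
        replace v with (minus (dx f x y - rsum k (fun j => T j (dx f) x y)) (T k (dx f) x y))
          by (unfold minus, plus, opp; simpl; Rring) end.
      apply (is_derive_minus (K := R_AbsRing) (V := R_NormedModule)); auto.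
    + apply (is_derive_ext (fun t => minus (f x t - rsum (S k) (fun j => T j f x t)) (T (S k) f x t))).
      { intros t. rewrite (rsum_S (S k)). unfold minus, plus, opp; simpl. Rring. }
      rewrite rsum_S. match goal with |- is_derive _ _ ?v =>
        replace v with (minus (dy f x y - rsum k (fun j => T j (dy f) x y)) (T k (dy f) x y))
          by (unfold minus, plus, opp; simpl; Rring) end.
      apply (is_derive_minus (K := R_AbsRing) (V := R_NormedModule)); auto.
Qed.

Lemma Smooth_T j f : Smooth (T j f).
Proof.
  intros n. apply Cn_rsum; [apply open2_True|]. intros l Hl.
  apply Cn_scal; [apply open2_True|]. apply Cn_monomial, open2_True.
Qed.

Lemma Smooth_Rem k f : Smooth f -> Smooth (Rem k f).
Proof.
  intros H n. apply Cn_minus; [apply open2_True|apply H|].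
  apply Cn_rsum; [apply open2_True|]. intros; apply Smooth_T.
Qed.

(** Uniform continuity gives a step length over which [f] varies by less than 1; the segment from
    the origin to a point is walked in [N] such steps, with the same [N] for all points. *)
Lemma bounded_on_square f r : 0 < r ->
  (forall x y, nrm x y <= r -> continuity_2d_pt f x y) ->
  exists C, 0 < C /\ forall x y, nrm x y <= r -> Rabs (f x y) <= C.
Proof.
  intros Hr Hc.
  destruct (uniform_continuity_2d f (- r) r (- r) r) with (eps := mkposreal 1 Rlt_0_1) as [d Hd].
  { intros x y h1 h2. apply Hc, nrm_le; apply Rabs_le; lra. }
  simpl in Hd. destruct (nfloor_ex (r / d)) as [n [_ Hn]].
  { apply Rdiv_le_0_compat; [lra|apply cond_pos]. }
  set (N := S n). assert (HN : 0 < INR N) by (apply lt_0_INR; unfold N; lia).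
  assert (Hstep : r / INR N < d).
  { rewrite <- S_INR in Hn. fold N in Hn. apply Rlt_div_l in Hn; [|apply cond_pos].
    apply Rlt_div_l; auto. now rewrite Rmult_comm. }
  exists (Rabs (f 0 0) + INR N * 1). split.
  { generalize (Rabs_pos (f 0 0)); lra. }
  intros x y Hxy. generalize (Rabs_le_nrm_l x y) (Rabs_le_nrm_r x y). intros hx hy.
  replace (f x y) with (f 0 0 + rsum N (fun k => f (INR (S k) / INR N * x) (INR (S k) / INR N * y)
     - f (INR k / INR N * x) (INR k / INR N * y))).
  2: { rewrite (rsum_telescope N (fun k => f (INR k / INR N * x) (INR k / INR N * y))).
       simpl (INR 0). replace (INR N / INR N) with 1 by (field; lra).
       unfold Rdiv. rewrite !Rmult_0_l, !Rmult_1_l. ring. }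
  eapply Rle_trans; [apply Rabs_triang|]. apply Rplus_le_compat_l.
  apply rsum_Rabs_le. intros k Hk.
  assert (In : forall m z, (m <= N)%nat -> Rabs z <= r -> - r <= INR m / INR N * z <= r).
  { intros m z Hm Hz. apply Rabs_le_between.
    rewrite Rabs_mult, Rabs_pos_eq by (apply Rdiv_le_0_compat; auto; apply pos_INR).
    apply le_INR in Hm. assert (INR m / INR N <= 1) by (apply Rle_div_l; lra).
    generalize (Rabs_pos z) (pos_INR m). intros.
    assert (0 <= INR m / INR N) by (apply Rdiv_le_0_compat; lra). nra. }
  assert (St : forall z, Rabs z <= r -> Rabs (INR (S k) / INR N * z - INR k / INR N * z) < d).
  { intros z Hz. rewrite S_INR.
    replace ((INR k + 1) / INR N * z - INR k / INR N * z) with (z / INR N) by (field; lra).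
    unfold Rdiv. rewrite Rabs_mult, (Rabs_pos_eq (/ INR N)) by (left; now apply Rinv_0_lt_compat).
    eapply Rle_lt_trans; [|exact Hstep]. apply Rmult_le_compat_r; auto. left; now apply Rinv_0_lt_compat. }
  left. apply Hd; try (apply In; [lia|lra]); apply St; lra.
Qed.

(** Induction through the partials: the path from the origin follows the [y] axis to [(0, y)] and
    then runs horizontally to [(x, y)], with the mean value inequality on each leg. *)
Lemma Rem_bound k : forall f, Smooth f ->
  exists C, forall x y, nrm x y <= 1 -> Rabs (Rem k f x y) <= C * nrm x y ^ k.
Proof.
  induction k as [|k IH]; intros f H.
  - destruct (bounded_on_square f 1 Rlt_0_1) as [C [_ HC]].
    { intros; now apply Smooth_continuity. }
    exists C. intros x y h. unfold Rem. rewrite rsum_0, Rminus_0_r. simpl. rewrite Rmult_1_r; auto.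
  - destruct (IH _ (Smooth_dx _ H)) as [C1 H1]. destruct (IH _ (Smooth_dy _ H)) as [C2 H2].
    exists (Rabs C1 + Rabs C2). intros x y h.
    generalize (Rabs_le_nrm_l x y) (Rabs_le_nrm_r x y) (nrm_ge0 x y). intros hx hy hn.
    assert (R0 : Rem (S k) f 0 0 = 0).
    { unfold Rem. rewrite rsum_Sl, T_0, rsum_eq0; [ring|]. intros i _. rewrite T_S. unfold Rdiv. ring. }
    assert (B1 : Rabs (Rem (S k) f x y - Rem (S k) f 0 y) <= (Rabs C1 * nrm x y ^ k) * Rabs (x - 0)).
    { apply (bounded_variation (fun t => Rem (S k) f t y) (fun t => Rem k (dx f) t y)).
      intros t Ht. rewrite !Rminus_0_r in Ht. split; [apply Rem_is_derive; auto|].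
      assert (N : nrm t y <= nrm x y) by (apply nrm_le; lra).
      eapply Rle_trans; [apply H1; lra|].
      apply Rle_trans with (Rabs C1 * nrm t y ^ k).
      - apply Rmult_le_compat_r; [apply pow_le, nrm_ge0|apply Rle_abs].
      - apply Rmult_le_compat_l; [apply Rabs_pos|]. apply pow_incr. split; [apply nrm_ge0|auto]. }
    assert (B2 : Rabs (Rem (S k) f 0 y - Rem (S k) f 0 0) <= (Rabs C2 * nrm x y ^ k) * Rabs (y - 0)).
    { apply (bounded_variation (fun t => Rem (S k) f 0 t) (fun t => Rem k (dy f) 0 t)).
      intros t Ht. rewrite !Rminus_0_r in Ht. split; [apply Rem_is_derive; auto|].
      assert (N : nrm 0 t <= nrm x y) by (apply nrm_le; [rewrite Rabs_R0|]; lra).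
      eapply Rle_trans; [apply H2; lra|].
      apply Rle_trans with (Rabs C2 * nrm 0 t ^ k).
      - apply Rmult_le_compat_r; [apply pow_le, nrm_ge0|apply Rle_abs].
      - apply Rmult_le_compat_l; [apply Rabs_pos|]. apply pow_incr. split; [apply nrm_ge0|auto]. }
    rewrite R0 in B2. rewrite !Rminus_0_r in *.
    replace (Rem (S k) f x y) with ((Rem (S k) f x y - Rem (S k) f 0 y) + Rem (S k) f 0 y) by ring.
    eapply Rle_trans; [apply Rabs_triang|].
    assert (P : 0 <= nrm x y ^ k) by now apply pow_le.
    generalize (Rabs_pos C1) (Rabs_pos C2). intros.
    apply Rle_trans with (Rabs C1 * nrm x y ^ k * nrm x y + Rabs C2 * nrm x y ^ k * nrm x y).
    + apply Rplus_le_compat; (eapply Rle_trans; [eassumption|]; apply Rmult_le_compat_l; auto;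
        apply Rmult_le_pos; auto).
    + simpl. right. ring.
Qed.

Lemma pball1_pos x y : pball 1 x y -> 0 < nrm x y <= 1.
Proof. unfold pball. lra. Qed.

(** While [k] is positive, a derivative lowers order and weight together. At [k = 0] the remainder
    is the function itself, bounded near the origin, and the weights asked for, at most 0, are
    weaker than that. *)
Lemma Gn_Rem n : forall k d f, Smooth f -> (d <= Z.of_nat k)%Z -> Gn True n d (pball 1) (Rem k f).
Proof.
  assert (B : forall k d f, Smooth f -> (d <= Z.of_nat k)%Z -> True -> exists C,
     forall x y, pball 1 x y -> Rabs (Rem k f x y) <= C * powerRZ (nrm x y) d).
  { intros k d f H Hd. destruct (Rem_bound k f H) as [C HC].
    assert (G : Gn True 0 (Z.of_nat k) (pball 1) (Rem k f)).
    { split; [intros; now apply Smooth_continuity, Smooth_Rem|]. split; [|exact Logic.I].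
      intros _. exists C. intros x y h. rewrite <- pow_powerRZ. apply HC.
      unfold pball in h; lra. }
    apply (Gn_weight _ _ (fun _ => pball1_pos) 0 _ d) in G; [|now left]. apply G. }
  induction n as [|n IH]; intros k d f H Hd.
  - split; [intros; now apply Smooth_continuity, Smooth_Rem|]. split; [now apply B|exact Logic.I].
  - destruct k as [|k].
    + apply (Gn_intro _ _ (open2_pball 1) n d _ (Rem 0 (dx f)) (Rem 0 (dy f))).
      * intros; now apply Smooth_continuity, Smooth_Rem.
      * now apply B.
      * intros x y _. unfold Rem. rewrite rsum_0, Rminus_0_r.
        apply (is_derive_ext (fun t => f t y)); [intros; rewrite rsum_0; Rring|].
        now apply Smooth_is_derive.
      * intros x y _. unfold Rem. rewrite rsum_0, Rminus_0_r.
        apply (is_derive_ext (fun t => f x t)); [intros; rewrite rsum_0; Rring|].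
        now apply Smooth_is_derive.
      * apply IH; [now apply Smooth_dx|lia].
      * apply IH; [now apply Smooth_dy|lia].
    + apply (Gn_intro _ _ (open2_pball 1) n d _ (Rem k (dx f)) (Rem k (dy f))).
      * intros; now apply Smooth_continuity, Smooth_Rem.
      * now apply B.
      * intros x y _. now apply Rem_is_derive.
      * intros x y _. now apply Rem_is_derive.
      * apply IH; [now apply Smooth_dx|lia].
      * apply IH; [now apply Smooth_dy|lia].
Qed.

(** The lower terms vanish by induction, so near the origin [T j f] differs from [f] by
    [O(|u|^(j + 1))] and is itself of that size. Being homogeneous of degree [j], it must vanish, as
    dilation by a small [t] shows. *)
Lemma T_eq0_of_bound f k C delta : Smooth f -> 0 < delta ->
  (forall x y, nrm x y < delta -> Rabs (f x y) <= C * nrm x y ^ k) ->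
  forall j, (j < k)%nat -> forall x y, T j f x y = 0.
Proof.
  intros H Hdel Hf. induction j as [j IH] using lt_wf_ind. intros Hj x y.
  destruct (Rem_bound (S j) f H) as [C' HC'].
  set (r := Rmin (Rmin delta 1) 1 / 2).
  assert (Hr : 0 < r /\ r < delta /\ r < 1).
  { unfold r. generalize (Rmin_l (Rmin delta 1) 1) (Rmin_l delta 1) (Rmin_r delta 1).
    assert (0 < Rmin (Rmin delta 1) 1) by (repeat apply Rmin_pos; lra). lra. }
  assert (Small : forall u v, nrm u v <= r -> Rabs (T j f u v) <= (Rabs C + Rabs C') * nrm u v ^ S j).
  { intros u v Huv. generalize (nrm_ge0 u v); intros h0.
    assert (E : T j f u v = f u v - Rem (S j) f u v).
    { unfold Rem. rewrite rsum_S, rsum_eq0; [ring|]. intros i Hi. apply IH; lia. }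
    rewrite E. eapply Rle_trans; [apply Rabs_triang|]. rewrite Rabs_Ropp, Rmult_plus_distr_r.
    assert (P : 0 <= nrm u v ^ S j) by now apply pow_le.
    apply Rplus_le_compat.
    - eapply Rle_trans; [apply Hf; lra|].
      assert (nrm u v ^ k <= nrm u v ^ S j).
      { replace k with (S j + (k - S j))%nat by lia. rewrite pow_add.
        rewrite <- (Rmult_1_r (nrm u v ^ S j)) at 2. apply Rmult_le_compat_l; auto.
        rewrite <- (pow1 (k - S j)). apply pow_incr. lra. }
      assert (0 <= nrm u v ^ k) by now apply pow_le.
      generalize (Rle_abs C) (Rabs_pos C). intros. nra.
    - eapply Rle_trans; [apply HC'; lra|]. apply Rmult_le_compat_r; auto. apply Rle_abs. }
  destruct (Req_dec (T j f x y) 0) as [|NZ]; [assumption|exfalso].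
  set (K := (Rabs C + Rabs C') * nrm x y ^ S j).
  assert (HK : 0 <= K).
  { unfold K. apply Rmult_le_pos; [generalize (Rabs_pos C) (Rabs_pos C'); lra|apply pow_le, nrm_ge0]. }
  assert (A : 0 < Rabs (T j f x y)) by now apply Rabs_pos_lt.
  generalize (nrm_ge0 x y); intros h0.
  (* The first entry brings the dilated point into the range of [Small]; the second makes [t * K] at
     most half of [|T j f x y|]. *)
  set (t := Rmin (r / (nrm x y + 1)) (Rabs (T j f x y) / (2 * (K + 1)))).
  assert (Ht : 0 < t) by (apply Rmin_pos; apply Rdiv_lt_0_compat; lra).
  assert (Ht1 : t * nrm x y <= r).
  { apply Rle_trans with (r / (nrm x y + 1) * (nrm x y + 1)); [|right; field; lra].
    apply Rmult_le_compat; try lra. apply Rmin_l. }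
  assert (Ht2 : t * (K + 1) <= Rabs (T j f x y) / 2).
  { apply Rle_trans with (Rabs (T j f x y) / (2 * (K + 1)) * (K + 1)); [|right; field; lra].
    apply Rmult_le_compat_r; [lra|]. apply Rmin_r. }
  generalize (Small (t * x) (t * y)). rewrite nrm_mult, (Rabs_pos_eq t) by lra. intros S1.
  specialize (S1 Ht1). rewrite T_homogeneous, Rabs_mult, Rpow_mult_distr in S1.
  rewrite (Rabs_pos_eq (t ^ j)) in S1 by (apply pow_le; lra).
  replace ((Rabs C + Rabs C') * (t ^ S j * nrm x y ^ S j)) with (t ^ j * (t * K)) in S1
    by (unfold K; simpl; ring).
  apply Rmult_le_reg_l in S1; [|now apply pow_lt]. nra.
Qed.

(** Used to read [Q] as [Rem 2 Q] and [r^2 - Q] as its own remainder of order 3, so that [Gn_Rem]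
    supplies their weights 2 and 3. *)
Lemma Rem_eq_of_bound f k C delta : Smooth f -> 0 < delta ->
  (forall x y, nrm x y < delta -> Rabs (f x y) <= C * nrm x y ^ k) ->
  forall x y, Rem k f x y = f x y.
Proof.
  intros H Hd Hf x y. unfold Rem. rewrite rsum_eq0; [ring|].
  intros i Hi. now apply (T_eq0_of_bound f k C delta).
Qed.

(** * The binomial expansion *)

Lemma gbinom_0 al : gbinom al 0 = 1.
Proof. unfold gbinom. simpl. field. Qed.

Lemma gbinom_S al k : INR (S k) * gbinom al (S k) = al * gbinom (al - 1) k.
Proof.
  unfold gbinom. simpl seq. rewrite map_cons. simpl fold_right.
  rewrite <- seq_shift, map_map.
  rewrite (map_ext (fun x => al - INR (S x)) (fun i => al - 1 - INR i)).
  2: { intros i. rewrite S_INR. ring. }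
  change (fact (S k)) with (S k * fact k)%nat. rewrite mult_INR. simpl (INR 0).
  field. split; [apply INR_fact_neq_0|apply not_0_INR; lia].
Qed.

Definition rho (al : R) (k : nat) (z : R) : R :=
  Rpower (1 + z) al - rsum k (fun m => gbinom al m * z ^ m).

Lemma rho_0 al z : rho al 0 z = Rpower (1 + z) al.
Proof. unfold rho. rewrite rsum_0. ring. Qed.

Lemma rho_is_derive_0 al z : -1 < z -> is_derive (rho al 0) z (al * rho (al - 1) 0 z).
Proof.
  intros H. rewrite rho_0. apply (is_derive_ext (fun t => Rpower (1 + t) al)).
  { intros; symmetry; apply rho_0. }
  replace (al * Rpower (1 + z) (al - 1)) with (1 * (al * Rpower (1 + z) (al - 1))) by ring.
  apply (is_derive_comp (fun t => Rpower t al) (fun t => 1 + t)).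
  - apply is_derive_Rpower. lra.
  - auto_derive; auto.
Qed.

Lemma rho_is_derive al k z : -1 < z -> is_derive (rho al (S k)) z (al * rho (al - 1) k z).
Proof.
  intros H. induction k as [|k IH].
  - apply (is_derive_ext (fun t => rho al 0 t + - 1)).
    { intros t. unfold rho. rewrite rsum_S, rsum_0, gbinom_0. simpl. Rring. }
    replace (al * rho (al - 1) 0 z) with (al * rho (al - 1) 0 z + 0) by ring.
    apply (is_derive_plus (rho al 0) (fun _ => - 1)); [now apply rho_is_derive_0|].
    apply is_derive_cst.
  - apply (is_derive_ext (fun t => rho al (S k) t + - gbinom al (S k) * t ^ S k)).
    { intros t. unfold rho. rewrite (rsum_S (S k)). Rring. }
    replace (al * rho (al - 1) (S k) z) with
      (al * rho (al - 1) k z + - gbinom al (S k) * (INR (S k) * 1 * z ^ k)).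
    2: { unfold rho. rewrite rsum_S.
         replace (- gbinom al (S k) * (INR (S k) * 1 * z ^ k)) with
           (- (INR (S k) * gbinom al (S k)) * z ^ k) by ring. rewrite gbinom_S. ring. }
    apply (is_derive_plus (rho al (S k)) (fun t => - gbinom al (S k) * t ^ S k)); [exact IH|].
    apply (is_derive_scal (fun t => t ^ S k)).
    apply (is_derive_pow (fun t => t) (S k) z 1). apply is_derive_idR.
Qed.

(** [rho al (S k)] vanishes at 0 and has derivative [al * rho (al - 1) k], so each order follows
    from the one before by the mean value inequality. In the base case [1 + z] lies between 1/2 and
    3/2. *)
Lemma rho_bound k : forall al, exists C, forall z, Rabs z <= 1 / 2 -> Rabs (rho al k z) <= C * Rabs z ^ k.
Proof.
  induction k as [|k IH]; intros al.
  - exists (Rpower (1/2) al + Rpower (3/2) al). intros z Hz. rewrite rho_0. simpl. rewrite Rmult_1_r.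
    rewrite Rabs_pos_eq by (left; apply exp_pos). apply Rabs_le_between in Hz.
    apply Rpower_le_ends; lra.
  - destruct (IH (al - 1)) as [C HC]. exists (Rabs (al * C)). intros z Hz.
    assert (R0 : rho al (S k) 0 = 0).
    { unfold rho. rewrite rsum_Sl, rsum_eq0, gbinom_0, Rplus_0_r.
      - unfold Rpower. rewrite ln_1, Rmult_0_r, exp_0. simpl. ring.
      - intros i _. simpl. ring. }
    assert (B : Rabs (rho al (S k) z - rho al (S k) 0) <= (Rabs (al * C) * Rabs z ^ k) * Rabs (z - 0)).
    { apply (bounded_variation (rho al (S k)) (fun t => al * rho (al - 1) k t)).
      intros t Ht. rewrite !Rminus_0_r in Ht.
      assert (h : Rabs t <= 1 / 2) by lra. split.
      - apply rho_is_derive. apply Rabs_le_between in h. lra.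
      - rewrite !Rabs_mult, Rmult_assoc. apply Rmult_le_compat_l; [apply Rabs_pos|].
        eapply Rle_trans; [apply HC; auto|].
        apply Rle_trans with (Rabs C * Rabs t ^ k).
        + apply Rmult_le_compat_r; [apply pow_le, Rabs_pos|apply Rle_abs].
        + apply Rmult_le_compat_l; [apply Rabs_pos|]. apply pow_incr. split; [apply Rabs_pos|auto]. }
    rewrite R0, !Rminus_0_r in B. simpl. rewrite (Rmult_comm (Rabs z)), <- Rmult_assoc. exact B.
Qed.

(** The class for [Gn_comp] consists of all [c * rho a k] with [d <= k]. It is an inequality because
    [k] cannot drop below 0: once [k = 0], further derivatives keep it there while [d] goes on
    decreasing. *)
Lemma Gn_rho (U : R -> R -> Prop) n f al k : open2 U ->
  (forall x y, U x y -> 0 < nrm x y <= 1) ->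
  (forall x y, U x y -> Rabs (f x y) <= 1 / 2) ->
  Gn True n 1 U f -> Gn True n (Z.of_nat k) U (fun x y => rho al k (f x y)).
Proof.
  intros HU Hn Hf HG.
  refine (Gn_comp True U HU (fun _ => Hn)
     (fun d g => exists c a k, (d <= Z.of_nat k)%Z /\ g = fun z => c * rho a k z)
     (fun z => -1 < z) 1 f _ _ _ n (Z.of_nat k) (fun z => rho al k z) _ HG).
  - intros d g (c & a & i & Hi & ->). destruct i as [|i].
    + exists (fun z => (c * a) * rho (a - 1) 0 z). split.
      * exists (c * a), (a - 1), 0%nat. split; [lia|reflexivity].
      * intros z hz. rewrite Rmult_assoc. apply (is_derive_scal (rho a 0)). now apply rho_is_derive_0.
    + exists (fun z => (c * a) * rho (a - 1) i z). split.
      * exists (c * a), (a - 1), i. split; [lia|reflexivity].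
      * intros z hz. rewrite Rmult_assoc. apply (is_derive_scal (rho a (S i))). now apply rho_is_derive.
  - intros x y h. generalize (Hf x y h). intros h1. apply Rabs_le_between in h1. lra.
  - intros d g (c & a & i & Hi & ->) _.
    destruct (rho_bound i a) as [C HC].
    destruct (Gn_bound _ _ _ _ _ HG Logic.I) as [C' HC'].
    exists (Rabs c * (Rabs C * Rabs C' ^ i)). intros x y h. destruct (Hn x y h) as [h1 h2].
    rewrite Rabs_mult, Rmult_assoc. apply Rmult_le_compat_l; [apply Rabs_pos|].
    eapply Rle_trans; [apply HC; auto|].
    apply Rle_trans with (Rabs C * Rabs (f x y) ^ i).
    { apply Rmult_le_compat_r; [apply pow_le, Rabs_pos|apply Rle_abs]. }
    rewrite Rmult_assoc. apply Rmult_le_compat_l; [apply Rabs_pos|].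
    apply Rle_trans with ((Rabs C' * nrm x y) ^ i).
    { apply pow_incr. split; [apply Rabs_pos|]. eapply Rle_trans; [apply HC'; auto|].
      change (powerRZ (nrm x y) 1) with (nrm x y ^ 1). rewrite pow_1.
      apply Rmult_le_compat_r; [lra|apply Rle_abs]. }
    rewrite Rpow_mult_distr. apply Rmult_le_compat_l; [apply pow_le, Rabs_pos|].
    rewrite pow_powerRZ.
    replace (Z.of_nat i) with (d + Z.of_nat (Z.to_nat (Z.of_nat i - d)))%Z by lia.
    rewrite powerRZ_add, <- pow_powerRZ by lra.
    rewrite <- (Rmult_1_r (powerRZ (nrm x y) d)) at 2.
    apply Rmult_le_compat_l; [now apply powerRZ_le|].
    rewrite <- (pow1 (Z.to_nat (Z.of_nat i - d))). apply pow_incr. lra.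
  - exists 1, al, k. split; [lia|]. apply functional_extensionality. intros; ring.
Qed.

(** * Iterated integrals over rectangles *)

Lemma continuity_2d_slice_r f x y : continuity_2d_pt f x y -> continuous (f x) y.
Proof.
  intros H P [e He]. destruct (H e) as [d Hd]. exists d. intros t Ht. apply He.
  change (Rabs (f x t - f x y) < e). apply Hd; [|exact Ht].
  rewrite Rminus_eq_0, Rabs_R0. apply cond_pos.
Qed.

Definition clamp (lo hi x : R) : R := Rmax lo (Rmin hi x).

Lemma clamp_in lo hi x : lo <= hi -> lo <= clamp lo hi x <= hi.
Proof.
  intros H. unfold clamp. split; [apply Rmax_l|]. apply Rmax_lub; [auto|apply Rmin_l].
Qed.

Lemma clamp_id lo hi x : lo <= x <= hi -> clamp lo hi x = x.
Proof. intros H. unfold clamp. rewrite Rmin_right, Rmax_right; lra. Qed.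

Lemma clamp_lipschitz lo hi x u : Rabs (clamp lo hi u - clamp lo hi x) <= Rabs (u - x).
Proof.
  unfold clamp, Rmax, Rmin. repeat destruct Rle_dec; apply Rabs_le;
    unfold Rabs; destruct Rcase_abs; lra.
Qed.

Definition rcont (f : R -> R -> R) (x1 x2 y1 y2 : R) : Prop :=
  forall x y, x1 <= x <= x2 -> y1 <= y <= y2 -> continuity_2d_pt f x y.

Lemma rcont_mono f x1 x2 y1 y2 u1 u2 v1 v2 : rcont f x1 x2 y1 y2 ->
  x1 <= u1 -> u2 <= x2 -> y1 <= v1 -> v2 <= y2 -> rcont f u1 u2 v1 v2.
Proof. intros H h1 h2 h3 h4 x y hx hy. apply H; lra. Qed.

(** Composition with the retraction [clamp] onto the rectangle gives a function continuous on the
    whole plane, so that integrals depending on a parameter are continuous up to the edges. *)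
Lemma rcont_extension f x1 x2 y1 y2 : x1 <= x2 -> y1 <= y2 -> rcont f x1 x2 y1 y2 ->
  exists g, (forall x y, continuity_2d_pt g x y) /\
    forall x y, x1 <= x <= x2 -> y1 <= y <= y2 -> g x y = f x y.
Proof.
  intros Hx Hy H. exists (fun x y => f (clamp x1 x2 x) (clamp y1 y2 y)). split.
  - intros x y eps.
    destruct (H (clamp x1 x2 x) (clamp y1 y2 y) (clamp_in _ _ _ Hx) (clamp_in _ _ _ Hy) eps) as [d Hd].
    exists d. intros u v Hu Hv. apply Hd; eapply Rle_lt_trans; eauto using clamp_lipschitz.
  - intros x y h1 h2. now rewrite !clamp_id.
Qed.

Lemma continuous_RInt_slice f a b : (forall x y, continuity_2d_pt f x y) -> a <= b ->
  forall x, continuous (fun x => RInt (f x) a b) x.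
Proof.
  intros Hf Hab x P [e He].
  assert (He' : 0 < e / (b - a + 1)) by (apply Rdiv_lt_0_compat; [apply cond_pos|lra]).
  destruct (uniform_continuity_2d_1d' f a b x) with (eps := mkposreal _ He') as [d Hd].
  { intros; apply Hf. }
  exists d. intros t Ht. apply He.
  change (Rabs (t - x) < d) in Ht.
  change (Rabs (RInt (f t) a b - RInt (f x) a b) < e).
  assert (Ex : forall z, ex_RInt (f z) a b).
  { intros z. apply (ex_RInt_continuous (V := R_CompleteNormedModule)). intros; now apply continuity_2d_slice_r. }
  rewrite <- (RInt_minus (V := R_CompleteNormedModule)) by auto.
  eapply Rle_lt_trans.
  - apply (abs_RInt_le_const _ _ _ (e / (b - a + 1))); auto.
    + apply (ex_RInt_minus (V := R_CompleteNormedModule)); auto.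
    + intros s Hs. left. apply Hd; auto; try (rewrite Rminus_eq_0, Rabs_R0; apply cond_pos).
      * generalize (cond_pos d); lra.
      * apply Rabs_def2 in Ht; lra.
  - generalize (cond_pos e); intros hp. apply Rle_lt_trans with ((b - a) * e / (b - a + 1)); [right; field; lra|].
    apply Rlt_div_l; nra.
Qed.

Lemma rcont_ex_RInt f x1 x2 y1 y2 x : y1 <= y2 -> x1 <= x <= x2 -> rcont f x1 x2 y1 y2 ->
  ex_RInt (f x) y1 y2.
Proof.
  intros Hy Hx H. apply (ex_RInt_continuous (V := R_CompleteNormedModule)). intros z Hz.
  apply continuity_2d_slice_r. rewrite Rmin_left, Rmax_right in Hz by auto. now apply H.
Qed.

Lemma rcont_ex_iint f x1 x2 y1 y2 : x1 <= x2 -> y1 <= y2 -> rcont f x1 x2 y1 y2 ->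
  ex_RInt (fun x => RInt (fun y => f x y) y1 y2) x1 x2.
Proof.
  intros Hx Hy H. destruct (rcont_extension f x1 x2 y1 y2 Hx Hy H) as [g [G1 G2]].
  apply (ex_RInt_ext (V := R_NormedModule) (fun x => RInt (g x) y1 y2)).
  - rewrite Rmin_left, Rmax_right by auto. intros x h. apply RInt_ext.
    rewrite Rmin_left, Rmax_right by auto. intros y h'. apply G2; lra.
  - apply (ex_RInt_continuous (V := R_CompleteNormedModule)). intros z _.
    now apply continuous_RInt_slice.
Qed.

Lemma iint_ext f g x1 x2 y1 y2 : x1 <= x2 -> y1 <= y2 ->
  (forall x y, x1 < x < x2 -> y1 < y < y2 -> f x y = g x y) ->
  iint f x1 x2 y1 y2 = iint g x1 x2 y1 y2.
Proof.
  intros Hx Hy H. apply RInt_ext. rewrite Rmin_left, Rmax_right by auto. intros x h.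
  apply RInt_ext. rewrite Rmin_left, Rmax_right by auto. intros y h'. now apply H.
Qed.

Lemma iint_plus f g x1 x2 y1 y2 : x1 <= x2 -> y1 <= y2 ->
  rcont f x1 x2 y1 y2 -> rcont g x1 x2 y1 y2 ->
  iint (fun x y => f x y + g x y) x1 x2 y1 y2 = iint f x1 x2 y1 y2 + iint g x1 x2 y1 y2.
Proof.
  intros Hx Hy Hf Hg. unfold iint.
  rewrite <- (RInt_plus (V := R_CompleteNormedModule)) by now apply rcont_ex_iint.
  apply RInt_ext. rewrite Rmin_left, Rmax_right by auto. intros x h.
  apply (RInt_plus (V := R_CompleteNormedModule));
    [apply (rcont_ex_RInt f x1 x2)|apply (rcont_ex_RInt g x1 x2)]; auto; lra.
Qed.

Lemma iint_scal c f x1 x2 y1 y2 : x1 <= x2 -> y1 <= y2 -> rcont f x1 x2 y1 y2 ->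
  iint (fun x y => c * f x y) x1 x2 y1 y2 = c * iint f x1 x2 y1 y2.
Proof.
  intros Hx Hy Hf. unfold iint.
  rewrite <- (RInt_scal (V := R_CompleteNormedModule)) by now apply rcont_ex_iint.
  apply RInt_ext. rewrite Rmin_left, Rmax_right by auto. intros x h.
  apply (RInt_scal (V := R_CompleteNormedModule)). apply (rcont_ex_RInt f x1 x2); auto; lra.
Qed.

Lemma iint_Chasles_x f x1 x2 x3 y1 y2 : x1 <= x2 -> x2 <= x3 -> y1 <= y2 -> rcont f x1 x3 y1 y2 ->
  iint f x1 x3 y1 y2 = iint f x1 x2 y1 y2 + iint f x2 x3 y1 y2.
Proof.
  intros H1 H2 H3 Hf. unfold iint. symmetry.
  apply (RInt_Chasles (V := R_CompleteNormedModule)); apply rcont_ex_iint; auto;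
    apply (rcont_mono f x1 x3 y1 y2); auto; lra.
Qed.

Lemma iint_Chasles_y f x1 x2 y1 y2 y3 : x1 <= x2 -> y1 <= y2 -> y2 <= y3 -> rcont f x1 x2 y1 y3 ->
  iint f x1 x2 y1 y3 = iint f x1 x2 y1 y2 + iint f x1 x2 y2 y3.
Proof.
  intros H1 H2 H3 Hf. unfold iint.
  assert (Hf1 : rcont f x1 x2 y1 y2) by (apply (rcont_mono f x1 x2 y1 y3); auto; lra).
  assert (Hf2 : rcont f x1 x2 y2 y3) by (apply (rcont_mono f x1 x2 y1 y3); auto; lra).
  rewrite <- (RInt_plus (V := R_CompleteNormedModule)) by now apply rcont_ex_iint.
  apply RInt_ext. rewrite Rmin_left, Rmax_right by auto. intros x h. symmetry.
  apply (RInt_Chasles (V := R_CompleteNormedModule));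
    [apply (rcont_ex_RInt f x1 x2)|apply (rcont_ex_RInt f x1 x2)]; auto; lra.
Qed.

Lemma iint_eq0 f x1 x2 y1 y2 : x1 <= x2 -> y1 <= y2 ->
  (forall x y, x1 < x < x2 -> y1 < y < y2 -> f x y = 0) -> iint f x1 x2 y1 y2 = 0.
Proof.
  intros Hx Hy H. rewrite (iint_ext f (fun _ _ => 0)) by auto. unfold iint.
  rewrite (RInt_ext (V := R_CompleteNormedModule) _ (fun _ => 0)).
  - rewrite (RInt_const (V := R_CompleteNormedModule)). apply Rmult_0_r.
  - intros x _. rewrite (RInt_const (V := R_CompleteNormedModule)). apply Rmult_0_r.
Qed.

Lemma iint_bound f x1 x2 y1 y2 M : x1 <= x2 -> y1 <= y2 -> rcont f x1 x2 y1 y2 ->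
  (forall x y, x1 <= x <= x2 -> y1 <= y <= y2 -> Rabs (f x y) <= M) ->
  Rabs (iint f x1 x2 y1 y2) <= (x2 - x1) * ((y2 - y1) * M).
Proof.
  intros Hx Hy Hf H. unfold iint. apply abs_RInt_le_const; auto using rcont_ex_iint.
  intros x h. apply abs_RInt_le_const; auto. now apply (rcont_ex_RInt f x1 x2).
Qed.

Lemma iint_comp_scale f t x1 x2 y1 y2 : x1 <= x2 -> y1 <= y2 -> 0 < t ->
  rcont f (t * x1) (t * x2) (t * y1) (t * y2) ->
  t ^ 2 * iint (fun x y => f (t * x) (t * y)) x1 x2 y1 y2 = iint f (t * x1) (t * x2) (t * y1) (t * y2).
Proof.
  intros Hx Hy Ht Hf.
  assert (Ix : t * x1 <= t * x2) by now apply Rmult_le_compat_l; [lra|].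
  assert (Iy : t * y1 <= t * y2) by now apply Rmult_le_compat_l; [lra|].
  assert (In : forall x, x1 <= x <= x2 ->
    t * RInt (fun y => f (t * x) (t * y)) y1 y2 = RInt (f (t * x)) (t * y1) (t * y2)).
  { intros x h.
    assert (Ex : ex_RInt (f (t * x)) (t * y1 + 0) (t * y2 + 0)).
    { rewrite !Rplus_0_r. apply (rcont_ex_RInt f (t * x1) (t * x2)); auto.
      split; apply Rmult_le_compat_l; lra. }
    generalize (RInt_comp_lin (V := R_CompleteNormedModule) _ _ _ _ _ Ex). rewrite !Rplus_0_r. intros <-.
    rewrite <- (RInt_scal (V := R_CompleteNormedModule)).
    - apply RInt_ext. intros y _. now rewrite Rplus_0_r.
    - apply (ex_RInt_continuous (V := R_CompleteNormedModule)). intros y Hy'.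
      rewrite Rmin_left, Rmax_right in Hy' by auto.
      apply (continuous_comp (fun y => t * y) (f (t * x))).
      + apply (ex_derive_continuous (fun y => t * y)). auto_derive; auto.
      + apply continuity_2d_slice_r, Hf; split; apply Rmult_le_compat_l; lra. }
  unfold iint.
  assert (Ex : ex_RInt (fun x => RInt (fun y => f x y) (t * y1) (t * y2)) (t * x1 + 0) (t * x2 + 0)).
  { rewrite !Rplus_0_r. now apply rcont_ex_iint. }
  generalize (RInt_comp_lin (V := R_CompleteNormedModule) _ _ _ _ _ Ex). rewrite !Rplus_0_r. intros <-.
  replace (t ^ 2) with (t * t) by ring.
  rewrite <- (RInt_scal (V := R_CompleteNormedModule)).
  - apply RInt_ext. rewrite Rmin_left, Rmax_right by auto. intros x h. rewrite Rplus_0_r.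
    rewrite <- In by lra. unfold scal; simpl; unfold mult; simpl. ring.
  - apply rcont_ex_iint; auto. intros x y h h'.
    intros e. destruct (Hf (t * x) (t * y)) with (eps := e) as [d Hd].
    { split; apply Rmult_le_compat_l; lra. }
    { split; apply Rmult_le_compat_l; lra. }
    assert (Hd' : 0 < d / t) by (apply Rdiv_lt_0_compat; auto; apply cond_pos).
    exists (mkposreal _ Hd'). simpl. intros u v Hu Hv.
    apply Hd; rewrite <- Rmult_minus_distr_l, Rabs_mult, (Rabs_pos_eq t) by lra;
      rewrite Rmult_comm; now apply Rlt_div_r.
Qed.

Lemma RInt_opp_arg (f : R -> R) a b : ex_RInt f (- b) (- a) ->
  RInt (fun y => f (- y)) a b = RInt f (- b) (- a).
Proof.
  intros H. apply is_RInt_unique. apply (RInt_correct (V := R_CompleteNormedModule)) in H.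
  apply (is_RInt_swap (V := R_NormedModule)) in H.
  apply (is_RInt_comp_opp (V := R_NormedModule)) in H.
  apply (is_RInt_opp (V := R_NormedModule)) in H.
  replace (RInt f (- b) (- a)) with (- - RInt f (- b) (- a)) by ring.
  eapply is_RInt_ext; [|exact H]. intros y _. unfold opp; simpl. Rring.
Qed.

Lemma iint_comp_opp f x1 x2 y1 y2 :
  x1 <= x2 -> y1 <= y2 -> rcont f (- x2) (- x1) (- y2) (- y1) ->
  iint (fun x y => f (- x) (- y)) x1 x2 y1 y2 = iint f (- x2) (- x1) (- y2) (- y1).
Proof.
  intros Hx Hy Hf. unfold iint.
  rewrite <- (RInt_opp_arg (fun x => RInt (fun y => f x y) (- y2) (- y1))).
  - apply RInt_ext. rewrite Rmin_left, Rmax_right by auto. intros x h.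
    apply RInt_opp_arg. apply (rcont_ex_RInt f (- x2) (- x1)); auto; lra.
  - apply rcont_ex_iint; auto; lra.
Qed.

(** * The trapezoidal rule *)

(** Induction on [J] with the mean value theorem for the remainder. The derivatives come as a
    sequence [f k], so that an antiderivative can be put in front of it; the factor [1 / J!] is
    given away. *)
Lemma taylor_bound J : forall (f : nat -> R -> R) x t B, 0 <= t ->
  (forall k s, (k < J)%nat -> x <= s <= x + t -> is_derive (f k) s (f (S k) s)) ->
  (forall s, x <= s <= x + t -> Rabs (f J s) <= B) ->
  Rabs (f 0%nat (x + t) - rsum J (fun j => t ^ j / INR (fact j) * f j x)) <= B * t ^ J.
Proof.
  induction J as [|J IH]; intros f x t B Ht HD HB.
  - rewrite rsum_0, Rminus_0_r. simpl. rewrite Rmult_1_r. apply HB. lra.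
  - set (g := fun s => f 0%nat (x + s) - rsum (S J) (fun j => s ^ j / INR (fact j) * f j x)).
    set (dg := fun s => f 1%nat (x + s) - rsum J (fun j => s ^ j / INR (fact j) * f (S j) x)).
    assert (Dpoly : forall s, is_derive (fun s => rsum (S J) (fun j => s ^ j / INR (fact j) * f j x)) s
              (rsum J (fun j => s ^ j / INR (fact j) * f (S j) x))).
    { intros s. clear. induction J as [|J IH].
      - rewrite rsum_0. apply (is_derive_ext (fun _ => f 0%nat x)).
        + intros u. rewrite rsum_S, rsum_0. simpl. field.
        + apply is_derive_cst.
      - rewrite rsum_S.
        apply (is_derive_ext (fun u => rsum (S J) (fun j => u ^ j / INR (fact j) * f j x)
                 + (f (S J) x / INR (fact (S J))) * u ^ S J)).
        + intros u. rewrite (rsum_S (S J)). unfold Rdiv. Rring.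
        + apply (is_derive_plus (fun u => rsum (S J) (fun j => u ^ j / INR (fact j) * f j x))
                   (fun u => (f (S J) x / INR (fact (S J))) * u ^ S J)); [exact IH|].
          replace (s ^ J / INR (fact J) * f (S J) x) with
            ((f (S J) x / INR (fact (S J))) * (INR (S J) * 1 * s ^ J)).
          * apply (is_derive_scal (fun u => u ^ S J)).
            apply (is_derive_pow (fun t => t) (S J) s 1). apply is_derive_idR.
          * change (fact (S J)) with (S J * fact J)%nat. rewrite mult_INR.
            field. split; [apply INR_fact_neq_0|apply not_0_INR; lia]. }
    assert (Dg : forall s, 0 <= s <= t -> is_derive g s (dg s)).
    { intros s Hs. unfold g, dg.
      apply (is_derive_minus (K := R_AbsRing) (V := R_NormedModule) (fun s => f 0%nat (x + s))); [|apply Dpoly].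
      replace (f 1%nat (x + s)) with (1 * f 1%nat (x + s)) by ring.
      apply (is_derive_comp (f 0%nat) (fun s => x + s)).
      - apply HD; [lia|lra].
      - auto_derive; auto. }
    assert (Bdg : forall s, 0 <= s <= t -> Rabs (dg s) <= B * t ^ J).
    { intros s Hs. eapply Rle_trans.
      - apply (IH (fun k => f (S k)) x s B).
        + lra.
        + intros k u Hk Hu. apply HD; [lia|lra].
        + intros u Hu. apply HB. lra.
      - assert (0 <= B) by (eapply Rle_trans; [apply Rabs_pos|apply (HB x); lra]).
        apply Rmult_le_compat_l; auto. apply pow_incr. lra. }
    assert (g0 : g 0 = 0).
    { unfold g. rewrite rsum_Sl, rsum_eq0, Rplus_0_r.
      - simpl. field.
      - intros i _. simpl. unfold Rdiv. ring. }
    destruct (MVT_gen g 0 t dg) as [c [Hc E]].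
    + rewrite Rmin_left, Rmax_right by auto. intros s Hs. apply Dg; lra.
    + rewrite Rmin_left, Rmax_right by auto. intros s Hs.
      apply continuity_pt_filterlim. apply (ex_derive_continuous g). exists (dg s). now apply Dg.
    + rewrite Rmin_left, Rmax_right in Hc by auto. fold (g t).
      rewrite g0, !Rminus_0_r in E. rewrite E, Rabs_mult, (Rabs_pos_eq t) by auto.
      simpl. rewrite (Rmult_comm t), <- Rmult_assoc. apply Rmult_le_compat_r; auto.
Qed.

(** Equals the trapezoidal sum on [[-N h, N h]] whenever [g] takes the same value at both ends, as
    the matching conditions ensure. *)
Definition T1 (g : R -> R) (N : nat) (h : R) : R :=
  rsum (2 * N) (fun i => g (- (INR N * h) + INR i * h) * h).

(** The recursion behind the constant [2^J] of the next estimate: the cell errors count 1, the error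
    for the derivative of order [i + 1] counts [2^(K - i)]. *)
Lemma sum_pow2 K : rsum K (fun i => 2 ^ (K - i)) + 1 <= 2 ^ S K.
Proof.
  induction K as [|K IH]; [rewrite rsum_0; simpl; lra|].
  rewrite rsum_Sl. rewrite (rsum_ext K _ (fun i => 2 ^ (K - i))) by (intros; f_equal; lia).
  replace (S K - 0)%nat with (S K) by lia. simpl in *. lra.
Qed.

(* Cell by cell Taylor expansion gives [int f_0 = sum_(j<J) h^j/(j+1)! T1 f_j + O(h^J)]; by the
   boundary matching [int f_j = 0] for [j >= 1], so that [T1 f_j] is itself a quadrature error,
   one of lower order. *)
Lemma trapezoidal_error_1d J : (0 < J)%nat -> forall (f : nat -> R -> R) N h A' B,
  0 < h -> INR N * h < A' ->
  (forall k s, (k < J)%nat -> Rabs s < A' -> is_derive (f k) s (f (S k) s)) ->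
  (forall k, (k < J)%nat -> f k (- (INR N * h)) = f k (INR N * h)) ->
  (forall s, Rabs s <= INR N * h -> Rabs (f J s) <= B) ->
  Rabs (T1 (f 0%nat) N h - RInt (f 0%nat) (- (INR N * h)) (INR N * h))
    <= 2 ^ J * (2 * (INR N * h)) * B * h ^ J.
Proof.
  induction J as [J IH] using lt_wf_ind. intros HJ f N h A' B Hh HA HD HM HB.
  set (A := INR N * h) in *.
  assert (A0 : 0 <= A) by (apply Rmult_le_pos; [apply pos_INR|lra]).
  assert (B0 : 0 <= B) by (eapply Rle_trans; [apply Rabs_pos|apply (HB 0); rewrite Rabs_R0; auto]).
  assert (Cont : forall k s, (k < J)%nat -> Rabs s < A' -> continuous (f k) s).
  { intros k s Hk Hs. apply (ex_derive_continuous (f k)). exists (f (S k) s). now apply HD. }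
  assert (Ex : forall u v, Rabs u < A' -> Rabs v < A' -> ex_RInt (f 0%nat) u v).
  { intros u v Hu Hv. apply (ex_RInt_continuous (V := R_CompleteNormedModule)). intros z Hz.
    apply Cont; auto. apply Rabs_def2 in Hu, Hv. unfold Rmin, Rmax in Hz.
    apply Rabs_def1; destruct Rle_dec; lra. }
  set (F := fun s => RInt (f 0%nat) (- A) s).
  assert (DF : forall s, Rabs s < A' -> is_derive F s (f 0%nat s)).
  { intros s Hs. apply (is_derive_RInt (V := R_NormedModule) (f 0%nat) F (- A)).
    - assert (H : 0 < A' - Rabs s) by lra. exists (mkposreal _ H). intros u Hu.
      change (Rabs (u - s) < A' - Rabs s) in Hu.
      apply (RInt_correct (V := R_CompleteNormedModule)). apply Ex.
      + rewrite Rabs_Ropp, Rabs_pos_eq; lra.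
      + replace u with (s + (u - s)) by ring. eapply Rle_lt_trans; [apply Rabs_triang|lra].
    - now apply Cont. }
  set (x := fun i => - A + INR i * h).
  assert (HN : forall i, (i <= 2 * N)%nat -> Rabs (x i) <= A).
  { intros i Hi. apply Rabs_le. unfold x. apply le_INR in Hi. rewrite mult_INR in Hi. simpl (INR 2) in Hi.
    generalize (pos_INR i). unfold A in *. intros. nra. }
  assert (Cell : forall i, (i < 2 * N)%nat ->
    Rabs (F (x (S i)) - F (x i) - rsum J (fun j => h ^ S j / INR (fact (S j)) * f j (x i))) <= B * h ^ S J).
  { intros i Hi.
    assert (E : x (S i) = x i + h) by (unfold x; rewrite S_INR; ring).
    generalize (HN i ltac:(lia)) (HN (S i) ltac:(lia)). intros h1 h2.
    (* With the antiderivative [F] in front of the sequence, one Taylor expansion covers the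
       integral over the cell and the derivatives. *)
    generalize (taylor_bound (S J) (fun k => match k with O => F | S k => f k end) (x i) h B).
    intros Tb. rewrite rsum_Sl in Tb. rewrite E.
    replace (F (x i + h) - F (x i) - rsum J (fun j => h ^ S j / INR (fact (S j)) * f j (x i)))
      with (F (x i + h) - (h ^ 0 / INR (fact 0) * F (x i) +
              rsum J (fun j => h ^ S j / INR (fact (S j)) * f j (x i)))) by (simpl; field).
    rewrite E in h2. apply Rabs_le_between in h1, h2.
    apply Tb; [lra| |].
    - intros k s Hk Hs. assert (Rabs s < A') by (apply Rabs_def1; lra).
      destruct k as [|k]; [now apply DF|]. apply HD; [lia|auto].
    - intros s Hs. apply HB. apply Rabs_le. lra. }
  assert (Main : Rabs (RInt (f 0%nat) (- A) A
       - rsum J (fun j => h ^ j / INR (fact (S j)) * T1 (f j) N h)) <= 2 * A * B * h ^ J).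
  { assert (E1 : RInt (f 0%nat) (- A) A = rsum (2 * N) (fun i => F (x (S i)) - F (x i))).
    { rewrite (rsum_telescope (2 * N) (fun i => F (x i))). unfold F at 2.
      replace (x 0%nat) with (- A) by (unfold x; simpl; ring).
      replace (x (2 * N)%nat) with A.
      - rewrite (RInt_point (V := R_CompleteNormedModule)). symmetry. apply Rminus_0_r.
      - unfold x, A. rewrite mult_INR. simpl (INR 2). ring. }
    assert (E2 : rsum J (fun j => h ^ j / INR (fact (S j)) * T1 (f j) N h)
       = rsum (2 * N) (fun i => rsum J (fun j => h ^ S j / INR (fact (S j)) * f j (x i)))).
    { unfold T1. fold A. generalize (2 * N)%nat as n. intros n.
      clear -x. induction J as [|J IH].
      - rewrite rsum_0. symmetry. apply rsum_eq0. intros; apply rsum_0.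
      - rewrite rsum_S, IH, <- rsum_scal, <- rsum_plus. apply rsum_ext. intros i Hi. rewrite rsum_S.
        unfold x, Rdiv. simpl pow. ring. }
    rewrite E1, E2.
    replace (rsum (2 * N) (fun i => F (x (S i)) - F (x i)) -
       rsum (2 * N) (fun i => rsum J (fun j => h ^ S j / INR (fact (S j)) * f j (x i))))
      with (rsum (2 * N) (fun i => F (x (S i)) - F (x i) -
         rsum J (fun j => h ^ S j / INR (fact (S j)) * f j (x i)))).
    - eapply Rle_trans; [apply rsum_Rabs_le; exact Cell|]. rewrite mult_INR. simpl (INR 2).
      right. unfold A. simpl. ring.
    - rewrite (rsum_ext _ _ (fun i => (F (x (S i)) - F (x i)) +
         (-1) * rsum J (fun j => h ^ S j / INR (fact (S j)) * f j (x i)))) by (intros; ring).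
      rewrite rsum_plus, rsum_scal. ring. }
  destruct J as [|K]; [lia|]. rewrite rsum_Sl in Main.
  set (W := rsum K (fun i => h ^ S i / INR (fact (S (S i))) * T1 (f (S i)) N h)) in Main.
  assert (HW : Rabs W <= rsum K (fun i => 2 ^ (K - i) * (2 * A * B * h ^ S K))).
  { eapply Rle_trans; [apply rsum_Rabs|]. apply rsum_le. intros i Hi.
    assert (Z : RInt (f (S i)) (- A) A = 0).
    { apply is_RInt_unique. replace 0 with (minus (f i A) (f i (- A))).
      - apply (is_RInt_derive (V := R_CompleteNormedModule) (f i) (f (S i))).
        + rewrite Rmin_left, Rmax_right by lra. intros s Hs. apply HD; [lia|apply Rabs_def1; lra].
        + rewrite Rmin_left, Rmax_right by lra. intros s Hs. apply Cont; [lia|apply Rabs_def1; lra].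
      - rewrite HM by lia. apply Rplus_opp_r. }
    (* The sequence shifted by [S i] has [S K - S i] derivatives left; the factor [h ^ S i] restores
       the full order. *)
    generalize (IH (S K - S i)%nat ltac:(lia) ltac:(lia) (fun k => f (S i + k)%nat) N h A' B Hh HA).
    fold A. intros IHi. rewrite Nat.add_0_r, Z, Rminus_0_r in IHi.
    rewrite Rabs_mult, (Rabs_pos_eq (h ^ S i / INR (fact (S (S i))))).
    2: { apply Rdiv_le_0_compat; [apply pow_le; lra|apply INR_fact_lt_0]. }
    assert (F1 : h ^ S i / INR (fact (S (S i))) <= h ^ S i).
    { apply Rle_div_l; [apply INR_fact_lt_0|]. rewrite <- (Rmult_1_r (h ^ S i)) at 1.
      apply Rmult_le_compat_l; [apply pow_le; lra|]. change 1 with (INR 1). apply le_INR.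
      generalize (lt_O_fact (S (S i))). lia. }
    apply Rle_trans with (h ^ S i * (2 ^ (S K - S i) * (2 * A) * B * h ^ (S K - S i))).
    - apply Rmult_le_compat; auto using Rabs_pos.
      + apply Rdiv_le_0_compat; [apply pow_le; lra|apply INR_fact_lt_0].
      + apply IHi.
        * intros k s Hk Hs. replace (S i + S k)%nat with (S (S i + k)) by lia. apply HD; [lia|auto].
        * intros k Hk. apply HM. lia.
        * intros s Hs. replace (S i + (S K - S i))%nat with (S K) by lia. auto.
    - right. replace (h ^ S K) with (h ^ S i * h ^ (S K - S i)) by (rewrite <- pow_add; f_equal; lia).
      replace (S K - S i)%nat with (K - i)%nat by lia. ring. }
  rewrite (rsum_ext K _ (fun i => (2 * A * B * h ^ S K) * 2 ^ (K - i))) in HW by (intros; ring).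
  rewrite rsum_scal in HW.
  assert (P0 : 0 <= 2 * A * B * h ^ S K).
  { apply Rmult_le_pos; [apply Rmult_le_pos; [lra|auto]|apply pow_le; lra]. }
  generalize (sum_pow2 K). intros S2.
  replace (h ^ 0 / INR (fact 1)) with 1 in Main by (simpl; field). rewrite Rmult_1_l in Main.
  change (RInt (f 0%nat) (- A) A) with (F A) in *.
  replace (T1 (f 0%nat) N h - F A) with (- (F A - (T1 (f 0%nat) N h + W)) + - W) by ring.
  eapply Rle_trans; [apply Rabs_triang|]. rewrite !Rabs_Ropp.
  replace (2 ^ S K * (2 * A) * B * h ^ S K) with ((2 * A * B * h ^ S K) * 2 ^ S K) by ring.
  apply (Rmult_le_compat_l _ _ _ P0) in S2. lra.
Qed.

Fixpoint dxn (k : nat) (f : R -> R -> R) : R -> R -> R :=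
  match k with O => f | S k => dx (dxn k f) end.
Fixpoint dyn (k : nat) (f : R -> R -> R) : R -> R -> R :=
  match k with O => f | S k => dy (dyn k f) end.

Lemma Cn_dxn k : forall n U f, Cn (k + n) U f -> Cn n U (dxn k f).
Proof.
  induction k as [|k IH]; intros n U f H; [exact H|]. simpl. apply Cn_dx, IH.
  now rewrite Nat.add_succ_r.
Qed.

Lemma Cn_dyn k : forall n U f, Cn (k + n) U f -> Cn n U (dyn k f).
Proof.
  induction k as [|k IH]; intros n U f H; [exact H|]. simpl. apply Cn_dy, IH.
  now rewrite Nat.add_succ_r.
Qed.

Lemma Cn_continuity n U f x y : Cn n U f -> U x y -> continuity_2d_pt f x y.
Proof. intros H h. exact (Gn_continuity False U n 0 f H x y h). Qed.

Lemma Cn_is_derive n U f : Cn (S n) U f -> forall x y, U x y ->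
  is_derive (fun t => f t y) x (dx f x y) /\ is_derive (fun t => f x t) y (dy f x y).
Proof. exact (Gn_is_derive False U n 0 f). Qed.

Definition grid_sum (f : R -> R -> R) (N : Z) (h : R) : R :=
  zsum (- N) (N - 1) (fun i => zsum (- N) (N - 1) (fun j => f (IZR i * h) (IZR j * h) * h ^ 2)).

Lemma zsum_T1 (g : R -> R) N h :
  zsum (- Z.of_nat N) (Z.of_nat N - 1) (fun i => g (IZR i * h) * h) = T1 g N h.
Proof.
  rewrite zsum_rsum. unfold T1.
  replace (Z.to_nat (Z.of_nat N - 1 - - Z.of_nat N + 1)) with (2 * N)%nat by lia.
  apply rsum_ext. intros i _. f_equal. f_equal.
  rewrite plus_IZR, opp_IZR, <- !INR_IZR_INZ. ring.
Qed.

(** Each side of the square constrains only the derivatives normal to it, since the rule is applied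
    in one variable at a time. *)
Definition matching (A : R) (J : nat) (f : R -> R -> R) : Prop :=
  forall k s, (k < J)%nat -> Rabs s <= A ->
    dxn k f (- A) s = dxn k f A s /\ dyn k f s (- A) = dyn k f s A.

(** The one-dimensional rule is applied in [y] on each row, uniformly in [x], and then in [x] to the
    row integrals [Psi 0], differentiated under the integral sign. The two contributions have equal
    bounds, hence [2 ^ S J]. The margin between the half side and [A'] makes the derivatives
    two-sided up to the boundary. *)
Lemma trapezoidal_error_2d J f N h A' B : (0 < J)%nat -> 0 < h -> INR N * h < A' ->
  Cn J (fun x y => nrm x y < A') f -> matching (INR N * h) J f ->
  (forall x y, nrm x y <= INR N * h -> Rabs (dxn J f x y) <= B /\ Rabs (dyn J f x y) <= B) ->
  Rabs (grid_sum f (Z.of_nat N) h - iint f (- (INR N * h)) (INR N * h) (- (INR N * h)) (INR N * h))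
    <= 2 ^ S J * (2 * (INR N * h)) ^ 2 * B * h ^ J.
Proof.
  intros HJ Hh HA HC HM HB. set (A := INR N * h) in *.
  assert (A0 : 0 <= A) by (apply Rmult_le_pos; [apply pos_INR|lra]).
  assert (B0 : 0 <= B).
  { destruct (HB 0 0) as [h1 _]; [rewrite nrm_00; auto|]. eapply Rle_trans; [apply Rabs_pos|exact h1]. }
  set (Psi := fun k x => RInt (fun y => dxn k f x y) (- A) A).
  assert (CD : forall k x y, (k <= J)%nat -> nrm x y < A' -> continuity_2d_pt (dxn k f) x y).
  { intros k x y Hk Hxy. apply (Cn_continuity 0 (fun x y => nrm x y < A')); auto.
    apply Cn_dxn. apply (Cn_le J); [lia|auto]. }
  assert (ExP : forall k x, (k <= J)%nat -> Rabs x < A' -> ex_RInt (dxn k f x) (- A) A).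
  { intros k x Hk Hx. apply (ex_RInt_continuous (V := R_CompleteNormedModule)). intros z Hz.
    rewrite Rmin_left, Rmax_right in Hz by lra. apply continuity_2d_slice_r, CD; auto.
    apply nrm_lt; auto. apply Rabs_def1; lra. }
  assert (DPsi : forall k x, (k < J)%nat -> Rabs x < A' -> is_derive (Psi k) x (Psi (S k) x)).
  { intros k x Hk Hx. unfold Psi.
    assert (Hx' : 0 < A' - Rabs x) by lra.
    assert (L : forall u, ball x (A' - Rabs x) u -> Rabs u < A').
    { intros u Hu. change (Rabs (u - x) < A' - Rabs x) in Hu.
      replace u with (x + (u - x)) by ring. eapply Rle_lt_trans; [apply Rabs_triang|lra]. }
    apply (is_derive_RInt_param (dxn k f) (- A) A x).
    - exists (mkposreal _ Hx'). intros u Hu t Ht. rewrite Rmin_left, Rmax_right in Ht by lra.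
      apply L in Hu.
      assert (HC1 : Cn 1 (fun x y => nrm x y < A') (dxn k f)).
      { apply Cn_dxn. apply (Cn_le J); [lia|auto]. }
      exists (dx (dxn k f) u t). apply (Cn_is_derive 0 _ _ HC1).
      apply nrm_lt; auto. apply Rabs_def1; lra.
    - intros t Ht. rewrite Rmin_left, Rmax_right in Ht by lra.
      apply (CD (S k)); [lia|]. apply nrm_lt; auto. apply Rabs_def1; lra.
    - exists (mkposreal _ Hx'). intros u Hu. apply L in Hu. apply ExP; [lia|auto]. }
  set (row := fun x => zsum (- Z.of_nat N) (Z.of_nat N - 1) (fun j => f x (IZR j * h) * h)).
  assert (Row : forall x, Rabs x <= A -> Rabs (row x - Psi 0%nat x) <= 2 ^ J * (2 * A) * B * h ^ J).
  { intros x Hx. unfold row. rewrite (zsum_T1 (f x)).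
    apply (trapezoidal_error_1d J HJ (fun k y => dyn k f x y) N h A' B); auto; fold A; auto.
    - intros k s Hk Hs.
      assert (HC1 : Cn 1 (fun x y => nrm x y < A') (dyn k f)).
      { apply Cn_dyn. apply (Cn_le J); [lia|auto]. }
      apply (Cn_is_derive 0 _ _ HC1). apply nrm_lt; lra.
    - intros k Hk. now apply HM.
    - intros s Hs. apply HB. now apply nrm_le. }
  assert (E : grid_sum f (Z.of_nat N) h = T1 row N h).
  { rewrite <- zsum_T1. unfold grid_sum, row. apply zsum_ext. intros i _.
    rewrite (Rmult_comm (zsum _ _ _) h), <- zsum_scal. apply zsum_ext. intros j _. ring. }
  assert (E2 : Rabs (T1 row N h - T1 (Psi 0%nat) N h) <= 2 * A * (2 ^ J * (2 * A) * B * h ^ J)).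
  { unfold T1. fold A.
    replace (rsum (2 * N) (fun i => row (- A + INR i * h) * h) -
             rsum (2 * N) (fun i => Psi 0%nat (- A + INR i * h) * h))
     with (rsum (2 * N) (fun i => (row (- A + INR i * h) - Psi 0%nat (- A + INR i * h)) * h)).
    - eapply Rle_trans.
      + apply (rsum_Rabs_le _ _ ((2 ^ J * (2 * A) * B * h ^ J) * h)). intros i Hi.
        rewrite Rabs_mult, (Rabs_pos_eq h) by lra. apply Rmult_le_compat_r; [lra|].
        apply Row. apply Rabs_le. apply lt_INR in Hi. rewrite mult_INR in Hi. simpl (INR 2) in Hi.
        generalize (pos_INR i). unfold A in *. intros. nra.
      + rewrite mult_INR. simpl (INR 2). right. unfold A. ring.
    - rewrite (rsum_ext _ _ (fun i => row (- A + INR i * h) * h + (-1) * (Psi 0%nat (- A + INR i * h) * h)))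
        by (intros; ring).
      rewrite rsum_plus, rsum_scal. ring. }
  assert (E3 : Rabs (T1 (Psi 0%nat) N h - RInt (Psi 0%nat) (- A) A)
             <= 2 ^ J * (2 * A) * (2 * A * B) * h ^ J).
  { apply (trapezoidal_error_1d J HJ Psi N h A'); auto; fold A.
    - intros k Hk. unfold Psi. apply RInt_ext. rewrite Rmin_left, Rmax_right by lra.
      intros s Hs. apply HM; auto. apply Rabs_le; lra.
    - intros s Hs. unfold Psi. replace (2 * A * B) with ((A - - A) * B) by ring.
      apply abs_RInt_le_const; [lra| |].
      + apply ExP; [lia|lra].
      + intros t Ht. apply HB. apply nrm_le; auto. now apply Rabs_le. }
  rewrite E. change (iint f (- A) A (- A) A) with (RInt (Psi 0%nat) (- A) A).
  replace (T1 row N h - RInt (Psi 0%nat) (- A) A) with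
    ((T1 row N h - T1 (Psi 0%nat) N h) + (T1 (Psi 0%nat) N h - RInt (Psi 0%nat) (- A) A)) by ring.
  eapply Rle_trans; [apply Rabs_triang|].
  replace (2 ^ S J * (2 * A) ^ 2 * B * h ^ J) with
    (2 * A * (2 ^ J * (2 * A) * B * h ^ J) + 2 ^ J * (2 * A) * (2 * A * B) * h ^ J) by (simpl; ring).
  lra.
Qed.

(** * Integrals over square annuli *)

Definition acont (r : R) (f : R -> R -> R) : Prop :=
  forall x y, pball r x y -> continuity_2d_pt f x y.

Lemma acont_plus r f g : acont r f -> acont r g -> acont r (fun x y => f x y + g x y).
Proof. intros Hf Hg x y h. apply continuity_2d_pt_plus; auto. Qed.

Lemma acont_scal r c f : acont r f -> acont r (fun x y => c * f x y).
Proof. intros Hf x y h. apply continuity_2d_pt_mult; auto. apply continuity_2d_pt_const. Qed.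

Lemma acont_mono r r' f : r' <= r -> acont r f -> acont r' f.
Proof. intros Hr Hf x y [h1 h2]. apply Hf. split; lra. Qed.

Lemma pball_abs r x y : 0 < Rabs x \/ 0 < Rabs y -> Rabs x < r -> Rabs y < r -> pball r x y.
Proof.
  intros H hx hy. split; [|now apply nrm_lt].
  destruct H as [H|H]; eapply Rlt_le_trans; [exact H|apply Rmax_l|exact H|apply Rmax_r].
Qed.

Lemma acont_rcont r f x1 x2 y1 y2 : acont r f -> - r < x1 -> x2 < r -> - r < y1 -> y2 < r ->
  (0 < x1 \/ x2 < 0 \/ 0 < y1 \/ y2 < 0) -> rcont f x1 x2 y1 y2.
Proof.
  intros Hf h1 h2 h3 h4 H x y hx hy. apply Hf. apply pball_abs.
  - destruct H as [H|[H|[H|H]]]; [left|left|right|right]; apply Rabs_pos_lt; lra.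
  - apply Rabs_def1; lra.
  - apply Rabs_def1; lra.
Qed.

Section Annulus.

Variables (r : R) (f : R -> R -> R).
Hypothesis Hf : acont r f.

(** The four rectangles of a square annulus do not refine those of its parts; all are cut along
    [|x| = d] and [|y| = d] and regrouped. *)
Lemma sq_annulus_split e d b : 0 < e -> e <= d -> d <= b -> b < r ->
  sq_annulus_int f e b = sq_annulus_int f e d + sq_annulus_int f d b.
Proof.
  intros H1 H2 H3 H4. unfold sq_annulus_int.
  assert (C : forall x1 x2 y1 y2, - b <= x1 -> x2 <= b -> - b <= y1 -> y2 <= b ->
     (e <= x1 \/ x2 <= - e \/ e <= y1 \/ y2 <= - e) -> rcont f x1 x2 y1 y2).
  { intros. apply (acont_rcont r); auto; lra. }
  rewrite (iint_Chasles_y f (- b) b e d b) by (lra || (apply C; lra)).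
  rewrite (iint_Chasles_x f (- b) (- d) b e d) by (lra || (apply C; lra)).
  rewrite (iint_Chasles_x f (- d) d b e d) by (lra || (apply C; lra)).
  rewrite (iint_Chasles_y f (- b) b (- b) (- d) (- e)) by (lra || (apply C; lra)).
  rewrite (iint_Chasles_x f (- b) (- d) b (- d) (- e)) by (lra || (apply C; lra)).
  rewrite (iint_Chasles_x f (- d) d b (- d) (- e)) by (lra || (apply C; lra)).
  rewrite (iint_Chasles_x f (- b) (- d) (- e) (- e) e) by (lra || (apply C; lra)).
  rewrite (iint_Chasles_x f e d b (- e) e) by (lra || (apply C; lra)).
  rewrite (iint_Chasles_y f (- b) (- d) (- d) (- e) d) by (lra || (apply C; lra)).
  rewrite (iint_Chasles_y f (- b) (- d) (- e) e d) by (lra || (apply C; lra)).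
  rewrite (iint_Chasles_y f d b (- d) (- e) d) by (lra || (apply C; lra)).
  rewrite (iint_Chasles_y f d b (- e) e d) by (lra || (apply C; lra)).
  ring.
Qed.

Lemma sq_annulus_plus g e b : acont r g -> 0 < e -> e <= b -> b < r ->
  sq_annulus_int (fun x y => f x y + g x y) e b = sq_annulus_int f e b + sq_annulus_int g e b.
Proof.
  intros Hg H1 H2 H3. unfold sq_annulus_int.
  rewrite !iint_plus by (lra || (apply (acont_rcont r); auto; lra)). ring.
Qed.

Lemma sq_annulus_scal c e b : 0 < e -> e <= b -> b < r ->
  sq_annulus_int (fun x y => c * f x y) e b = c * sq_annulus_int f e b.
Proof.
  intros H1 H2 H3. unfold sq_annulus_int.
  rewrite !iint_scal by (lra || (apply (acont_rcont r); auto; lra)). ring.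
Qed.

Lemma sq_annulus_odd e b : 0 < e -> e <= b -> b < r ->
  (forall x y, pball r x y -> f (- x) (- y) = - f x y) -> sq_annulus_int f e b = 0.
Proof.
  intros H1 H2 H3 Hodd.
  assert (E : forall x1 x2 y1 y2, x1 <= x2 -> y1 <= y2 -> - b <= x1 -> x2 <= b -> - b <= y1 -> y2 <= b ->
     (e <= x1 \/ x2 <= - e \/ e <= y1 \/ y2 <= - e) ->
     iint f (- x2) (- x1) (- y2) (- y1) = (-1) * iint f x1 x2 y1 y2).
  { intros x1 x2 y1 y2 a1 a2 a3 a4 a5 a6 a7.
    rewrite <- iint_comp_opp; auto.
    - rewrite <- iint_scal; auto.
      + apply iint_ext; auto. intros x y hx hy. rewrite Hodd; [ring|].
        apply pball_abs.
        * destruct a7 as [a7|[a7|[a7|a7]]]; [left|left|right|right]; apply Rabs_pos_lt; lra.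
        * apply Rabs_def1; lra.
        * apply Rabs_def1; lra.
      + apply (acont_rcont r); auto; lra.
    - apply (acont_rcont r); auto; lra. }
  unfold sq_annulus_int.
  generalize (E (- b) b e b ltac:(lra) ltac:(lra) ltac:(lra) ltac:(lra) ltac:(lra) ltac:(lra) ltac:(lra)).
  generalize (E e b (- e) e ltac:(lra) ltac:(lra) ltac:(lra) ltac:(lra) ltac:(lra) ltac:(lra) ltac:(lra)).
  rewrite !Ropp_involutive. lra.
Qed.

Lemma sq_annulus_scale t e b : 0 < t -> 0 < e -> e <= b -> t * b < r ->
  sq_annulus_int f (t * e) (t * b) = t ^ 2 * sq_annulus_int (fun x y => f (t * x) (t * y)) e b.
Proof.
  intros H0 H1 H2 H3. unfold sq_annulus_int.
  assert (h1 : 0 < t * e) by now apply Rmult_lt_0_compat.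
  assert (h2 : t * e <= t * b) by (apply Rmult_le_compat_l; lra).
  rewrite !Rmult_plus_distr_l.
  rewrite !iint_comp_scale by (lra || (apply (acont_rcont r); auto; lra)).
  rewrite !Ropp_mult_distr_r_reverse. reflexivity.
Qed.

End Annulus.

Lemma sq_annulus_ext f g e b : 0 < e -> e <= b ->
  (forall x y, e < nrm x y -> nrm x y < b -> f x y = g x y) ->
  sq_annulus_int f e b = sq_annulus_int g e b.
Proof.
  intros H1 H2 H. unfold sq_annulus_int.
  assert (E : forall x1 x2 y1 y2, x1 <= x2 -> y1 <= y2 -> - b <= x1 -> x2 <= b -> - b <= y1 -> y2 <= b ->
     (e <= x1 \/ x2 <= - e \/ e <= y1 \/ y2 <= - e) ->
     iint f x1 x2 y1 y2 = iint g x1 x2 y1 y2).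
  { intros x1 x2 y1 y2 a1 a2 a3 a4 a5 a6 a7. apply iint_ext; auto. intros x y hx hy. apply H.
    - destruct a7 as [a7|[a7|[a7|a7]]].
      + apply Rlt_le_trans with (Rabs x); [|apply Rmax_l]. unfold Rabs; destruct Rcase_abs; lra.
      + apply Rlt_le_trans with (Rabs x); [|apply Rmax_l]. unfold Rabs; destruct Rcase_abs; lra.
      + apply Rlt_le_trans with (Rabs y); [|apply Rmax_r]. unfold Rabs; destruct Rcase_abs; lra.
      + apply Rlt_le_trans with (Rabs y); [|apply Rmax_r]. unfold Rabs; destruct Rcase_abs; lra.
    - apply nrm_lt; apply Rabs_def1; lra. }
  rewrite !E by lra. reflexivity.
Qed.

Lemma sq_annulus_eq0 f e b : 0 < e -> e <= b ->
  (forall x y, e < nrm x y -> nrm x y < b -> f x y = 0) -> sq_annulus_int f e b = 0.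
Proof.
  intros H1 H2 H. rewrite (sq_annulus_ext f (fun _ _ => 0)); auto.
  unfold sq_annulus_int. rewrite !iint_eq0; auto; lra.
Qed.

Lemma sq_annulus_full f e b : 0 < e -> e <= b -> rcont f (- b) b (- b) b ->
  iint f (- b) b (- b) b = sq_annulus_int f e b + iint f (- e) e (- e) e.
Proof.
  intros H1 H2 H. unfold sq_annulus_int.
  assert (C : forall x1 x2 y1 y2, - b <= x1 -> x2 <= b -> - b <= y1 -> y2 <= b -> rcont f x1 x2 y1 y2).
  { intros. apply (rcont_mono f (- b) b (- b) b); auto. }
  rewrite (iint_Chasles_y f (- b) b (- b) (- e) b) by (lra || (apply C; lra)).
  rewrite (iint_Chasles_y f (- b) b (- e) e b) by (lra || (apply C; lra)).
  rewrite (iint_Chasles_x f (- b) (- e) b (- e) e) by (lra || (apply C; lra)).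
  rewrite (iint_Chasles_x f (- e) e b (- e) e) by (lra || (apply C; lra)).
  ring.
Qed.

(** * Homogeneous functions on square annuli *)

Lemma powerRZ_add_2 t d : 0 < t -> powerRZ t (d + 2) = t ^ 2 * powerRZ t d.
Proof.
  intros H. rewrite powerRZ_add by lra. change (powerRZ t 2) with (t ^ 2). ring.
Qed.

Lemma powerRZ_div t s d : 0 < t -> 0 < s -> powerRZ (t / s) d = powerRZ t d / powerRZ s d.
Proof. intros Ht Hs. unfold Rdiv. rewrite powerRZ_mult, powerRZ_inv'. reflexivity. Qed.

Lemma powerRZ_2_neq_1 (D : Z) : D <> 0%Z -> powerRZ 2 D <> 1.
Proof.
  intros HD.
  assert (P : forall n, 1 < 2 ^ S n).
  { induction n as [|n IH]; simpl in *; lra. }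
  destruct (Z_lt_le_dec 0 D) as [h|h].
  - replace D with (Z.of_nat (S (Z.to_nat (D - 1)))) by lia. rewrite <- pow_powerRZ.
    generalize (P (Z.to_nat (D - 1))). lra.
  - replace D with (- Z.of_nat (S (Z.to_nat (- D - 1))))%Z by lia.
    rewrite powerRZ_neg', <- pow_powerRZ. generalize (P (Z.to_nat (- D - 1))). intros h1 h2.
    apply (f_equal Rinv) in h2. rewrite Rinv_inv, Rinv_1 in h2. lra.
Qed.

Section Homogeneous.

Variables (g : R -> R -> R) (d : Z).
Hypothesis Hg : forall r, acont r g.
Hypothesis Hhom : forall t x y, 0 < t -> 0 < nrm x y -> g (t * x) (t * y) = powerRZ t d * g x y.

(** In polar terms this is the angular integral of [g] divided by [d + 2]; the annulus from 1 to 2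
    normalises it without polar coordinates. *)
Definition hconst : R := sq_annulus_int g 1 2 / (powerRZ 2 (d + 2) - 1).

Lemma sq_annulus_dilate t e b : 0 < t -> 0 < e -> e <= b ->
  sq_annulus_int g (t * e) (t * b) = powerRZ t (d + 2) * sq_annulus_int g e b.
Proof.
  intros Ht He Hb. rewrite (sq_annulus_scale (t * b + 1)) by (auto; lra).
  rewrite (sq_annulus_ext _ (fun x y => powerRZ t d * g x y)); auto.
  - rewrite (sq_annulus_scal (b + 1)) by (auto; lra). rewrite powerRZ_add_2 by auto. ring.
  - intros x y h1 h2. apply Hhom; auto. lra.
Qed.

(* Splitting [[1, s t]] at [s] and at [t] gives [a s (1 - t^D) = a t (1 - s^D)]. *)
Lemma sq_annulus_homogeneous e b : (d + 2 <> 0)%Z -> 0 < e -> e <= b ->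
  sq_annulus_int g e b = hconst * (powerRZ b (d + 2) - powerRZ e (d + 2)).
Proof.
  intros HD He Hb. set (a := fun s => sq_annulus_int g 1 s).
  assert (F : forall s t, 1 <= s -> 1 <= t -> a (s * t) = a s + powerRZ s (d + 2) * a t).
  { intros s t Hs Ht. unfold a. rewrite (sq_annulus_split (s * t + 1) g (Hg _) 1 s (s * t)) by nra.
    f_equal. rewrite <- sq_annulus_dilate by lra. f_equal. ring. }
  assert (A : forall s, 1 <= s -> a s = hconst * (powerRZ s (d + 2) - 1)).
  { intros s Hs. generalize (F s 2 Hs ltac:(lra)) (F 2 s ltac:(lra) Hs).
    rewrite (Rmult_comm 2 s). intros -> E. unfold hconst. fold (a 2).
    assert (N := powerRZ_2_neq_1 (d + 2) HD).
    assert (powerRZ 2 (d + 2) - 1 <> 0) by lra.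
    apply (Rmult_eq_reg_r (powerRZ 2 (d + 2) - 1)); auto. field_simplify; auto. lra. }
  assert (Q : 1 <= b / e) by (apply Rle_div_r; lra).
  generalize (A (b / e) Q). unfold a. intros E.
  replace (sq_annulus_int g e b) with (sq_annulus_int g (e * 1) (e * (b / e))).
  - rewrite sq_annulus_dilate, E by (auto; lra). rewrite powerRZ_div by lra.
    field. apply powerRZ_NOR. lra.
  - f_equal; field; lra.
Qed.

End Homogeneous.

(** * Hadamard finite parts *)

Definition rlim (f : R -> R) (L : R) : Prop :=
  forall e, 0 < e -> exists d, 0 < d /\ forall x, 0 < x < d -> Rabs (f x - L) < e.

Lemma rlim_iff f L : filterlim f (at_right 0) (locally L) <-> rlim f L.
Proof.
  split.
  - intros H e He. destruct (H (fun y => Rabs (y - L) < e)) as [d Hd].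
    { exists (mkposreal e He). intros y Hy. exact Hy. }
    exists d. split; [apply cond_pos|]. intros x Hx. apply Hd; [|lra].
    change (Rabs (x - 0) < d). rewrite Rminus_0_r, Rabs_pos_eq; lra.
  - intros H P [e He]. destruct (H e (cond_pos e)) as [d [Hd Hx]].
    exists (mkposreal d Hd). intros x h1 h2. apply He. apply Hx. split; auto.
    change (Rabs (x - 0) < d) in h1. rewrite Rminus_0_r, Rabs_pos_eq in h1; lra.
Qed.

Lemma rlim_ext f g L r : 0 < r -> (forall x, 0 < x < r -> f x = g x) -> rlim f L -> rlim g L.
Proof.
  intros Hr E H e He. destruct (H e He) as [d [Hd Hx]]. exists (Rmin r d). split; [now apply Rmin_pos|].
  intros x h. generalize (Rmin_l r d) (Rmin_r r d). intros. rewrite <- E by lra. apply Hx. lra.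
Qed.

Lemma rlim_const c : rlim (fun _ => c) c.
Proof. intros e He. exists 1. split; [lra|]. intros. rewrite Rminus_eq_0, Rabs_R0; auto. Qed.

Lemma rlim_plus f g L M : rlim f L -> rlim g M -> rlim (fun x => f x + g x) (L + M).
Proof.
  intros Hf Hg e He. destruct (Hf (e / 2) ltac:(lra)) as [d1 [h1 H1]].
  destruct (Hg (e / 2) ltac:(lra)) as [d2 [h2 H2]].
  exists (Rmin d1 d2). split; [now apply Rmin_pos|]. intros x h.
  generalize (Rmin_l d1 d2) (Rmin_r d1 d2). intros.
  replace (f x + g x - (L + M)) with ((f x - L) + (g x - M)) by ring.
  eapply Rle_lt_trans; [apply Rabs_triang|].
  generalize (H1 x ltac:(lra)) (H2 x ltac:(lra)). lra.
Qed.

Lemma rlim_scal c f L : rlim f L -> rlim (fun x => c * f x) (c * L).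
Proof.
  intros Hf e He. generalize (Rabs_pos c); intros hc.
  destruct (Hf (e / (Rabs c + 1))) as [d [Hd H]]; [apply Rdiv_lt_0_compat; lra|].
  exists d. split; auto. intros x h. rewrite <- Rmult_minus_distr_l, Rabs_mult.
  generalize (H x h) (Rabs_pos (f x - L)). intros h1 h2. apply Rlt_div_r in h1; [|lra]. nra.
Qed.

Lemma rlim_unique f L M : rlim f L -> rlim f M -> L = M.
Proof.
  intros H1 H2. destruct (Req_dec L M) as [|N]; auto. exfalso.
  assert (P : 0 < Rabs (L - M)) by (apply Rabs_pos_lt; lra).
  destruct (H1 (Rabs (L - M) / 2) ltac:(lra)) as [d1 [h1 K1]].
  destruct (H2 (Rabs (L - M) / 2) ltac:(lra)) as [d2 [h2 K2]].
  set (x := Rmin d1 d2 / 2).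
  assert (0 < Rmin d1 d2) by now apply Rmin_pos.
  generalize (Rmin_l d1 d2) (Rmin_r d1 d2). intros.
  generalize (K1 x ltac:(unfold x; lra)) (K2 x ltac:(unfold x; lra)). intros a1 a2.
  replace (L - M) with (- (f x - L) + (f x - M)) in a1, a2, P by ring.
  generalize (Rabs_triang (- (f x - L)) (f x - M)). rewrite Rabs_Ropp. lra.
Qed.

Lemma rlim_comp f L (u : R -> R) : rlim f L ->
  (forall d, 0 < d -> exists d', 0 < d' /\ forall x, 0 < x < d' -> 0 < u x < d) ->
  rlim (fun x => f (u x)) L.
Proof.
  intros Hf Hu e He. destruct (Hf e He) as [d [Hd H]]. destruct (Hu d Hd) as [d' [Hd' H']].
  exists d'. split; auto.
Qed.

Lemma rlim_half f L : rlim f L -> rlim (fun x => f (x / 2)) L.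
Proof. intros H. apply rlim_comp; auto. intros d Hd. exists d. split; auto. intros; lra. Qed.

(* [Phi (e/2) - 2^(K+1) Phi e] kills the most singular power. *)
Lemma singular_terms_limit K : forall (c : nat -> R) c0 L,
  rlim (fun e => rsum K (fun k => c k / e ^ S k) + c0 * ln e) L -> L = 0 /\ c0 = 0.
Proof.
  assert (LnH : forall e, 0 < e -> ln (e / 2) = ln e - ln 2) by (intros; apply ln_div; lra).
  assert (L2 : 0 < ln 2) by (rewrite <- ln_1; apply ln_increasing; lra).
  induction K as [|K IH]; intros c c0 L H.
  - assert (H0 : rlim (fun e => c0 * ln e) L).
    { refine (rlim_ext _ _ _ 1 Rlt_0_1 _ H). intros; rewrite rsum_0; lra. }
    (* Substituting [e * e] for [e] doubles the logarithm and keeps the limit, so [L = 2 L]. Halving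
       [e] then shifts the function by [c0 * ln 2], which forces [c0 = 0]. *)
    assert (L = 0).
    { assert (Hs : rlim (fun e => c0 * ln (e * e)) L).
      { apply (rlim_comp _ _ (fun e => e * e) H0). intros d Hd. exists (Rmin 1 d).
        split; [apply Rmin_pos; lra|]. intros x Hx. generalize (Rmin_l 1 d) (Rmin_r 1 d). intros. nra. }
      apply (rlim_ext _ (fun e => 2 * (c0 * ln e)) _ 1 Rlt_0_1) in Hs.
      - generalize (rlim_unique _ _ _ Hs (rlim_scal 2 _ _ H0)). lra.
      - intros x Hx. rewrite ln_mult by lra. ring. }
    split; auto. subst L.
    generalize (rlim_half _ _ H0). intros Hh.
    apply (rlim_ext _ (fun e => c0 * ln e + - (c0 * ln 2)) _ 1 Rlt_0_1) in Hh.
    2: { intros x Hx. rewrite LnH by lra. ring. }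
    generalize (rlim_unique _ _ _ Hh (rlim_plus _ _ _ _ H0 (rlim_const (- (c0 * ln 2))))). nra.
  - set (m := 2 ^ S K).
    assert (Hm : 1 < m).
    { unfold m. clear. induction K as [|K IH]; simpl in *; lra. }
    generalize (rlim_plus _ _ _ _ (rlim_plus _ _ _ _ (rlim_half _ _ H) (rlim_scal (- m) _ _ H))
                  (rlim_const (c0 * ln 2))). intros H1.
    apply (rlim_ext _ (fun e => rsum K (fun k => (c k * (2 ^ S k - m)) / e ^ S k)
              + (c0 * (1 - m)) * ln e) _ 1 Rlt_0_1) in H1.
    + apply IH in H1. destruct H1 as [E1 E2].
      assert (c0 = 0) by (apply Rmult_integral in E2; destruct E2; lra).
      subst c0. split; auto. assert (L * (1 - m) = 0) by lra.
      apply Rmult_integral in H0; destruct H0; lra.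
    + intros e He. rewrite LnH by lra.
      assert (Epow : forall k, c k / (e / 2) ^ S k = c k * 2 ^ S k / e ^ S k).
      { intros k. unfold Rdiv. rewrite Rpow_mult_distr, pow_inv. field.
        split; apply pow_nonzero; lra. }
      rewrite (rsum_ext (S K) (fun k => c k / (e / 2) ^ S k) (fun k => c k * 2 ^ S k / e ^ S k))
        by (intros; apply Epow).
      rewrite (rsum_ext K (fun k => c k * (2 ^ S k - m) / e ^ S k)
         (fun k => c k * 2 ^ S k / e ^ S k + (- m) * (c k / e ^ S k))).
      2: { intros; field. apply pow_nonzero; lra. }
      rewrite rsum_plus, rsum_scal, !rsum_S. fold m. field. apply pow_nonzero; lra.
Qed.

Lemma rsum_pad n m (f : nat -> R) : (n <= m)%nat ->
  rsum m (fun k => if (k <? n)%nat then f k else 0) = rsum n f.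
Proof.
  intros H. replace m with (n + (m - n))%nat by lia. rewrite rsum_add, (rsum_eq0 (m - n)).
  - rewrite Rplus_0_r. apply rsum_ext. intros i Hi. apply Nat.ltb_lt in Hi. now rewrite Hi.
  - intros i _. replace (n + i <? n)%nat with false; auto. symmetry. apply Nat.ltb_ge. lia.
Qed.

Definition sing (K : nat) (c : nat -> R) (c0 e : R) : R := rsum K (fun k => c k / e ^ S k) + c0 * ln e.

Lemma fp_rlim g b L : fp_square_int g b L <->
  exists K c c0, rlim (fun e => sq_annulus_int g e b - sing K c c0 e) L.
Proof.
  split; intros (K & c & c0 & H); exists K, c, c0.
  - apply rlim_iff in H. refine (rlim_ext _ _ _ 1 Rlt_0_1 _ H). intros; unfold sing; ring.
  - apply rlim_iff. refine (rlim_ext _ _ _ 1 Rlt_0_1 _ H). intros; unfold sing; ring.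
Qed.

Lemma sing_comb K1 c1 d1 K2 c2 d2 t : exists K c c0, forall e,
  sing K c c0 e = sing K1 c1 d1 e + t * sing K2 c2 d2 e.
Proof.
  exists (K1 + K2)%nat, (fun k => (if (k <? K1)%nat then c1 k else 0) +
     t * (if (k <? K2)%nat then c2 k else 0)), (d1 + t * d2).
  intros e. unfold sing.
  rewrite (rsum_ext (K1 + K2) _ (fun k => (if (k <? K1)%nat then c1 k / e ^ S k else 0) +
     t * (if (k <? K2)%nat then c2 k / e ^ S k else 0))).
  - rewrite rsum_plus, rsum_scal.
    rewrite (rsum_pad K1 (K1 + K2) (fun k => c1 k / e ^ S k)) by lia.
    rewrite (rsum_pad K2 (K1 + K2) (fun k => c2 k / e ^ S k)) by lia. ring.
  - intros k _. unfold Rdiv. destruct (k <? K1)%nat, (k <? K2)%nat; ring.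
Qed.

Lemma fp_unique g b L M : fp_square_int g b L -> fp_square_int g b M -> L = M.
Proof.
  intros H1 H2. apply fp_rlim in H1, H2.
  destruct H1 as (K1 & c1 & d1 & H1). destruct H2 as (K2 & c2 & d2 & H2).
  destruct (sing_comb K1 c1 d1 K2 c2 d2 (-1)) as (K & c & c0 & E).
  generalize (rlim_plus _ _ _ _ H2 (rlim_scal (-1) _ _ H1)). intros H.
  apply (rlim_ext _ (sing K c c0) _ 1 Rlt_0_1) in H.
  - apply singular_terms_limit in H. lra.
  - intros x _. rewrite E. ring.
Qed.

Lemma fp_plus r f g b L M : acont r f -> acont r g -> 0 < b -> b < r ->
  fp_square_int f b L -> fp_square_int g b M -> fp_square_int (fun x y => f x y + g x y) b (L + M).
Proof.
  intros Hf Hg Hb Hr H1 H2. apply fp_rlim in H1, H2. apply fp_rlim.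
  destruct H1 as (K1 & c1 & d1 & H1). destruct H2 as (K2 & c2 & d2 & H2).
  destruct (sing_comb K1 c1 d1 K2 c2 d2 1) as (K & c & c0 & E). exists K, c, c0.
  eapply rlim_ext; [exact Hb| |exact (rlim_plus _ _ _ _ H1 H2)].
  intros e He. rewrite (sq_annulus_plus r), E by (auto; lra). ring.
Qed.

Lemma fp_scal r f b c L : acont r f -> 0 < b -> b < r ->
  fp_square_int f b L -> fp_square_int (fun x y => c * f x y) b (c * L).
Proof.
  intros Hf Hb Hr H1. apply fp_rlim in H1. apply fp_rlim.
  destruct H1 as (K1 & c1 & d1 & H1).
  destruct (sing_comb 0 c1 0 K1 c1 d1 c) as (K & c' & c0 & E). exists K, c', c0.
  eapply rlim_ext; [exact Hb| |exact (rlim_scal c _ _ H1)].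
  intros e He. rewrite (sq_annulus_scal r), E by (auto; lra). unfold sing at 2. rewrite rsum_0. ring.
Qed.

Lemma fp_ext f g b L : 0 < b -> (forall x y, 0 < nrm x y < b -> f x y = g x y) ->
  fp_square_int f b L -> fp_square_int g b L.
Proof.
  intros Hb E H. apply fp_rlim in H. apply fp_rlim.
  destruct H as (K & c & c0 & H). exists K, c, c0.
  refine (rlim_ext _ _ _ b Hb _ H). intros e He. cbv beta.
  rewrite (sq_annulus_ext f g) by (lra || (intros; apply E; lra)). reflexivity.
Qed.

Lemma fp_continuous f b : 0 < b -> rcont f (- b) b (- b) b ->
  fp_square_int f b (iint f (- b) b (- b) b).
Proof.
  intros Hb Hf. apply fp_rlim. exists 0%nat, (fun _ => 0), 0.
  destruct (bounded_on_square f b Hb) as [C [C0 HC]].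
  { intros x y h. generalize (Rabs_le_nrm_l x y) (Rabs_le_nrm_r x y). intros.
    apply Hf; apply Rabs_le_between; lra. }
  (* The omitted square of half side [x < 1] contributes at most [4 C x^2], and this is below
     [e]. *)
  intros e He. exists (Rmin b (Rmin 1 (e / (4 * C + 1)))).
  assert (P : 0 < e / (4 * C + 1)) by (apply Rdiv_lt_0_compat; lra).
  split; [repeat apply Rmin_pos; lra|].
  intros x Hx. generalize (Rmin_l b (Rmin 1 (e / (4 * C + 1)))) (Rmin_r b (Rmin 1 (e / (4 * C + 1))))
    (Rmin_l 1 (e / (4 * C + 1))) (Rmin_r 1 (e / (4 * C + 1))). intros.
  unfold sing. rewrite rsum_0, (sq_annulus_full f x b) by (auto; lra).
  replace (sq_annulus_int f x b - (0 + 0 * ln x) - (sq_annulus_int f x b + iint f (- x) x (- x) x))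
    with (- iint f (- x) x (- x) x) by ring.
  rewrite Rabs_Ropp. eapply Rle_lt_trans.
  - apply (iint_bound f _ _ _ _ C); try lra.
    + apply (rcont_mono f (- b) b (- b) b); auto; lra.
    + intros u v hu hv. apply HC. apply nrm_le; apply Rabs_le; lra.
  - assert (Q : x < e / (4 * C + 1)) by lra. apply Rlt_div_r in Q; [|lra]. nra.
Qed.

Lemma fp_odd r f b : acont r f -> 0 < b -> b < r ->
  (forall x y, pball r x y -> f (- x) (- y) = - f x y) -> fp_square_int f b 0.
Proof.
  intros Hf Hb Hr Ho. apply fp_rlim. exists 0%nat, (fun _ => 0), 0.
  apply (rlim_ext (fun _ => 0) _ _ b); auto using rlim_const.
  intros e He. unfold sing. rewrite rsum_0, (sq_annulus_odd r) by (auto; lra). ring.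
Qed.

(** On the annulus from [e] to [del] the integral is [hconst] times the difference of the powers of
    exponent [D = d + 2]. For [D > 0] the power of [e] tends to 0; for [D < 0] it is one of the
    divergent terms that the finite part discards, with index [- D - 1]. *)
Lemma fp_homogeneous g d G del b r :
  (forall r, acont r g) ->
  (forall t x y, 0 < t -> 0 < nrm x y -> g (t * x) (t * y) = powerRZ t d * g x y) ->
  (d + 2 <> 0)%Z -> acont r G -> 0 < del -> del <= b -> b < r ->
  (forall x y, 0 < nrm x y < del -> G x y = g x y) ->
  fp_square_int G b (hconst g d * powerRZ del (d + 2) + sq_annulus_int G del b).
Proof.
  intros Hg Hh HD HG Hdel Hb Hr E.
  assert (A : forall e, 0 < e < del -> sq_annulus_int G e b =
     - hconst g d * powerRZ e (d + 2) + (hconst g d * powerRZ del (d + 2) + sq_annulus_int G del b)).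
  { intros e He. rewrite (sq_annulus_split r G HG e del b) by lra.
    rewrite (sq_annulus_ext G g e del) by (lra || (intros; apply E; lra)).
    rewrite (sq_annulus_homogeneous g d Hg Hh) by (auto; lra). ring. }
  set (D := (d + 2)%Z) in *. set (V := hconst g d * powerRZ del D + sq_annulus_int G del b) in *.
  apply fp_rlim. destruct (Z_lt_le_dec 0 D) as [h|h].
  - exists 0%nat, (fun _ => 0), 0.
    replace V with (- hconst g d * 0 + V) by ring.
    apply (rlim_ext (fun e => - hconst g d * powerRZ e D + V) _ _ del); auto.
    + intros e He. rewrite A by auto. unfold sing. rewrite rsum_0. ring.
    + apply rlim_plus; [|apply rlim_const]. apply rlim_scal.
      intros e He. exists (Rmin 1 e). split; [apply Rmin_pos; lra|].
      intros x Hx. generalize (Rmin_l 1 e) (Rmin_r 1 e). intros.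
      replace D with (Z.of_nat (S (Z.to_nat (D - 1)))) by lia. rewrite <- pow_powerRZ. simpl.
      assert (P : 0 <= x ^ Z.to_nat (D - 1) <= 1).
      { split; [apply pow_le; lra|]. rewrite <- (pow1 (Z.to_nat (D - 1))). apply pow_incr; lra. }
      rewrite Rminus_0_r, Rabs_pos_eq by nra. nra.
  - set (n := Z.to_nat (- D - 1)).
    exists (S n), (fun k => if (k =? n)%nat then - hconst g d else 0), 0.
    apply (rlim_ext (fun _ => V) _ _ del); auto using rlim_const.
    intros e He. rewrite A by auto. unfold sing. rewrite rsum_S, rsum_eq0.
    + rewrite Nat.eqb_refl. replace D with (- Z.of_nat (S n))%Z by (unfold n; lia).
      rewrite powerRZ_neg', <- pow_powerRZ. unfold Rdiv. ring.
    + intros i Hi. replace (i =? n)%nat with false; [unfold Rdiv; ring|].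
      symmetry. apply Nat.eqb_neq. lia.
Qed.

(** * A smooth cutoff *)

Definition flat_exp (k : nat) (z : R) : R := if Rlt_dec 0 z then (/ z) ^ k * exp (- / z) else 0.

(** The linear span of the [flat_exp k], closed under differentiation and so an admissible class of
    outer functions for [Gn_comp]. *)
Inductive flat : (R -> R) -> Prop :=
  | flat_base k : flat (flat_exp k)
  | flat_plus f g : flat f -> flat g -> flat (fun z => f z + g z)
  | flat_scal c f : flat f -> flat (fun z => c * f z).

(** The term of order [k + 2] of the exponential series bounds [exp (1 / z)] from below. A quadratic
    bound is what differentiability at 0 needs. *)
Lemma flat_exp_le k z : 0 < z -> 0 <= flat_exp k z <= INR (fact (k + 2)) * z ^ 2.
Proof.
  intros Hz. unfold flat_exp. destruct Rlt_dec as [_|n]; [|lra].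
  assert (Hx : 0 < / z) by now apply Rinv_0_lt_compat.
  assert (P : 0 < (/ z) ^ k) by now apply pow_lt.
  split; [apply Rmult_le_pos; [lra|left; apply exp_pos]|].
  assert (T : (/ z) ^ (k + 2) / INR (fact (k + 2)) <= exp (/ z)).
  { eapply Rle_trans; [|apply (exp_ge_taylor (/ z) (k + 2)); lra].
    replace (k + 2)%nat with (S (k + 1)) by lia. rewrite tech5.
    assert (0 <= sum_f_R0 (fun j => (/ z) ^ j / INR (fact j)) (k + 1)).
    { apply cond_pos_sum. intros j. apply Rdiv_le_0_compat; [apply pow_le; lra|apply INR_fact_lt_0]. }
    lra. }
  generalize (INR_fact_lt_0 (k + 2)); intros F0.
  rewrite exp_Ropp. generalize (exp_pos (/ z)); intros E0.
  apply Rle_div_l in T; auto. apply Rle_div_l; auto.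
  rewrite pow_add, pow_inv with (n := 2%nat) in T.
  assert (Z2 : 0 < z ^ 2) by now apply pow_lt.
  replace ((/ z) ^ k) with ((/ z) ^ k * / z ^ 2 * z ^ 2) by (field; lra).
  apply Rle_trans with (exp (/ z) * INR (fact (k + 2)) * z ^ 2).
  - apply Rmult_le_compat_r; lra.
  - right; ring.
Qed.

Lemma is_derive_0_quadratic (f : R -> R) C : f 0 = 0 -> (forall t, Rabs (f t) <= C * t ^ 2) -> is_derive f 0 0.
Proof.
  intros f0 H.
  split; [apply is_linear_scal_l|]. intros x Hx.
  apply (is_filter_lim_locally_unique (K := R_AbsRing) (V := R_NormedModule)) in Hx. subst x.
  intros eps. generalize (Rabs_pos C); intros C0.
  assert (He : 0 < eps / (Rabs C + 1)) by (apply Rdiv_lt_0_compat; [apply cond_pos|lra]).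
  exists (mkposreal _ He). intros t Ht.
  change (Rabs (t - 0) < eps / (Rabs C + 1)) in Ht.
  change (Rabs (f t - f 0 - (t - 0) * 0) <= eps * Rabs (t - 0)). rewrite Rminus_0_r in *.
  rewrite f0. replace (f t - 0 - t * 0) with (f t) by ring.
  eapply Rle_trans; [apply H|]. rewrite <- (pow2_abs t).
  apply Rlt_div_r in Ht; [|lra]. generalize (Rabs_pos t) (Rle_abs C). intros. simpl.
  rewrite Rmult_1_r. assert (C * Rabs t <= eps) by nra. nra.
Qed.

Lemma flat_exp_is_derive k z :
  is_derive (flat_exp k) z (- INR k * flat_exp (S k) z + flat_exp (S (S k)) z).
Proof.
  destruct (Rtotal_order z 0) as [Hz|[Hz|Hz]].
  - apply (is_derive_ext_loc (fun _ => 0)).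
    + exists (mkposreal (- z) ltac:(lra)). intros t Ht. change (Rabs (t - z) < - z) in Ht.
      apply Rabs_def2 in Ht. unfold flat_exp. destruct Rlt_dec; [lra|reflexivity].
    + unfold flat_exp. destruct Rlt_dec; [lra|].
      replace (- INR k * 0 + 0) with 0 by ring.
      apply is_derive_cst.
  - subst z. replace (- INR k * flat_exp (S k) 0 + flat_exp (S (S k)) 0) with 0.
    2: { unfold flat_exp. destruct Rlt_dec; [lra|ring]. }
    apply (is_derive_0_quadratic _ (INR (fact (k + 2)))).
    + unfold flat_exp. destruct Rlt_dec; [lra|reflexivity].
    + intros t. destruct (Rlt_dec 0 t) as [h|h].
      * generalize (flat_exp_le k t h). intros. rewrite Rabs_pos_eq; lra.
      * unfold flat_exp. destruct Rlt_dec; [lra|]. rewrite Rabs_R0.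
        apply Rmult_le_pos; [left; apply INR_fact_lt_0|apply pow2_ge_0].
  - apply (is_derive_ext_loc (fun t => (/ t) ^ k * exp (- / t))).
    + exists (mkposreal z Hz). intros t Ht. change (Rabs (t - z) < z) in Ht.
      apply Rabs_def2 in Ht. unfold flat_exp. destruct Rlt_dec; [reflexivity|lra].
    + unfold flat_exp. destruct Rlt_dec; [|lra].
      assert (Di : is_derive (fun t => / t) z (- / z ^ 2)).
      { auto_derive; [lra|]. field. lra. }
      replace (- INR k * ((/ z) ^ S k * exp (- / z)) + (/ z) ^ S (S k) * exp (- / z)) with
        ((INR k * (- / z ^ 2) * (/ z) ^ pred k) * exp (- / z) + (/ z) ^ k * (/ z ^ 2 * exp (- / z))).
      * apply (is_derive_mult (fun t => (/ t) ^ k) (fun t => exp (- / t))).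
        -- now apply (is_derive_pow (fun t => / t)).
        -- auto_derive; [lra|]. field. lra.
        -- intros; apply Rmult_comm.
      * destruct k as [|k]; [simpl; field; lra|]. simpl pred.
        rewrite <- !tech_pow_Rmult. field. lra.
Qed.

Lemma flat_derive f : flat f -> exists f', flat f' /\ forall z, is_derive f z (f' z).
Proof.
  induction 1 as [k|f g Hf [f' [F1 F2]] Hg [g' [G1 G2]]|c f Hf [f' [F1 F2]]].
  - exists (fun z => - INR k * flat_exp (S k) z + flat_exp (S (S k)) z). split.
    + apply flat_plus; [apply flat_scal|]; apply flat_base.
    + apply flat_exp_is_derive.
  - exists (fun z => f' z + g' z). split; [now apply flat_plus|].
    intros z. now apply (is_derive_plus f g).
  - exists (fun z => c * f' z). split; [now apply flat_scal|].
    intros z. now apply (is_derive_scal f).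
Qed.

Lemma Cn_flat (U : R -> R -> Prop) n f g : open2 U -> flat g -> Cn n U f -> Cn n U (fun x y => g (f x y)).
Proof.
  intros HU Hg Hf.
  refine (Gn_comp False U HU _ (fun _ g => flat g) (fun _ => True) 0 f _ _ _ n 0 g Hg Hf).
  - contradiction.
  - intros d k Hk. destruct (flat_derive k Hk) as [k' [h1 h2]]. exists k'. split; auto.
  - auto.
  - contradiction.
Qed.

(** A smooth step from 1 to 0. The two arguments in the denominator add up to [hi - lo], so for
    [lo < hi] one of them is positive and the quotient is smooth. *)
Definition cut (lo hi t : R) : R :=
  flat_exp 0 (hi - t) / (flat_exp 0 (hi - t) + flat_exp 0 (t - lo)).

Lemma flat_exp_0_pos z : 0 < z -> 0 < flat_exp 0 z.
Proof.
  intros H. unfold flat_exp. destruct Rlt_dec; [|lra]. simpl. rewrite Rmult_1_l. apply exp_pos.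
Qed.

Lemma flat_exp_0_eq0 z : z <= 0 -> flat_exp 0 z = 0.
Proof. intros H. unfold flat_exp. destruct Rlt_dec; [lra|reflexivity]. Qed.

Lemma flat_exp_0_ge0 z : 0 <= flat_exp 0 z.
Proof.
  destruct (Rlt_dec 0 z); [left; now apply flat_exp_0_pos|]. rewrite flat_exp_0_eq0; lra.
Qed.

Lemma cut_den_pos lo hi t : lo < hi -> 0 < flat_exp 0 (hi - t) + flat_exp 0 (t - lo).
Proof.
  intros H. generalize (flat_exp_0_ge0 (hi - t)) (flat_exp_0_ge0 (t - lo)). intros.
  destruct (Rlt_dec t hi).
  - generalize (flat_exp_0_pos (hi - t) ltac:(lra)). lra.
  - generalize (flat_exp_0_pos (t - lo) ltac:(lra)). lra.
Qed.

Lemma cut_eq1 lo hi t : lo < hi -> t <= lo -> cut lo hi t = 1.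
Proof.
  intros H Ht. unfold cut. generalize (cut_den_pos lo hi t H).
  rewrite (flat_exp_0_eq0 (t - lo)) by lra. intros. field. lra.
Qed.

Lemma cut_eq0 lo hi t : hi <= t -> cut lo hi t = 0.
Proof. intros Ht. unfold cut. rewrite (flat_exp_0_eq0 (hi - t)) by lra. unfold Rdiv. ring. Qed.

Lemma cut_bounds lo hi t : lo < hi -> 0 <= cut lo hi t <= 1.
Proof.
  intros H. unfold cut. generalize (cut_den_pos lo hi t H). intros D.
  generalize (flat_exp_0_ge0 (hi - t)) (flat_exp_0_ge0 (t - lo)). intros.
  split; [apply Rdiv_le_0_compat; auto|]. apply Rle_div_l; lra.
Qed.

Lemma Cn_cut n lo hi f : lo < hi -> Cn n (fun _ _ => True) f ->
  Cn n (fun _ _ => True) (fun x y => cut lo hi (f x y)).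
Proof.
  intros H Hf. assert (O := open2_True).
  assert (A : Cn n (fun _ _ => True) (fun x y => flat_exp 0 (hi - f x y))).
  { apply (Cn_flat _ n (fun x y => hi - f x y) (flat_exp 0) O (flat_base 0)).
    apply Cn_minus; auto. now apply Cn_const. }
  assert (B : Cn n (fun _ _ => True) (fun x y => flat_exp 0 (f x y - lo))).
  { apply (Cn_flat _ n (fun x y => f x y - lo) (flat_exp 0) O (flat_base 0)).
    apply Cn_minus; auto. now apply Cn_const. }
  apply (Cn_ext _ O n (fun x y => flat_exp 0 (hi - f x y) *
     Rpower (flat_exp 0 (hi - f x y) + flat_exp 0 (f x y - lo)) (-1))).
  - intros x y _. unfold cut, Rdiv. f_equal.
    change (-1) with (Ropp 1). rewrite Rpower_Ropp, Rpower_1; auto. now apply cut_den_pos.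
  - apply Cn_mult; auto. apply Cn_Rpower; auto.
    + intros x y _. now apply cut_den_pos.
    + now apply Cn_plus.
Qed.

Lemma cutoff_exists del B : 0 < del -> del < B -> exists eta, cutoff eta /\
  (forall x y, nrm x y <= del -> eta x y = 1) /\
  (forall x y, B <= nrm x y -> eta x y = 0) /\
  (forall x y, 0 <= eta x y <= 1).
Proof.
  intros Hd HB. assert (H : del ^ 2 < B ^ 2) by nra.
  (* Steps in [x ^ 2] and [y ^ 2] avoid the corner of the absolute value and give evenness; their
     product fits the level sets of the sup norm. *)
  exists (fun x y => cut (del ^ 2) (B ^ 2) (x ^ 2) * cut (del ^ 2) (B ^ 2) (y ^ 2)).
  assert (E1 : forall x y, nrm x y <= del ->
     cut (del ^ 2) (B ^ 2) (x ^ 2) * cut (del ^ 2) (B ^ 2) (y ^ 2) = 1).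
  { intros x y h. generalize (Rabs_le_nrm_l x y) (Rabs_le_nrm_r x y) (Rabs_pos x) (Rabs_pos y). intros.
    rewrite !cut_eq1; auto; [ring| |].
    - rewrite <- (pow2_abs y). apply pow_incr; lra.
    - rewrite <- (pow2_abs x). apply pow_incr; lra. }
  assert (E0 : forall x y, B <= nrm x y ->
     cut (del ^ 2) (B ^ 2) (x ^ 2) * cut (del ^ 2) (B ^ 2) (y ^ 2) = 0).
  { intros x y. unfold nrm, Rmax. destruct Rle_dec; intros h.
    - rewrite (cut_eq0 _ _ (y ^ 2)); [ring|]. rewrite <- (pow2_abs y). apply pow_incr; lra.
    - rewrite (cut_eq0 _ _ (x ^ 2)); [ring|]. rewrite <- (pow2_abs x). apply pow_incr; lra. }
  split; [split; [|split; [|split]]|split; [exact E1|split; [exact E0|]]].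
  - apply Cn_smooth_on. intros n. assert (O := open2_True). apply Cn_mult; auto.
    + apply (Cn_cut n _ _ (fun x _ => x ^ 2)); auto.
      apply (Cn_pow _ O n (fun x _ => x)). now apply Cn_x.
    + apply (Cn_cut n _ _ (fun _ y => y ^ 2)); auto.
      apply (Cn_pow _ O n (fun _ y => y)). now apply Cn_y.
  - exists B. split; [lra|]. intros x y h. apply E0. unfold nrm; lra.
  - intros x y. f_equal; f_equal; ring.
  - apply E1. rewrite nrm_00; lra.
  - intros x y.
    generalize (cut_bounds (del ^ 2) (B ^ 2) (x ^ 2) H) (cut_bounds (del ^ 2) (B ^ 2) (y ^ 2) H). nra.
Qed.

(** * Punctured lattice sums *)

Definition psum (F : Z -> Z -> R) (K : Z) : R :=
  zsum (- K) K (fun i => zsum (- K) K (fun j => if (Z.eqb i 0 && Z.eqb j 0)%bool then 0 else F i j)).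

Lemma psum_ext F G K : (forall i j, (i <> 0 \/ j <> 0)%Z -> F i j = G i j) -> psum F K = psum G K.
Proof.
  intros H. apply zsum_ext. intros i _. apply zsum_ext. intros j _.
  destruct (Z.eqb_spec i 0); destruct (Z.eqb_spec j 0); simpl; auto.
Qed.

Lemma psum_scal c F K : psum (fun i j => c * F i j) K = c * psum F K.
Proof.
  unfold psum. rewrite <- zsum_scal. apply zsum_ext. intros i _. rewrite <- zsum_scal.
  apply zsum_ext. intros j _. destruct (_ && _)%bool; ring.
Qed.

Lemma psum_odd F K : (forall i j, F (- i)%Z (- j)%Z = - F i j) -> psum F K = 0.
Proof.
  intros H. assert (E : psum F K = - psum F K); [|lra].
  replace (- psum F K) with ((-1) * psum F K) by ring. rewrite <- psum_scal. unfold psum at 1.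
  rewrite <- zsum_opp_index. apply zsum_ext. intros i _. rewrite <- zsum_opp_index.
  apply zsum_ext. intros j _.
  replace (Z.eqb (- i) 0) with (Z.eqb i 0) by (destruct (Z.eqb_spec i 0), (Z.eqb_spec (- i) 0); lia || auto).
  replace (Z.eqb (- j) 0) with (Z.eqb j 0) by (destruct (Z.eqb_spec j 0), (Z.eqb_spec (- j) 0); lia || auto).
  destruct (_ && _)%bool; auto. rewrite H. ring.
Qed.

Lemma nrm_grid_ge (i j N : Z) h : 0 < h -> (N <= Z.abs i \/ N <= Z.abs j)%Z ->
  IZR N * h <= nrm (IZR i * h) (IZR j * h).
Proof.
  intros Hh [H|H]; apply IZR_le in H; rewrite abs_IZR in H.
  - eapply Rle_trans; [|apply Rmax_l]. rewrite Rabs_mult, (Rabs_pos_eq h) by lra.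
    apply Rmult_le_compat_r; lra.
  - eapply Rle_trans; [|apply Rmax_r]. rewrite Rabs_mult, (Rabs_pos_eq h) by lra.
    apply Rmult_le_compat_r; lra.
Qed.

(** The trapezoidal sum runs from [- N] to [N - 1]. When [F] vanishes on the outer rows it can be
    completed to a sum symmetric under reflection, of any larger range. *)
Lemma trap_sum_psum F B N K h : 0 < h -> (0 <= N)%Z -> (N <= K)%Z -> B <= IZR N * h ->
  (forall x y, B <= nrm x y -> F x y = 0) ->
  trap_sum F N h = psum (fun i j => F (IZR i * h) (IZR j * h) * h ^ 2) K.
Proof.
  intros Hh HN HK HB HF. unfold trap_sum, psum.
  assert (V : forall i j, (N <= Z.abs i \/ N <= Z.abs j)%Z -> F (IZR i * h) (IZR j * h) = 0).
  { intros i j Hij. apply HF. eapply Rle_trans; [exact HB|]. now apply nrm_grid_ge. }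
  rewrite (zsum_support (- N) (N - 1) (- K) K); try lia.
  - apply zsum_ext. intros i _. symmetry. apply zsum_support; try lia.
    intros j Hj. destruct (_ && _)%bool; auto. rewrite V by lia. ring.
  - intros i Hi. apply zsum_eq0. intros j _. destruct (_ && _)%bool; auto. rewrite V by lia. ring.
Qed.

Lemma trap_sum_indep F B N N' h : 0 < h -> (0 <= N)%Z -> (0 <= N')%Z ->
  B <= IZR N * h -> B <= IZR N' * h -> (forall x y, B <= nrm x y -> F x y = 0) ->
  trap_sum F N h = trap_sum F N' h.
Proof.
  intros Hh HN HN' HB HB' HF. rewrite (trap_sum_psum F B N (N + N') h) by (auto; lia).
  rewrite (trap_sum_psum F B N' (N + N') h) by (auto; lia). reflexivity.
Qed.

Lemma trap_sum_plus F G N h :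
  trap_sum (fun x y => F x y + G x y) N h = trap_sum F N h + trap_sum G N h.
Proof.
  unfold trap_sum. rewrite <- zsum_plus. apply zsum_ext. intros i _. rewrite <- zsum_plus.
  apply zsum_ext. intros j _. destruct (_ && _)%bool; ring.
Qed.

Lemma trap_sum_scal c F N h : trap_sum (fun x y => c * F x y) N h = c * trap_sum F N h.
Proof.
  unfold trap_sum. rewrite <- zsum_scal. apply zsum_ext. intros i _. rewrite <- zsum_scal.
  apply zsum_ext. intros j _. destruct (_ && _)%bool; ring.
Qed.

Lemma trap_sum_ext F G N h : 0 < h ->
  (forall x y, 0 < nrm x y -> nrm x y <= IZR N * h -> F x y = G x y) -> trap_sum F N h = trap_sum G N h.
Proof.
  intros Hh H. apply zsum_ext. intros i Hi. apply zsum_ext. intros j Hj.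
  destruct (Z.eqb_spec i 0); destruct (Z.eqb_spec j 0); simpl; auto; rewrite H; auto;
    try (apply nrm_pos; intros E; injection E; intros E1 E2;
         apply Rmult_integral in E1, E2; destruct E1 as [E1|]; destruct E2 as [E2|]; try lra;
         apply eq_IZR in E1; apply eq_IZR in E2; lia);
    apply nrm_le; rewrite Rabs_mult, (Rabs_pos_eq h), <- abs_IZR by lra;
    (apply Rmult_le_compat_r; [lra|apply IZR_le; lia]).
Qed.

Lemma trap_sum_grid_sum F N h : F 0 0 = 0 -> trap_sum F N h = grid_sum F N h.
Proof.
  intros H. apply zsum_ext. intros i _. apply zsum_ext. intros j _.
  destruct (Z.eqb_spec i 0); destruct (Z.eqb_spec j 0); simpl; auto.
  subst. rewrite !Rmult_0_l, H. ring.
Qed.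

(** * Normal derivatives on the boundary of the square *)

Lemma dxn_ext U f g : open2 U -> (forall x y, U x y -> f x y = g x y) ->
  forall k x y, U x y -> dxn k f x y = dxn k g x y.
Proof.
  intros HU H k. induction k as [|k IH]; intros x y h; simpl; auto. apply Derive_ext_loc.
  apply (locally_2d_1d_const_y (fun u v => dxn k f u v = dxn k g u v)).
  destruct (HU x y h) as [e He]. exists e. intros; apply IH; auto.
Qed.

Lemma dyn_ext U f g : open2 U -> (forall x y, U x y -> f x y = g x y) ->
  forall k x y, U x y -> dyn k f x y = dyn k g x y.
Proof.
  intros HU H k. induction k as [|k IH]; intros x y h; simpl; auto. apply Derive_ext_loc.
  apply (locally_2d_1d_const_x (fun u v => dyn k f u v = dyn k g u v)).
  destruct (HU x y h) as [e He]. exists e. intros; apply IH; auto.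
Qed.

Lemma dxn_0 k x y : dxn k (fun _ _ => 0) x y = 0.
Proof.
  revert x y. induction k as [|k IH]; intros x y; simpl; auto. unfold dx.
  rewrite (Derive_ext _ (fun _ => 0)) by (intros; apply IH). apply Derive_const.
Qed.

Lemma dyn_0 k x y : dyn k (fun _ _ => 0) x y = 0.
Proof.
  revert x y. induction k as [|k IH]; intros x y; simpl; auto. unfold dy.
  rewrite (Derive_ext _ (fun _ => 0)) by (intros; apply IH). apply Derive_const.
Qed.

Lemma matching_of_support A B J f : B < A -> (forall x y, B < nrm x y -> f x y = 0) -> matching A J f.
Proof.
  intros HA H k s Hk Hs. assert (Z : 0 <= Rabs s) by apply Rabs_pos.
  assert (P : B < Rabs A /\ B < Rabs (- A)) by (rewrite Rabs_Ropp, Rabs_pos_eq; lra).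
  split.
  - rewrite !(dxn_ext _ f (fun _ _ => 0) (open2_nrm_gt B) H), !dxn_0; auto;
      (eapply Rlt_le_trans; [|apply Rmax_l]; apply P).
  - rewrite !(dyn_ext _ f (fun _ _ => 0) (open2_nrm_gt B) H), !dyn_0; auto;
      (eapply Rlt_le_trans; [|apply Rmax_r]; apply P).
Qed.

Lemma dxn_dyn_bound J f r r' : 0 < r -> r < r' -> Cn J (fun x y => nrm x y < r') f ->
  exists Bd, 0 < Bd /\ forall x y, nrm x y <= r -> Rabs (dxn J f x y) <= Bd /\ Rabs (dyn J f x y) <= Bd.
Proof.
  intros Hr Hr' HC.
  destruct (bounded_on_square (dxn J f) r Hr) as [C1 [P1 H1]].
  { intros x y h. apply (Cn_continuity 0 (fun x y => nrm x y < r')); [|lra].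
    apply Cn_dxn. now rewrite Nat.add_0_r. }
  destruct (bounded_on_square (dyn J f) r Hr) as [C2 [P2 H2]].
  { intros x y h. apply (Cn_continuity 0 (fun x y => nrm x y < r')); [|lra].
    apply Cn_dyn. now rewrite Nat.add_0_r. }
  exists (C1 + C2). split; [lra|]. intros x y h. generalize (H1 x y h) (H2 x y h). lra.
Qed.

(** * Homogeneous functions times a cutoff *)

Section CutHomogeneous.

Variables (g eta : R -> R -> R) (d : Z) (del B : R).
Hypothesis Hdel : 0 < del.
Hypothesis HB : del < B.
Hypothesis gsmooth : forall n, Cn n (fun x y => 0 < nrm x y) g.
Hypothesis ghom : forall t x y, 0 < t -> 0 < nrm x y -> g (t * x) (t * y) = powerRZ t d * g x y.
Hypothesis etasmooth : Smooth eta.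
Hypothesis eta1 : forall x y, nrm x y <= del -> eta x y = 1.
Hypothesis eta0 : forall x y, B <= nrm x y -> eta x y = 0.
Hypothesis eta01 : forall x y, 0 <= eta x y <= 1.

Definition cutg (x y : R) : R := g x y * eta x y.

Lemma acont_g r : acont r g.
Proof. intros x y [h _]. exact (Cn_continuity 0 _ g x y (gsmooth 0) h). Qed.

Lemma acont_cutg r : acont r cutg.
Proof.
  intros x y h. apply continuity_2d_pt_mult; [now apply (acont_g r)|]. now apply Smooth_continuity.
Qed.

Lemma cutg_eq0 x y : B <= nrm x y -> cutg x y = 0.
Proof. intros h. unfold cutg. rewrite eta0 by auto. ring. Qed.

Lemma Cn_cutg n : Cn n (fun x y => 0 < nrm x y) cutg.
Proof.
  apply Cn_mult; [apply open2_nrm_gt|apply gsmooth|].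
  apply (Cn_mono (fun _ _ => True)); auto.
Qed.

(** The finite part of the integral of [cutg]: the first term is the share of the square of half
    side [del], where [cutg] is homogeneous. *)
Definition fpv : R := hconst g d * powerRZ del (d + 2) + sq_annulus_int cutg del B.

Lemma sq_annulus_cutg b : B <= b -> sq_annulus_int cutg del b = sq_annulus_int cutg del B.
Proof.
  intros Hb. rewrite (sq_annulus_split (b + 1) cutg (acont_cutg _) del B b) by lra.
  rewrite (sq_annulus_eq0 cutg B b); [ring|lra|lra|]. intros x y h _. apply cutg_eq0; lra.
Qed.

Lemma fp_cutg b : (d + 2 <> 0)%Z -> B <= b -> fp_square_int cutg b fpv.
Proof.
  intros HD Hb. unfold fpv. rewrite <- (sq_annulus_cutg b Hb).
  apply (fp_homogeneous g d cutg del b (b + 1)); auto using acont_g, acont_cutg; try lra.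
  intros x y h. unfold cutg. rewrite eta1 by lra. ring.
Qed.

(** This is the integral in the Wigner limit, where the cutoff is dilated instead of the grid.
    Finite parts follow a dilation exactly when no logarithm occurs, whence [d + 2 <> 0]. *)
Lemma fp_cutg_scaled h b : (d + 2 <> 0)%Z -> 0 < h -> B <= b * h ->
  fp_square_int (fun x y => g x y * eta (x * h) (y * h)) b (powerRZ h (- (d + 2)) * fpv).
Proof.
  intros HD Hh Hb. set (G := fun x y => g x y * eta (x * h) (y * h)).
  assert (Pd : powerRZ h d <> 0) by (apply powerRZ_NOR; lra).
  assert (PD : powerRZ h (d + 2) = h ^ 2 * powerRZ h d) by now apply powerRZ_add_2.
  assert (Hdh : del / h * h = del) by (field; lra).
  assert (Hdb : del / h <= b).
  { apply Rle_div_l; lra. }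
  assert (EG : forall x y, 0 < nrm x y -> G x y = / powerRZ h d * cutg (h * x) (h * y)).
  { intros x y hn. unfold G, cutg. rewrite ghom by auto. rewrite (Rmult_comm x), (Rmult_comm y). field. auto. }
  assert (CG : acont (b + 1) G).
  { intros x y [h1 h2]. apply continuity_2d_pt_mult; [apply (acont_g (b + 1)); now split|].
    intros e. destruct (Smooth_continuity eta etasmooth (x * h) (y * h) e) as [dd Hdd].
    exists (mkposreal (dd / h) ltac:(apply Rdiv_lt_0_compat; auto; apply cond_pos)). simpl.
    intros u v Hu Hv. apply Hdd; rewrite <- Rmult_minus_distr_r, Rabs_mult, (Rabs_pos_eq h) by lra;
      now apply Rlt_div_r. }
  replace (powerRZ h (- (d + 2)) * fpv) with
    (hconst g d * powerRZ (del / h) (d + 2) + sq_annulus_int G (del / h) b).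
  - apply (fp_homogeneous g d G (del / h) b (b + 1)); auto using acont_g; try lra.
    + now apply Rdiv_lt_0_compat.
    + intros x y hn. unfold G. rewrite eta1; [ring|].
      rewrite (Rmult_comm x), (Rmult_comm y), nrm_mult, Rabs_pos_eq by lra.
      rewrite <- Hdh. rewrite Rmult_comm. apply Rmult_le_compat_r; lra.
  - assert (HA : sq_annulus_int G (del / h) b = powerRZ h (- (d + 2)) * sq_annulus_int cutg del B).
    { rewrite <- (sq_annulus_cutg (h * b)) by (rewrite Rmult_comm; auto).
      rewrite <- Hdh at 2. rewrite (Rmult_comm _ h).
      rewrite (sq_annulus_scale (h * b + 1) cutg (acont_cutg _) h (del / h) b); auto; try lra.
      2: { now apply Rdiv_lt_0_compat. }
      rewrite (sq_annulus_ext G (fun x y => / powerRZ h d * cutg (h * x) (h * y))); auto.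
      - rewrite (sq_annulus_scal (b + 1)); try lra.
        + rewrite powerRZ_neg', PD. field. split; auto; lra.
        + intros x y [h1 h2]. intros e.
          destruct (acont_cutg (h * (b + 1)) (h * x) (h * y)) with (eps := e) as [dd Hdd].
          { split; rewrite nrm_mult, Rabs_pos_eq by lra; [now apply Rmult_lt_0_compat|].
            now apply Rmult_lt_compat_l. }
          exists (mkposreal (dd / h) ltac:(apply Rdiv_lt_0_compat; auto; apply cond_pos)). simpl.
          intros u v Hu Hv. apply Hdd; rewrite <- Rmult_minus_distr_l, Rabs_mult, (Rabs_pos_eq h) by lra;
            rewrite Rmult_comm; now apply Rlt_div_r.
        + now apply Rdiv_lt_0_compat.
      - now apply Rdiv_lt_0_compat.
      - intros x y h1 h2. apply EG. assert (0 < del / h) by now apply Rdiv_lt_0_compat. lra. }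
    rewrite HA. unfold fpv. rewrite powerRZ_div, powerRZ_neg' by lra. field.
    apply powerRZ_NOR. lra.
Qed.

(** The error [E h] of the overview. The number of cells is a choice: every grid that covers the
    support gives the same sum. The factor 2 lets the same number of cells serve for [h / 2] and for
    [cutg_diff]. *)
Definition errg (h : R) : R := trap_sum cutg (up (2 * B / h)) h - fpv.

Lemma up_grid h : 0 < h -> (0 <= up (2 * B / h))%Z /\ 2 * B < IZR (up (2 * B / h)) * h <= 2 * B + h.
Proof.
  intros Hh. destruct (archimed (2 * B / h)) as [h1 h2].
  assert (P : 0 <= 2 * B / h) by (apply Rdiv_le_0_compat; lra).
  split; [apply le_IZR; lra|]. split; [apply Rlt_div_l; lra|].
  assert (E : IZR (up (2 * B / h)) <= 2 * B / h + 1) by lra.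
  apply (Rmult_le_compat_r h) in E; [|lra]. replace ((2 * B / h + 1) * h) with (2 * B + h) in E by (field; lra).
  exact E.
Qed.

Lemma trap_sum_errg N h : 0 < h -> (0 <= N)%Z -> B <= IZR N * h -> trap_sum cutg N h - fpv = errg h.
Proof.
  intros Hh HN Hb. unfold errg. f_equal. destruct (up_grid h Hh) as [u1 u2].
  apply (trap_sum_indep cutg B); auto; try lra. apply cutg_eq0.
Qed.

(** * Comparison of the steps [h] and [h / 2] *)

Definition cutg_diff (x y : R) : R := g x y * (eta x y - eta (x / 2) (y / 2)).

Lemma nrm_half x y : nrm (x / 2) (y / 2) = nrm x y / 2.
Proof.
  unfold Rdiv. rewrite (Rmult_comm x), (Rmult_comm y), nrm_mult, Rabs_pos_eq by lra. ring.
Qed.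

Lemma Smooth_half f : Smooth f -> Smooth (fun x y => f (x / 2) (y / 2)).
Proof.
  intros H n. revert f H. induction n as [|n IH]; intros f H.
  - split; [|split; [contradiction|exact Logic.I]]. intros x y _ e.
    destruct (Smooth_continuity f H (x / 2) (y / 2) e) as [dd Hdd]. exists dd.
    intros u v Hu Hv. apply Hdd.
    + replace (u / 2 - x / 2) with (/ 2 * (u - x)) by field.
      rewrite Rabs_mult, Rabs_pos_eq by lra. generalize (Rabs_pos (u - x)). lra.
    + replace (v / 2 - y / 2) with (/ 2 * (v - y)) by field.
      rewrite Rabs_mult, Rabs_pos_eq by lra. generalize (Rabs_pos (v - y)). lra.
  - assert (D : forall x y,
       is_derive (fun t => f (t / 2) (y / 2)) x (/ 2 * dx f (x / 2) (y / 2)) /\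
       is_derive (fun t => f (x / 2) (t / 2)) y (/ 2 * dy f (x / 2) (y / 2))).
    { intros x y. destruct (Smooth_is_derive f H (x / 2) (y / 2)) as [D1 D2]. split.
      - apply (is_derive_comp (fun t => f t (y / 2)) (fun t => t / 2)); [exact D1|].
        auto_derive; auto. field.
      - apply (is_derive_comp (fun t => f (x / 2) t) (fun t => t / 2)); [exact D2|].
        auto_derive; auto. field. }
    apply Cn_intro.
    + intros x y _. exact (Cn_continuity n _ _ x y (IH f H) Logic.I).
    + intros x y _. destruct (D x y) as [D1 D2]. split; eexists; [exact D1|exact D2].
    + apply (Cn_ext _ open2_True n (fun x y => / 2 * dx f (x / 2) (y / 2))).
      * intros x y _. symmetry. apply is_derive_unique. apply D.
      * apply Cn_scal; [apply open2_True|]. apply IH. now apply Smooth_dx.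
    + apply (Cn_ext _ open2_True n (fun x y => / 2 * dy f (x / 2) (y / 2))).
      * intros x y _. symmetry. apply is_derive_unique. apply D.
      * apply Cn_scal; [apply open2_True|]. apply IH. now apply Smooth_dy.
Qed.

(* [eta x y - eta (x / 2) (y / 2)] vanishes near the origin, where [g] is singular. *)
Lemma Smooth_cutg_diff : Smooth cutg_diff.
Proof.
  intros n.
  assert (A : Cn n (fun x y => 0 < nrm x y) cutg_diff).
  { apply Cn_mult; [apply open2_nrm_gt|apply gsmooth|].
    apply (Cn_mono (fun _ _ => True)); auto. apply Cn_minus; [apply open2_True|apply etasmooth|].
    now apply Smooth_half. }
  assert (Z : Cn n (fun x y => nrm x y < del) cutg_diff).
  { apply (Cn_ext _ (open2_nrm_lt del) n (fun _ _ => 0)).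
    - intros x y h. generalize (nrm_ge0 x y); intros. unfold cutg_diff.
      rewrite !eta1; [ring|rewrite nrm_half|]; lra.
    - apply Cn_const, open2_nrm_lt. }
  eapply Cn_mono; [|apply (Cn_union n _ _ _ A Z)].
  intros x y _. simpl. generalize (nrm_ge0 x y). destruct (Rlt_dec (nrm x y) del); [auto|left; lra].
Qed.

Lemma cutg_diff_eq0 x y : 2 * B <= nrm x y -> cutg_diff x y = 0.
Proof.
  intros h. unfold cutg_diff. rewrite !eta0; [ring|rewrite nrm_half|]; lra.
Qed.

(** Dilating the cutoff by 2 multiplies the finite part by [2^D]. As [cutg_diff] is smooth, its
    ordinary integral is a finite part too, and uniqueness identifies it with the difference of the
    two. *)
Lemma cutg_diff_integral b : (d + 2 <> 0)%Z -> 2 * B <= b ->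
  iint cutg_diff (- b) b (- b) b = fpv - powerRZ 2 (d + 2) * fpv.
Proof.
  intros HD Hb.
  set (G2 := fun x y => g x y * eta (x * / 2) (y * / 2)).
  assert (F2 : fp_square_int G2 b (powerRZ (/ 2) (- (d + 2)) * fpv)).
  { apply fp_cutg_scaled; auto; lra. }
  assert (F1 : fp_square_int cutg b fpv) by (apply fp_cutg; auto; lra).
  assert (C2 : acont (b + 1) G2).
  { intros x y h. apply continuity_2d_pt_mult; [now apply (acont_g (b + 1))|].
    apply (Smooth_continuity _ (Smooth_half _ etasmooth)). }
  assert (F3 : fp_square_int (fun x y => cutg x y + (-1) * G2 x y) b
                 (fpv + (-1) * (powerRZ (/ 2) (- (d + 2)) * fpv))).
  { apply (fp_plus (b + 1)); auto using acont_cutg, acont_scal; try lra.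
    apply (fp_scal (b + 1)); auto; lra. }
  assert (F4 : fp_square_int cutg_diff b (iint cutg_diff (- b) b (- b) b)).
  { apply fp_continuous; [lra|]. intros x y _ _. apply Smooth_continuity, Smooth_cutg_diff. }
  assert (F5 : fp_square_int cutg_diff b (fpv + (-1) * (powerRZ (/ 2) (- (d + 2)) * fpv))).
  { apply (fp_ext (fun x y => cutg x y + (-1) * G2 x y)); [lra| |exact F3].
    intros x y _. unfold cutg, G2, cutg_diff, Rdiv. ring. }
  rewrite (fp_unique _ _ _ _ F4 F5), powerRZ_inv', powerRZ_neg', Rinv_inv. ring.
Qed.

(* By homogeneity the combination is the quadrature error of the smooth function [cutg_diff]. *)
Lemma errg_step M : (0 < M)%nat -> (d + 2 <> 0)%Z -> exists C, 0 <= C /\ forall h, 0 < h <= 1 ->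
  Rabs (errg h - powerRZ 2 (d + 2) * errg (h / 2)) <= C * h ^ M.
Proof.
  intros HM HD.
  assert (CM : Cn M (fun x y => nrm x y < 2 * B + 2) cutg_diff).
  { apply (Cn_mono (fun _ _ => True)); auto. apply Smooth_cutg_diff. }
  destruct (dxn_dyn_bound M cutg_diff (2 * B + 1) (2 * B + 2)) as [Bd [Bd0 HBd]]; auto; try lra.
  exists (2 ^ S M * (2 * (2 * B + 1)) ^ 2 * Bd). split.
  { repeat apply Rmult_le_pos; try lra; apply pow_le; lra. }
  intros h Hh. destruct (up_grid h ltac:(lra)) as [u1 u2].
  set (N := up (2 * B / h)) in *.
  rewrite <- (trap_sum_errg N h), <- (trap_sum_errg N (h / 2)) by (auto; lra).
  set (A := IZR N * h) in *.
  assert (E1 : trap_sum cutg N h - powerRZ 2 (d + 2) * trap_sum cutg N (h / 2) = grid_sum cutg_diff N h).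
  { rewrite <- trap_sum_grid_sum.
    - unfold trap_sum. unfold Rminus.
      replace (- (powerRZ 2 (d + 2) * zsum (- N) (N - 1) (fun i => zsum (- N) (N - 1) (fun j =>
         if (Z.eqb i 0 && Z.eqb j 0)%bool then 0 else
           cutg (IZR i * (h / 2)) (IZR j * (h / 2)) * (h / 2) ^ 2))))
        with ((- powerRZ 2 (d + 2)) * zsum (- N) (N - 1) (fun i => zsum (- N) (N - 1) (fun j =>
         if (Z.eqb i 0 && Z.eqb j 0)%bool then 0 else
           cutg (IZR i * (h / 2)) (IZR j * (h / 2)) * (h / 2) ^ 2))) by ring.
      rewrite <- zsum_scal, <- zsum_plus. apply zsum_ext. intros i _.
      rewrite <- zsum_scal, <- zsum_plus. apply zsum_ext. intros j _.
      destruct (Z.eqb_spec i 0) as [Ei|Ei]; destruct (Z.eqb_spec j 0) as [Ej|Ej]; simpl andb; cbv iota;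
        try ring;
      (assert (P : 0 < nrm (IZR i * (h / 2)) (IZR j * (h / 2)));
       [apply nrm_pos; intros E; injection E; intros E1 E2;
         apply Rmult_integral in E1, E2; destruct E1 as [E1|]; destruct E2 as [E2|]; try lra;
         apply eq_IZR in E1; apply eq_IZR in E2; lia|];
       unfold cutg, cutg_diff;
       replace (IZR i * h / 2) with (IZR i * (h / 2)) by field;
       replace (IZR j * h / 2) with (IZR j * (h / 2)) by field;
       generalize (ghom 2 _ _ ltac:(lra) P);
       replace (2 * (IZR i * (h / 2))) with (IZR i * h) by field;
       replace (2 * (IZR j * (h / 2))) with (IZR j * h) by field;
       intros ->; rewrite powerRZ_add_2 by lra; field).
    - unfold cutg_diff. rewrite !eta1; [ring| |]; [replace (0 / 2) with 0 by field|]; rewrite nrm_00; lra. }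
  assert (E2 : iint cutg_diff (- A) A (- A) A = fpv - powerRZ 2 (d + 2) * fpv).
  { apply cutg_diff_integral; auto. lra. }
  replace (trap_sum cutg N h - fpv - powerRZ 2 (d + 2) * (trap_sum cutg N (h / 2) - fpv)) with
    ((trap_sum cutg N h - powerRZ 2 (d + 2) * trap_sum cutg N (h / 2)) -
     (fpv - powerRZ 2 (d + 2) * fpv)) by ring.
  rewrite E1, <- E2.
  assert (EN : IZR N = INR (Z.to_nat N)) by (rewrite INR_IZR_INZ, Z2Nat.id; auto).
  unfold A in *. rewrite EN in *. replace N with (Z.of_nat (Z.to_nat N)) at 1 by (apply Z2Nat.id; auto).
  eapply Rle_trans.
  - apply (trapezoidal_error_2d M cutg_diff (Z.to_nat N) h (2 * B + 2) Bd); auto; try lra.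
    + apply (matching_of_support _ (2 * B)); [lra|]. intros x y hn. apply cutg_diff_eq0; lra.
    + intros x y hn. apply HBd. lra.
  - apply Rmult_le_compat_r; [apply pow_le; lra|]. apply Rmult_le_compat_r; [lra|].
    apply Rmult_le_compat_l; [apply pow_le; lra|]. apply pow_incr. lra.
Qed.

(** With [q = 2^D], passing from [h / 2^n] to the next half costs [C h^M (q / 2^M)^n]. As [D < M],
    the ratio is at most 1/2 and the geometric series sums to at most 2, whatever the sign of
    [D]. *)
Lemma errg_telescope M : (0 < M)%nat -> (d + 2 < Z.of_nat M)%Z -> (d + 2 <> 0)%Z ->
  exists C, 0 <= C /\ forall h n, 0 < h <= 1 ->
  Rabs (errg h - powerRZ 2 (d + 2) ^ n * errg (h / 2 ^ n)) <= C * h ^ M.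
Proof.
  intros HM HMD HD. destruct (errg_step M HM HD) as [C [C0 HC]].
  exists (2 * C). split; [lra|].
  set (q := powerRZ 2 (d + 2)). assert (q0 : 0 < q) by (apply powerRZ_lt; lra).
  assert (Hq : q / 2 ^ M <= 1 / 2).
  { set (m := Z.to_nat (Z.of_nat M - (d + 2) - 1)).
    rewrite pow_powerRZ. replace (Z.of_nat M) with (d + 2 + Z.of_nat (S m))%Z by (unfold m; lia).
    rewrite powerRZ_add, <- pow_powerRZ by lra. fold q. simpl pow.
    assert (1 <= 2 ^ m) by (apply pow_R1_Rle; lra).
    assert (q <= q * 2 ^ m) by nra.
    apply Rle_div_l; [apply Rmult_lt_0_compat; lra|]. lra. }
  assert (S : forall h n, 0 < h <= 1 ->
    Rabs (errg h - q ^ n * errg (h / 2 ^ n)) <= C * h ^ M * (2 * (1 - (1 / 2) ^ n))).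
  { intros h n Hh. induction n as [|n IH].
    - simpl. replace (h / 1) with h by field. rewrite Rmult_1_l, Rminus_eq_0, Rabs_R0. lra.
    - replace (errg h - q ^ S n * errg (h / 2 ^ S n)) with
        ((errg h - q ^ n * errg (h / 2 ^ n)) + q ^ n * (errg (h / 2 ^ n) - q * errg (h / 2 ^ n / 2))).
      2: { simpl. replace (h / (2 * 2 ^ n)) with (h / 2 ^ n / 2) by (field; apply pow_nonzero; lra). ring. }
      eapply Rle_trans; [apply Rabs_triang|].
      assert (P : 1 <= 2 ^ n) by (apply pow_R1_Rle; lra).
      assert (Q : 0 < h / 2 ^ n <= 1).
      { split; [apply Rdiv_lt_0_compat; lra|apply Rle_div_l; lra]. }
      generalize (HC (h / 2 ^ n) Q). fold q. intros H1.
      rewrite Rabs_mult, (Rabs_pos_eq (q ^ n)) by (apply pow_le; lra).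
      assert (H2 : q ^ n * Rabs (errg (h / 2 ^ n) - q * errg (h / 2 ^ n / 2)) <= C * h ^ M * (1 / 2) ^ n).
      { apply Rle_trans with (q ^ n * (C * (h / 2 ^ n) ^ M)).
        - apply Rmult_le_compat_l; auto. apply pow_le; lra.
        - apply Rle_trans with (C * h ^ M * (q / 2 ^ M) ^ n).
          + right. unfold Rdiv. rewrite !Rpow_mult_distr, !pow_inv, <- !pow_mult, (Nat.mul_comm n M). ring.
          + apply Rmult_le_compat_l; [apply Rmult_le_pos; auto; apply pow_le; lra|].
            apply pow_incr. split; auto. left. apply Rdiv_lt_0_compat; auto. apply pow_lt; lra. }
      simpl. lra. }
  intros h n Hh. eapply Rle_trans; [now apply S|].
  assert (0 <= (1 / 2) ^ n) by (apply pow_le; lra).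
  assert (0 <= C * h ^ M) by (apply Rmult_le_pos; auto; apply pow_le; lra). nra.
Qed.

(** Let [n] tend to infinity in the telescoped bound: [2^(D n) E(h / 2^n)] is [h^D] times
    [(h / 2^n)^(- D) E(h / 2^n)], which tends to [h^D L]. A bare limit along dyadic steps thus
    acquires a rate of order [M]. *)
Lemma errg_limit M (L : R) : (0 < M)%nat -> (d + 2 < Z.of_nat M)%Z -> (d + 2 <> 0)%Z ->
  (forall h, 0 < h -> is_lim_seq (fun n => powerRZ (h / 2 ^ n) (- (d + 2)) * errg (h / 2 ^ n)) L) ->
  exists C, forall h, 0 < h <= 1 -> Rabs (errg h - powerRZ h (d + 2) * L) <= C * h ^ M.
Proof.
  intros HM HMD HD HL. destruct (errg_telescope M HM HMD HD) as [C [C0 HC]].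
  exists C. intros h Hh.
  assert (HL' : is_lim_seq (fun n => Rabs (errg h - powerRZ 2 (d + 2) ^ n * errg (h / 2 ^ n)))
     (Rabs (errg h - powerRZ h (d + 2) * L))).
  { apply (is_lim_seq_abs _ (Finite _)). apply is_lim_seq_minus'; [apply is_lim_seq_const|].
    apply (is_lim_seq_ext (fun n => powerRZ h (d + 2) * (powerRZ (h / 2 ^ n) (- (d + 2)) * errg (h / 2 ^ n)))).
    - intros n. assert (P : 0 < 2 ^ n) by (apply pow_lt; lra).
      rewrite powerRZ_neg', powerRZ_div by lra.
      assert (E : powerRZ (2 ^ n) (d + 2) = powerRZ 2 (d + 2) ^ n).
      { clear. induction n as [|n IH]; [apply powerRZ_R1|].
        simpl. rewrite powerRZ_mult, IH. reflexivity. }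
      rewrite E. field. split; [apply pow_nonzero|]; apply powerRZ_NOR; lra.
    - apply (is_lim_seq_scal_l _ _ (Finite L)). apply HL; lra. }
  apply (is_lim_seq_le _ (fun _ => C * h ^ M) (Finite _) (Finite _)) with (3 := is_lim_seq_const _) in HL'.
  - exact HL'.
  - intros n. now apply HC.
Qed.

Lemma dyadic_scale h : 0 < h <= 1 -> exists n, 1 / 2 < 2 ^ n * h <= 1.
Proof.
  intros Hh.
  assert (K : forall k h, h <= 1 -> 1 / 2 ^ k < h -> exists n, 1 / 2 < 2 ^ n * h <= 1).
  { induction k as [|k IH]; intros z Hz Hk.
    - simpl in Hk. lra.
    - destruct (Rlt_dec (1 / 2) z) as [h1|h1]; [exists 0%nat; simpl; lra|].
      destruct (IH (2 * z)) as [n Hn].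
      + lra.
      + simpl in Hk. apply Rlt_div_l; [apply pow_lt; lra|]. apply Rlt_div_l in Hk; [|apply Rmult_lt_0_compat; [lra|apply pow_lt; lra]].
        lra.
      + exists (S n). simpl. lra. }
  destruct (pow_lt_1_zero (1 / 2)) with (y := h) as [k Hk].
  - rewrite Rabs_pos_eq; lra.
  - lra.
  - apply (K k h); [lra|]. generalize (Hk k (Nat.le_refl k)). intros H1.
    apply Rabs_def2 in H1. unfold Rdiv in H1. rewrite Rmult_1_l, pow_inv in H1. lra.
Qed.

(** For [h] between 1/2 and 1 a fixed finite set of indices covers the support. Homogeneity pulls
    out [h^D], at most 1 as [D > 0], which leaves the values of [|g|] at integer points. *)
Lemma errg_bounded_away : (0 < d + 2)%Z -> exists K, 0 <= K /\ forall h, 1 / 2 < h <= 1 -> Rabs (errg h) <= K.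
Proof.
  intros HD. set (N := up (4 * B)).
  assert (HN : 4 * B < IZR N) by apply archimed.
  assert (N0 : (0 <= N)%Z) by (apply le_IZR; lra).
  exists (psum (fun i j => Rabs (g (IZR i) (IZR j))) N + Rabs fpv). split.
  { apply Rplus_le_le_0_compat; [|apply Rabs_pos].
    eapply Rle_trans; [apply Rabs_pos|]. apply (zsum_Rabs_le _ _ (fun _ => 0)). intros i _.
    rewrite Rabs_R0. eapply Rle_trans; [apply Rabs_pos|]. apply (zsum_Rabs_le _ _ (fun _ => 0)). intros j _.
    rewrite Rabs_R0. destruct (_ && _)%bool; [lra|apply Rabs_pos]. }
  intros h Hh. rewrite <- (trap_sum_errg N h); auto; try lra.
  2: { nra. }
  unfold Rminus. eapply Rle_trans; [apply Rabs_triang|]. rewrite Rabs_Ropp. apply Rplus_le_compat_r.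
  rewrite (trap_sum_psum cutg B N N h); try lia; try lra; try nra.
  2: { exact cutg_eq0. }
  apply zsum_Rabs_le. intros i _. apply zsum_Rabs_le. intros j _.
  destruct (Z.eqb_spec i 0) as [Ei|Ei]; destruct (Z.eqb_spec j 0) as [Ej|Ej]; simpl andb; cbv iota;
    try (rewrite Rabs_R0; lra);
  (assert (P : 0 < nrm (IZR i) (IZR j));
   [apply nrm_pos; intros E; injection E; intros E1 E2; apply eq_IZR in E1; apply eq_IZR in E2; lia|];
   unfold cutg; rewrite (Rmult_comm (IZR i)), (Rmult_comm (IZR j)), ghom by lra;
   rewrite !Rabs_mult, (Rabs_pos_eq (powerRZ h d)), (Rabs_pos_eq (h ^ 2)), (Rabs_pos_eq (eta _ _));
   [| apply eta01 | apply pow2_ge_0 | apply powerRZ_le; lra];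
   replace (powerRZ h d * Rabs (g (IZR i) (IZR j)) * eta (h * IZR i) (h * IZR j) * h ^ 2) with
     (Rabs (g (IZR i) (IZR j)) * (eta (h * IZR i) (h * IZR j) * (h ^ 2 * powerRZ h d))) by ring;
   rewrite <- powerRZ_add_2 by lra;
   rewrite <- (Rmult_1_r (Rabs (g (IZR i) (IZR j)))) at 2;
   apply Rmult_le_compat_l; [apply Rabs_pos|];
   assert (Q : 0 <= powerRZ h (d + 2) <= 1);
   [split; [apply powerRZ_le; lra|]; rewrite <- (Z2Nat.id (d + 2)) by lia; rewrite <- pow_powerRZ;
    rewrite <- (pow1 (Z.to_nat (d + 2))); apply pow_incr; lra|];
   generalize (eta01 (h * IZR i) (h * IZR j)); nra).
Qed.

(** No limit of [h^(- D) E h] is available for these exponents. Instead the telescoped bound is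
    started at the dyadic multiple [h0] of [h] between 1/2 and 1, where [E] is bounded, and read as
    a bound on [2^(D n) E h]. *)
Lemma errg_small k : (0 < Z.of_nat k)%Z -> (Z.of_nat k <= d + 2)%Z ->
  exists C, forall h, 0 < h <= 1 -> Rabs (errg h) <= C * h ^ k.
Proof.
  intros Hk HD. destruct (errg_bounded_away ltac:(lia)) as [K [K0 HK]].
  set (M := Z.to_nat (d + 3)).
  destruct (errg_telescope M) as [C [C0 HC]]; [unfold M; lia|unfold M; lia|lia|].
  set (D := Z.to_nat (d + 2)). assert (ED : (d + 2)%Z = Z.of_nat D) by (unfold D; lia).
  exists (2 ^ D * (K + C)). intros h Hh.
  destruct (dyadic_scale h Hh) as [n Hn]. set (h0 := 2 ^ n * h) in *.
  assert (P : 0 < 2 ^ n) by (apply pow_lt; lra).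
  generalize (HC h0 n ltac:(lra)) (HK h0 Hn). intros H1 H2.
  replace (h0 / 2 ^ n) with h in H1 by (unfold h0; field; lra).
  rewrite ED, <- pow_powerRZ in H1.
  assert (H3 : C * h0 ^ M <= C).
  { rewrite <- (Rmult_1_r C) at 2. apply Rmult_le_compat_l; auto.
    rewrite <- (pow1 M). apply pow_incr. lra. }
  assert (H4 : (2 ^ D) ^ n * Rabs (errg h) <= K + C).
  { rewrite <- (Rabs_pos_eq ((2 ^ D) ^ n)) by (apply pow_le, pow_le; lra). rewrite <- Rabs_mult.
    replace ((2 ^ D) ^ n * errg h) with (errg h0 + - (errg h0 - (2 ^ D) ^ n * errg h)) by ring.
    eapply Rle_trans; [apply Rabs_triang|]. rewrite Rabs_Ropp. lra. }
  (* Since [h0 = 2^n h] exceeds 1/2, the factor [2^(D n)] is at least [h^(- D)] up to the constant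
     [2^D]. *)
  assert (H5 : 1 <= 2 ^ D * h ^ D * (2 ^ D) ^ n).
  { replace (2 ^ D * h ^ D * (2 ^ D) ^ n) with ((2 * h0) ^ D).
    - apply pow_R1_Rle. lra.
    - unfold h0. rewrite !Rpow_mult_distr, <- !pow_mult, (Nat.mul_comm n D). ring. }
  assert (H6 : h ^ D <= h ^ k).
  { replace D with (k + (D - k))%nat by (unfold D; lia). rewrite pow_add.
    rewrite <- (Rmult_1_r (h ^ k)) at 2. apply Rmult_le_compat_l; [apply pow_le; lra|].
    rewrite <- (pow1 (D - k)). apply pow_incr. lra. }
  assert (0 < h ^ D) by (apply pow_lt; lra). assert (0 < 2 ^ D) by (apply pow_lt; lra).
  assert (0 < (2 ^ D) ^ n) by (apply pow_lt; lra).
  apply Rle_trans with (2 ^ D * h ^ D * (2 ^ D) ^ n * Rabs (errg h)).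
  { rewrite <- (Rmult_1_l (Rabs (errg h))) at 1. apply Rmult_le_compat_r; auto using Rabs_pos. }
  rewrite Rmult_assoc. apply Rle_trans with (2 ^ D * h ^ D * (K + C)).
  { apply Rmult_le_compat_l; auto. apply Rmult_le_pos; lra. }
  replace (2 ^ D * (K + C) * h ^ k) with (2 ^ D * h ^ k * (K + C)) by ring.
  apply Rmult_le_compat_r; [lra|]. apply Rmult_le_compat_l; lra.
Qed.

(** Once the square covers the support of the dilated cutoff, the expression under the inner limit
    no longer depends on [N]: uniqueness of finite parts determines [I N h], homogeneity rescales
    the sum, and the value is [h^(- D) E h]. The outer limit is then taken along [h / 2^n]. *)
Lemma errg_wigner Q s f (L : R) : cutoff eta -> (d + 2 <> 0)%Z ->
  (forall x y, f x y / Rpower (Q x y) (s / 2) = g x y) -> is_wigner Q s f L ->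
  forall h, 0 < h -> is_lim_seq (fun n => powerRZ (h / 2 ^ n) (- (d + 2)) * errg (h / 2 ^ n)) L.
Proof.
  intros Hc HD Hg HW. destruct (HW eta Hc) as (I & HI & delta & inner & Hdelta & Hinner & Hlim).
  assert (Inner : forall h, 0 < h < delta -> inner h = powerRZ h (- (d + 2)) * errg h).
  { intros h Hh.
    assert (Hl := Hinner h ltac:(rewrite Rabs_pos_eq; lra)).
    assert (Hl' : is_lim_seq (fun _ => powerRZ h (- (d + 2)) * errg h) (inner h)).
    { destruct (up_grid h ltac:(lra)) as [u1 u2].
      apply (is_lim_seq_ext_loc (fun N => wigner_sum Q s f eta h (Z.of_nat N) - I N h)); [|exact Hl].
      exists (Z.to_nat (up (2 * B / h))). intros N HN.
      assert (HN' : 2 * B < INR N * h).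
      { eapply Rlt_le_trans; [apply u2|]. apply Rmult_le_compat_r; [lra|].
        rewrite INR_IZR_INZ. apply IZR_le. lia. }
      assert (EI : I N h = powerRZ h (- (d + 2)) * fpv).
      { apply (fp_unique (fun x y => f x y / Rpower (Q x y) (s / 2) * eta (x * h) (y * h)) (INR N + / 2)).
        - apply HI. lra.
        - apply (fp_ext (fun x y => g x y * eta (x * h) (y * h))).
          + generalize (pos_INR N); lra.
          + intros x y _. rewrite Hg. reflexivity.
          + apply fp_cutg_scaled; auto; try lra. }
      assert (ES : wigner_sum Q s f eta h (Z.of_nat N) = powerRZ h (- (d + 2)) * trap_sum cutg (Z.of_nat N) h).
      { rewrite (trap_sum_psum cutg B (Z.of_nat N) (Z.of_nat N) h); try lia; try lra.
        2: { rewrite <- INR_IZR_INZ. lra. }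
        2: { exact cutg_eq0. }
        rewrite <- psum_scal. apply psum_ext. intros i j Hij.
        assert (P : 0 < nrm (IZR i) (IZR j)).
        { apply nrm_pos. intros E; injection E; intros E1 E2; apply eq_IZR in E1; apply eq_IZR in E2; lia. }
        rewrite Hg. unfold cutg. rewrite (Rmult_comm (IZR i) h), (Rmult_comm (IZR j) h), ghom by lra.
        rewrite powerRZ_neg', powerRZ_add_2 by lra. field. split; [apply powerRZ_NOR|]; lra. }
      rewrite EI, ES, <- (trap_sum_errg (Z.of_nat N) h); try lra; try lia.
      rewrite <- INR_IZR_INZ. lra. }
    apply is_lim_seq_unique in Hl'. rewrite Lim_seq_const in Hl'. injection Hl'. auto. }
  intros h Hh.
  assert (H2 : is_lim_seq (fun n => h / 2 ^ n) 0).
  { replace (Finite 0) with (Rbar_mult h 0) by (simpl; f_equal; ring).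
    apply (is_lim_seq_ext (fun n => h * (1 / 2) ^ n)).
    - intros n. unfold Rdiv. now rewrite Rmult_1_l, pow_inv.
    - apply is_lim_seq_scal_l. apply is_lim_seq_geom. rewrite Rabs_pos_eq; lra. }
  apply (is_lim_seq_ext_loc (fun n => inner (h / 2 ^ n))).
  - apply is_lim_seq_spec in H2. destruct (H2 (mkposreal delta Hdelta)) as [N HN]. exists N.
    intros n Hn. apply Inner. generalize (HN n Hn). simpl. rewrite Rminus_0_r.
    assert (0 < h / 2 ^ n) by (apply Rdiv_lt_0_compat; auto; apply pow_lt; lra).
    rewrite Rabs_pos_eq; lra.
  - apply (is_lim_comp_seq inner _ 0 L); auto. exists 0%nat. intros n _ E. injection E. intros E'.
    assert (0 < h / 2 ^ n) by (apply Rdiv_lt_0_compat; auto; apply pow_lt; lra). lra.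
Qed.

End CutHomogeneous.

(** * The surface near the origin *)

Lemma Qform_homogeneous rx ry rz t x y :
  Qform rx ry rz (t * x) (t * y) = t ^ 2 * Qform rx ry rz x y.
Proof. unfold Qform. ring. Qed.

(** Linear independence gives [E G - F^2 > 0] through [|G rho_u - F rho_v|^2 = G (E G - F^2)].
    Completing the square in each variable bounds [Q E] and [Q G] from below by [E G - F^2] times
    [v^2] and [u^2], whence [lo]. *)
Lemma Qform_equivalent rx ry rz :
  (forall al be : R,
     al * du rx + be * dv rx = 0 -> al * du ry + be * dv ry = 0 ->
     al * du rz + be * dv rz = 0 -> al = 0 /\ be = 0) ->
  exists lo hi, 0 < lo /\ forall x y,
    lo * nrm x y ^ 2 <= Qform rx ry rz x y <= hi * nrm x y ^ 2.
Proof.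
  intros Hind. unfold Qform.
  set (E := du rx * du rx + du ry * du ry + du rz * du rz).
  set (F := du rx * dv rx + du ry * dv ry + du rz * dv rz).
  set (G := dv rx * dv rx + dv ry * dv ry + dv rz * dv rz).
  assert (SOS : forall a b c, a * a + b * b + c * c = 0 -> a = 0 /\ b = 0 /\ c = 0).
  { intros a b c H. repeat split; nra. }
  assert (HE : 0 < E).
  { assert (0 <= E) by (unfold E; nra). destruct (Req_dec E 0) as [h|]; [exfalso|lra].
    apply SOS in h. destruct h as (h1 & h2 & h3).
    destruct (Hind 1 0) as [h _]; [rewrite h1|rewrite h2|rewrite h3|]; lra. }
  assert (HG : 0 < G).
  { assert (0 <= G) by (unfold G; nra). destruct (Req_dec G 0) as [h|]; [exfalso|lra].
    apply SOS in h. destruct h as (h1 & h2 & h3).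
    destruct (Hind 0 1) as [_ h]; [rewrite h1|rewrite h2|rewrite h3|]; lra. }
  assert (HD : 0 < E * G - F * F).
  { set (v1 := G * du rx + - F * dv rx). set (v2 := G * du ry + - F * dv ry).
    set (v3 := G * du rz + - F * dv rz).
    assert (I : v1 * v1 + v2 * v2 + v3 * v3 = G * (E * G - F * F)) by (unfold v1, v2, v3, E, F, G; ring).
    assert (0 <= v1 * v1 + v2 * v2 + v3 * v3) by nra.
    destruct (Rlt_dec 0 (E * G - F * F)) as [|n]; [assumption|exfalso].
    assert (Z : v1 * v1 + v2 * v2 + v3 * v3 = 0) by nra.
    apply SOS in Z. destruct Z as (h1 & h2 & h3).
    destruct (Hind G (- F) h1 h2 h3) as [h _]. lra. }
  set (D := E * G - F * F) in *.
  exists (D / (E + G)), (E + 2 * Rabs F + G). split; [apply Rdiv_lt_0_compat; lra|].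
  intros x y.
  assert (Nx : x ^ 2 <= nrm x y ^ 2).
  { rewrite <- (pow2_abs x). apply pow_incr. split; [apply Rabs_pos|apply Rabs_le_nrm_l]. }
  assert (Ny : y ^ 2 <= nrm x y ^ 2).
  { rewrite <- (pow2_abs y). apply pow_incr. split; [apply Rabs_pos|apply Rabs_le_nrm_r]. }
  assert (N0 : 0 <= nrm x y ^ 2) by apply pow2_ge_0.
  split.
  - unfold Rdiv. rewrite Rmult_assoc, (Rmult_comm (/ (E + G))), <- Rmult_assoc.
    apply Rle_div_l; [lra|].
    assert (A1 : D * y ^ 2 <= (E * x ^ 2 + 2 * F * x * y + G * y ^ 2) * E).
    { replace ((E * x ^ 2 + 2 * F * x * y + G * y ^ 2) * E) with
        ((E * x + F * y) ^ 2 + D * y ^ 2) by (unfold D; ring). generalize (pow2_ge_0 (E * x + F * y)). lra. }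
    assert (A2 : D * x ^ 2 <= (E * x ^ 2 + 2 * F * x * y + G * y ^ 2) * G).
    { replace ((E * x ^ 2 + 2 * F * x * y + G * y ^ 2) * G) with
        ((G * y + F * x) ^ 2 + D * x ^ 2) by (unfold D; ring). generalize (pow2_ge_0 (G * y + F * x)). lra. }
    generalize (pow2_ge_0 x) (pow2_ge_0 y). intros. rewrite Rmult_plus_distr_l.
    assert (0 <= D * x ^ 2) by (apply Rmult_le_pos; lra).
    assert (0 <= D * y ^ 2) by (apply Rmult_le_pos; lra).
    unfold nrm, Rmax. destruct Rle_dec; rewrite pow2_abs; lra.
  - assert (XY : 2 * F * x * y <= 2 * Rabs F * nrm x y ^ 2).
    { apply Rle_trans with (Rabs (2 * F * x * y)); [apply Rle_abs|].
      rewrite !Rabs_mult, (Rabs_pos_eq 2), !Rmult_assoc by lra.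
      repeat (apply Rmult_le_compat_l; [lra || apply Rabs_pos|]).
      simpl. rewrite Rmult_1_r. apply Rmult_le_compat; auto using Rabs_pos, Rabs_le_nrm_l, Rabs_le_nrm_r. }
    assert (E * x ^ 2 <= E * nrm x y ^ 2) by (apply Rmult_le_compat_l; lra).
    assert (G * y ^ 2 <= G * nrm x y ^ 2) by (apply Rmult_le_compat_l; lra).
    rewrite !Rmult_plus_distr_r. lra.
Qed.

Lemma Smooth_Qform rx ry rz : Smooth (Qform rx ry rz).
Proof.
  intros n. unfold Qform. assert (O := open2_True).
  set (E := _ + _ + _). set (F := _ + _ + _). set (G := _ + _ + _).
  apply (Cn_ext _ O n (fun x y => E * (x ^ 2 * y ^ 0) + (2 * F) * (x ^ 1 * y ^ 1) + G * (x ^ 0 * y ^ 2))).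
  - intros x y _. ring.
  - repeat apply Cn_plus; auto; apply Cn_scal; auto; now apply Cn_monomial.
Qed.

Definition sqdist (rx ry rz : R -> R -> R) (x y : R) : R :=
  (rx x y - rx 0 0) ^ 2 + (ry x y - ry 0 0) ^ 2 + (rz x y - rz 0 0) ^ 2.

Lemma sqdist_ge0 rx ry rz x y : 0 <= sqdist rx ry rz x y.
Proof.
  unfold sqdist. generalize (pow2_ge_0 (rx x y - rx 0 0)) (pow2_ge_0 (ry x y - ry 0 0))
    (pow2_ge_0 (rz x y - rz 0 0)). lra.
Qed.

Lemma rdist_pow2 rx ry rz x y : rdist rx ry rz x y ^ 2 = sqdist rx ry rz x y.
Proof. apply pow2_sqrt, sqdist_ge0. Qed.

Lemma rdist_pow rx ry rz x y p : 0 < sqdist rx ry rz x y ->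
  rdist rx ry rz x y ^ p = Rpower (sqdist rx ry rz x y) (INR p / 2).
Proof.
  intros H. unfold rdist. fold (sqdist rx ry rz x y). rewrite <- Rpower_pow by now apply sqrt_lt_R0.
  rewrite <- Rpower_sqrt by auto. rewrite Rpower_mult. f_equal. field.
Qed.

Lemma sqdist_pos rx ry rz x y : (rx x y, ry x y, rz x y) <> (rx 0 0, ry 0 0, rz 0 0) ->
  0 < sqdist rx ry rz x y.
Proof.
  intros H. destruct (Rle_lt_or_eq_dec _ _ (sqdist_ge0 rx ry rz x y)) as [h|h]; auto.
  exfalso. apply H. unfold sqdist in h.
  generalize (pow2_ge_0 (rx x y - rx 0 0)) (pow2_ge_0 (ry x y - ry 0 0)) (pow2_ge_0 (rz x y - rz 0 0)).
  intros. assert (A : (rx x y - rx 0 0) ^ 2 = 0) by lra. assert (B : (ry x y - ry 0 0) ^ 2 = 0) by lra.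
  assert (C : (rz x y - rz 0 0) ^ 2 = 0) by lra.
  f_equal; [f_equal|]; apply Rminus_diag_uniq; nra.
Qed.

Lemma Smooth_sqdist rx ry rz : Smooth rx -> Smooth ry -> Smooth rz -> Smooth (sqdist rx ry rz).
Proof.
  intros Hx Hy Hz n. assert (O := open2_True). unfold sqdist.
  repeat apply Cn_plus; auto; apply (Cn_pow _ O n (fun x y => _ x y - _ 0 0)); apply Cn_minus; auto using Cn_const.
Qed.

(** With [t] the linear part and [w = O(|u|^2)] the remainder, the difference of squares is
    [2 t w + w^2]. Summed over the three components it shows [r^2 - Q = O(|u|^3)]. *)
Lemma component_cubic f : Smooth f -> exists C, 0 <= C /\ forall x y, nrm x y <= 1 ->
  Rabs ((f x y - f 0 0) ^ 2 - (x * du f + y * dv f) ^ 2) <= C * nrm x y ^ 3.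
Proof.
  intros H. destruct (Rem_bound 2 f H) as [C HC].
  set (L := Rabs (du f) + Rabs (dv f)).
  assert (HL : 0 <= L) by (unfold L; generalize (Rabs_pos (du f)) (Rabs_pos (dv f)); lra).
  exists (2 * L * Rabs C + Rabs C * Rabs C). generalize (Rabs_pos C); intros C0.
  split; [nra|]. intros x y h. generalize (nrm_ge0 x y); intros h0.
  assert (E : f x y - f 0 0 = (x * du f + y * dv f) + Rem 2 f x y).
  { unfold Rem. rewrite !rsum_S, rsum_0, T_S, !T_0. change (dx f 0 0) with (du f).
    change (dy f 0 0) with (dv f). simpl. field. }
  set (t := x * du f + y * dv f) in *. set (w := Rem 2 f x y) in *.
  assert (Ht : Rabs t <= L * nrm x y).
  { unfold t, L. eapply Rle_trans; [apply Rabs_triang|]. rewrite !Rabs_mult.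
    generalize (Rabs_le_nrm_l x y) (Rabs_le_nrm_r x y) (Rabs_pos (du f)) (Rabs_pos (dv f)). intros. nra. }
  assert (Hw : Rabs w <= Rabs C * nrm x y ^ 2).
  { eapply Rle_trans; [apply HC; auto|]. apply Rmult_le_compat_r; [apply pow2_ge_0|apply Rle_abs]. }
  rewrite E. replace ((t + w) ^ 2 - t ^ 2) with (2 * t * w + w * w) by ring.
  eapply Rle_trans; [apply Rabs_triang|]. rewrite !Rabs_mult, (Rabs_pos_eq 2) by lra.
  assert (A1 : 2 * Rabs t * Rabs w <= 2 * (L * nrm x y) * (Rabs C * nrm x y ^ 2)).
  { apply Rmult_le_compat; auto using Rabs_pos; [|lra]. apply Rmult_le_pos; [lra|apply Rabs_pos]. }
  assert (A2 : Rabs w * Rabs w <= (Rabs C * nrm x y ^ 2) * (Rabs C * nrm x y ^ 2)).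
  { apply Rmult_le_compat; auto using Rabs_pos. }
  assert (A3 : nrm x y ^ 2 * nrm x y ^ 2 <= nrm x y ^ 3).
  { replace (nrm x y ^ 2 * nrm x y ^ 2) with (nrm x y ^ 3 * nrm x y) by ring.
    rewrite <- (Rmult_1_r (nrm x y ^ 3)) at 2. apply Rmult_le_compat_l; auto. now apply pow_le. }
  assert (A4 : Rabs C * Rabs C * (nrm x y ^ 2 * nrm x y ^ 2) <= Rabs C * Rabs C * nrm x y ^ 3).
  { apply Rmult_le_compat_l; auto. nra. }
  replace ((2 * L * Rabs C + Rabs C * Rabs C) * nrm x y ^ 3) with
    (2 * (L * nrm x y) * (Rabs C * nrm x y ^ 2) + Rabs C * Rabs C * nrm x y ^ 3) by ring.
  lra.
Qed.

Lemma sqdist_Qform_cubic rx ry rz : Smooth rx -> Smooth ry -> Smooth rz ->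
  exists C, 0 <= C /\ forall x y, nrm x y <= 1 ->
  Rabs (sqdist rx ry rz x y - Qform rx ry rz x y) <= C * nrm x y ^ 3.
Proof.
  intros Hx Hy Hz. destruct (component_cubic rx Hx) as [C1 [P1 H1]].
  destruct (component_cubic ry Hy) as [C2 [P2 H2]]. destruct (component_cubic rz Hz) as [C3 [P3 H3]].
  exists (C1 + C2 + C3). split; [lra|]. intros x y h.
  generalize (H1 x y h) (H2 x y h) (H3 x y h). intros h1 h2 h3.
  replace (sqdist rx ry rz x y - Qform rx ry rz x y) with
    (((rx x y - rx 0 0) ^ 2 - (x * du rx + y * dv rx) ^ 2) +
     ((ry x y - ry 0 0) ^ 2 - (x * du ry + y * dv ry) ^ 2) +
     ((rz x y - rz 0 0) ^ 2 - (x * du rz + y * dv rz) ^ 2)) by (unfold sqdist, Qform; ring).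
  eapply Rle_trans; [apply Rabs_triang|]. eapply Rle_trans; [apply Rplus_le_compat_r, Rabs_triang|]. lra.
Qed.

(** * Quadrature errors as a linear functional *)

(** Existential in the finite part, so that sums of functions are handled through their error
    sequences alone; [a'] leaves room for continuity up to the boundary of the square. *)
Definition has_error (a a' : R) (G : R -> R -> R) (e : nat -> R) : Prop :=
  acont a' G /\ exists I, fp_square_int G a I /\
    forall N, (1 <= N)%nat -> trap_sum G (Z.of_nat N) (a / INR N) - I = e N.

Section QuadratureError.

Variables (a a' : R).
Hypothesis Ha : 0 < a.
Hypothesis Ha' : a < a'.

Lemma has_error_plus F G e f : has_error a a' F e -> has_error a a' G f ->
  has_error a a' (fun x y => F x y + G x y) (fun N => e N + f N).
Proof.
  intros (A1 & I & H1 & H2) (B1 & J & K1 & K2). split; [now apply acont_plus|].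
  exists (I + J). split; [now apply (fp_plus a')|]. intros N HN.
  rewrite trap_sum_plus, <- H2, <- K2 by auto. ring.
Qed.

Lemma has_error_scal c F e : has_error a a' F e -> has_error a a' (fun x y => c * F x y) (fun N => c * e N).
Proof.
  intros (A1 & I & H1 & H2). split; [now apply acont_scal|].
  exists (c * I). split; [now apply (fp_scal a')|]. intros N HN.
  rewrite trap_sum_scal, <- H2 by auto. ring.
Qed.

Lemma has_error_ext F G e : acont a' G -> (forall x y, 0 < nrm x y <= a -> F x y = G x y) ->
  has_error a a' F e -> has_error a a' G e.
Proof.
  intros HG E (A1 & I & H1 & H2). split; auto. exists I. split.
  - apply (fp_ext F); auto. intros x y h. apply E; lra.
  - intros N HN. rewrite <- H2 by auto. f_equal. symmetry.
    assert (0 < INR N) by (apply lt_0_INR; lia).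
    apply trap_sum_ext; [now apply Rdiv_lt_0_compat|]. intros x y h1 h2. apply E.
    rewrite <- INR_IZR_INZ in h2. replace (INR N * (a / INR N)) with a in h2 by (field; lra). lra.
Qed.

(** Reflection annihilates the integral, and also the sum, because the vanishing of [G] near the
    boundary makes the index range symmetric. *)
Lemma has_error_odd r G e B : B <= a -> a' <= r -> acont r G ->
  (forall x y, G (- x) (- y) = - G x y) -> (forall x y, B <= nrm x y -> G x y = 0) ->
  (forall N, e N = 0) -> has_error a a' G e.
Proof.
  intros HB Hr HG Ho H0 He. split; [now apply (acont_mono r)|]. exists 0. split.
  - apply (fp_odd r); auto. lra.
  - intros N HN. rewrite He. assert (0 < INR N) by (apply lt_0_INR; lia).
    rewrite (trap_sum_psum G B (Z.of_nat N) (Z.of_nat N)); auto; try lia.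
    + rewrite psum_odd; [ring|]. intros i j. rewrite !opp_IZR, !Ropp_mult_distr_l_reverse, Ho. ring.
    + now apply Rdiv_lt_0_compat.
    + rewrite <- INR_IZR_INZ. replace (INR N * (a / INR N)) with a by (field; lra). auto.
Qed.

Lemma has_error_rsum n (G : nat -> R -> R -> R) (e : nat -> nat -> R) :
  (forall i, (i < n)%nat -> has_error a a' (G i) (e i)) ->
  has_error a a' (fun x y => rsum n (fun i => G i x y)) (fun N => rsum n (fun i => e i N)).
Proof.
  induction n as [|n IH]; intros H.
  - split; [intros x y _; exact (continuity_2d_pt_const x y 0)|].
    exists 0. split.
    + apply (fp_odd (a + 1)); auto; try lra.
      * intros x y _. exact (continuity_2d_pt_const x y 0).
      * intros; rewrite !rsum_0; ring.
    + intros N HN. rewrite rsum_0, Rminus_0_r. apply zsum_eq0. intros i _. apply zsum_eq0. intros j _.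
      rewrite rsum_0. destruct (_ && _)%bool; ring.
  - generalize (has_error_plus _ _ _ _ (IH (fun i Hi => H i ltac:(lia))) (H n ltac:(lia))).
    intros (A1 & I & H1 & H2).
    assert (E : (fun x y => rsum (S n) (fun i => G i x y)) = (fun x y => rsum n (fun i => G i x y) + G n x y)).
    { apply functional_extensionality; intros x. apply functional_extensionality; intros y. apply rsum_S. }
    rewrite E. split; auto. exists I. split; auto. intros N HN. rewrite rsum_S. now apply H2.
Qed.

Variable P : nat.

Definition bigO (f : nat -> R) : Prop :=
  exists C N0, forall N, (N0 <= N)%nat -> (1 <= N)%nat -> Rabs (f N) <= C * (a / INR N) ^ P.

Lemma bigO_plus f g : bigO f -> bigO g -> bigO (fun N => f N + g N).
Proof.
  intros (C & N0 & H) (C' & N1 & H'). exists (C + C'), (max N0 N1). intros N HN HN'.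
  eapply Rle_trans; [apply Rabs_triang|]. rewrite Rmult_plus_distr_r.
  apply Rplus_le_compat; [apply H|apply H']; lia.
Qed.

Lemma bigO_scal c f : bigO f -> bigO (fun N => c * f N).
Proof.
  intros (C & N0 & H). exists (Rabs c * C), N0. intros N HN HN'. rewrite Rabs_mult, Rmult_assoc.
  apply Rmult_le_compat_l; [apply Rabs_pos|auto].
Qed.

Lemma bigO_ext f g : (forall N, (1 <= N)%nat -> f N = g N) -> bigO f -> bigO g.
Proof. intros E (C & N0 & H). exists C, N0. intros N HN HN'. rewrite <- E; auto. Qed.

Lemma bigO_0 : bigO (fun _ => 0).
Proof. exists 0, 0%nat. intros. rewrite Rabs_R0. lra. Qed.

Lemma bigO_rsum n (f : nat -> nat -> R) : (forall i, (i < n)%nat -> bigO (f i)) ->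
  bigO (fun N => rsum n (fun i => f i N)).
Proof.
  induction n as [|n IH]; intros H.
  - apply (bigO_ext (fun _ => 0)); [reflexivity|apply bigO_0].
  - apply (bigO_ext (fun N => rsum n (fun i => f i N) + f n N)); [intros; symmetry; apply (rsum_S n (fun i => f i N))|].
    apply bigO_plus; auto.
Qed.

Lemma bigO_of_small f C h0 : 0 < h0 -> (forall h, 0 < h <= h0 -> Rabs (f h) <= C * h ^ P) ->
  bigO (fun N => f (a / INR N)).
Proof.
  intros H0 H. exists C, (Z.to_nat (up (a / h0))). intros N HN HN'.
  assert (0 < INR N) by (apply lt_0_INR; lia).
  apply H. split; [now apply Rdiv_lt_0_compat|]. apply Rle_div_l; auto. rewrite Rmult_comm.
  apply Rle_div_l; auto.
  destruct (archimed (a / h0)) as [h _]. apply Rle_trans with (IZR (up (a / h0))); [lra|].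
  rewrite INR_IZR_INZ. apply IZR_le. lia.
Qed.

Lemma bigO_zsum lo hi (f : Z -> nat -> R) : (forall i, bigO (f i)) ->
  bigO (fun N => zsum lo hi (fun i => f i N)).
Proof. intros H. apply (bigO_rsum _ (fun n N => f (lo + Z.of_nat n)%Z N)). intros; apply H. Qed.

Lemma bigO_Usum K1 K2 (f : Z -> Z -> nat -> R) : (forall i j, bigO (f i j)) ->
  bigO (fun N => Usum K1 K2 (fun i j => f i j N)).
Proof.
  intros H. apply (bigO_zsum _ _ (fun i N => zsum (- K2) K2 (fun j => if inU K1 K2 i j then f i j N else 0))).
  intros i. apply (bigO_zsum _ _ (fun j N => if inU K1 K2 i j then f i j N else 0)).
  intros j. destruct (inU K1 K2 i j); [apply H|apply bigO_0].
Qed.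

Lemma powerRZ_le_pow h (D : Z) : 0 < h <= 1 -> (Z.of_nat P <= D)%Z -> 0 <= powerRZ h D <= h ^ P.
Proof.
  intros Hh HD. split; [apply powerRZ_le; lra|].
  replace D with (Z.of_nat P + Z.of_nat (Z.to_nat (D - Z.of_nat P)))%Z by lia.
  rewrite powerRZ_add, <- !pow_powerRZ by lra.
  rewrite <- (Rmult_1_r (h ^ P)) at 2. apply Rmult_le_compat_l; [apply pow_le; lra|].
  rewrite <- (pow1 (Z.to_nat (D - Z.of_nat P))). apply pow_incr. lra.
Qed.

End QuadratureError.

(** * Monomials over powers of the first fundamental form *)

Section Pieces.

Variable Q : R -> R -> R.
Hypothesis Qsmooth : Smooth Q.
Hypothesis Qhom : forall t x y, Q (t * x) (t * y) = t ^ 2 * Q x y.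
Hypothesis Qpos : forall x y, 0 < nrm x y -> 0 < Q x y.

Definition piece (s : Z) (i l : nat) (x y : R) : R := x ^ i * y ^ l / Rpower (Q x y) (IZR s / 2).

Lemma piece_smooth s i l n : Cn n (fun x y => 0 < nrm x y) (piece s i l).
Proof.
  assert (O := open2_nrm_gt 0).
  apply (Cn_ext _ O n (fun x y => (x ^ i * y ^ l) * Rpower (Q x y) (- (IZR s / 2)))).
  - intros x y h. unfold piece. rewrite Rpower_Ropp. reflexivity.
  - apply Cn_mult; auto; [now apply Cn_monomial|]. apply Cn_Rpower; auto.
    apply (Cn_mono (fun _ _ => True)); auto.
Qed.

Lemma piece_homogeneous s i l t x y : 0 < t -> 0 < nrm x y ->
  piece s i l (t * x) (t * y) = powerRZ t (Z.of_nat (i + l) - s) * piece s i l x y.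
Proof.
  intros Ht h. unfold piece. rewrite Qhom, <- Rpower_mult_distr by (auto; apply pow_lt; auto).
  rewrite Rpower_nrm2 by auto. rewrite !Rpow_mult_distr.
  replace (Z.of_nat (i + l) - s)%Z with (Z.of_nat i + Z.of_nat l + - s)%Z by lia.
  rewrite !powerRZ_add, powerRZ_neg', <- !pow_powerRZ by lra. field.
  split; [apply Rgt_not_eq, exp_pos|apply powerRZ_NOR; lra].
Qed.

Lemma piece_odd s i l x y : Nat.odd (i + l) = true -> piece s i l (- x) (- y) = - piece s i l x y.
Proof.
  intros H. unfold piece.
  replace (Q (- x) (- y)) with (Q x y).
  2: { replace (- x) with ((-1) * x) by ring. replace (- y) with ((-1) * y) by ring.
       rewrite Qhom. ring. }
  replace ((- x) ^ i * (- y) ^ l) with (- (x ^ i * y ^ l)); [unfold Rdiv; ring|].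
  replace (- x) with ((-1) * x) by ring. replace (- y) with ((-1) * y) by ring.
  rewrite !Rpow_mult_distr.
  replace ((-1) ^ i * x ^ i * ((-1) ^ l * y ^ l)) with ((-1) ^ (i + l) * (x ^ i * y ^ l))
    by (rewrite pow_add; ring).
  apply Nat.odd_spec in H. destruct H as [k ->]. rewrite Nat.add_1_r, pow_1_odd. ring.
Qed.

End Pieces.

(** * Sums over the stencil *)

Lemma Usum_ext K1 K2 f g : (forall i j, f i j = g i j) -> Usum K1 K2 f = Usum K1 K2 g.
Proof.
  intros H. apply zsum_ext. intros i _. apply zsum_ext. intros j _. now rewrite H.
Qed.

Lemma Usum_plus K1 K2 f g : Usum K1 K2 (fun i j => f i j + g i j) = Usum K1 K2 f + Usum K1 K2 g.
Proof.
  unfold Usum. rewrite <- zsum_plus. apply zsum_ext. intros i _. rewrite <- zsum_plus.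
  apply zsum_ext. intros j _. destruct inU; ring.
Qed.

Lemma Usum_scal K1 K2 c f : Usum K1 K2 (fun i j => c * f i j) = c * Usum K1 K2 f.
Proof.
  unfold Usum. rewrite <- zsum_scal. apply zsum_ext. intros i _. rewrite <- zsum_scal.
  apply zsum_ext. intros j _. destruct inU; ring.
Qed.

Lemma Usum_rsum K1 K2 n (f : nat -> Z -> Z -> R) :
  Usum K1 K2 (fun i j => rsum n (fun k => f k i j)) = rsum n (fun k => Usum K1 K2 (f k)).
Proof.
  induction n as [|n IH].
  - rewrite rsum_0. apply zsum_eq0. intros i _. apply zsum_eq0. intros j _. destruct inU; reflexivity.
  - rewrite rsum_S, <- IH, <- Usum_plus. apply Usum_ext. intros i j. apply (rsum_S n (fun k => f k i j)).
Qed.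

Lemma Usum_odd K1 K2 f : (forall i j, inU K1 K2 i j = true -> f (- i)%Z (- j)%Z = - f i j) ->
  Usum K1 K2 f = 0.
Proof.
  intros H. assert (E : Usum K1 K2 f = - Usum K1 K2 f); [|lra].
  replace (- Usum K1 K2 f) with ((-1) * Usum K1 K2 f) by ring. rewrite <- Usum_scal. unfold Usum at 1.
  rewrite <- zsum_opp_index. apply zsum_ext. intros i _. rewrite <- zsum_opp_index.
  apply zsum_ext. intros j _.
  assert (S : inU K1 K2 (- i) (- j) = inU K1 K2 i j) by (unfold inU; now rewrite !Z.abs_opp).
  rewrite S. destruct (inU K1 K2 i j) eqn:E; auto. rewrite H by auto. ring.
Qed.

(** * The error expansion *)

Section Main.

Variables (a : R) (rx ry rz phi : R -> R -> R) (p q P : nat) (tau : Z -> Z -> Z -> R).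
Hypothesis Ha : 0 < a.
Hypothesis Hrx : Smooth rx.
Hypothesis Hry : Smooth ry.
Hypothesis Hrz : Smooth rz.
Hypothesis Hphi : Smooth phi.
Hypothesis Hind : forall al be : R,
     al * du rx + be * dv rx = 0 -> al * du ry + be * dv ry = 0 ->
     al * du rz + be * dv rz = 0 -> al = 0 /\ be = 0.
Hypothesis Hp : Nat.Odd p.
Hypothesis HP : (0 < P)%nat.
Hypothesis Hord : exists C delta, 0 < delta /\ forall x y, nrm x y < delta ->
  Rabs (phi x y) <= C * nrm x y ^ (2 * q).
Hypothesis Hw : forall m : Z, (0 <= m <= Mmax P p q)%Z ->
  weight_system (Qform rx ry rz) (2 * IZR m + INR p) (K1m q m) (K2m P p m) (tau m).

Let Q := Qform rx ry rz.
Let X := sqdist rx ry rz.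
Let Sd (x y : R) : R := X x y - Q x y.
Let fm (m : nat) (x y : R) : R := Sd x y ^ m * phi x y.
Let bp (m : nat) : R := gbinom (- INR p / 2) m.
Let sm (m : nat) : Z := (Z.of_nat p + 2 * Z.of_nat m)%Z.
(* Truncation orders of the binomial and Taylor expansions, large enough for a [C^P] remainder. *)
Let MM : nat := (2 * (P + p) + 2)%nat.
Let JJ : nat := (P + p + 2 * MM + 1)%nat.
(** The number of terms of [Ccorr]; [Z.to_nat] makes it 0 when [Mmax] is negative. *)
Let n0 : nat := Z.to_nat (Mmax P p q - 0 + 1).
(** [T_eq0_of_bound] makes the Taylor polynomials of [fm m] below order [3 m + 2 q] vanish as
    functions and does not speak of single coefficients; these are therefore set to 0 by hand. *)
Let tcf (m j l : nat) : R := if (j <? 3 * m + 2 * q)%nat then 0 else tc j (fm m) l.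

Lemma Q_pos x y : 0 < nrm x y -> 0 < Q x y.
Proof.
  intros h. destruct (Qform_equivalent rx ry rz Hind) as (lo & hi & Hlo & H).
  destruct (H x y) as [h1 _]. unfold Q. assert (0 < nrm x y ^ 2) by now apply pow_lt. nra.
Qed.

Lemma Smooth_Sd : Smooth Sd.
Proof.
  intros n. apply Cn_minus; [apply open2_True|apply Smooth_sqdist; auto|apply Smooth_Qform].
Qed.

Lemma Smooth_fm m : Smooth (fm m).
Proof.
  intros n. apply Cn_mult; [apply open2_True| |apply Hphi].
  apply Cn_pow; [apply open2_True|]. apply Smooth_Sd.
Qed.

(** The modified coefficients still represent [T j (fm m)], since [r^2 - Q = O(|u|^3)] and
    [phi = O(|u|^(2 q))]. *)
Lemma T_fm m j x y : T j (fm m) x y = rsum (S j) (fun l => tcf m j l * (x ^ (j - l) * y ^ l)).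
Proof.
  unfold tcf. destruct (Nat.ltb_spec j (3 * m + 2 * q)) as [h|h].
  - rewrite (rsum_eq0 (S j)) by (intros; ring).
    destruct Hord as (C & delta & Hdelta & H).
    destruct (sqdist_Qform_cubic rx ry rz Hrx Hry Hrz) as (C' & C0 & H').
    apply (T_eq0_of_bound (fm m) (3 * m + 2 * q) (C' ^ m * Rabs C) (Rmin delta 1)); auto.
    + apply Smooth_fm.
    + apply Rmin_pos; lra.
    + intros u v huv. generalize (Rmin_l delta 1) (Rmin_r delta 1) (nrm_ge0 u v). intros.
      unfold fm. rewrite Rabs_mult, <- RPow_abs.
      apply Rle_trans with ((C' * nrm u v ^ 3) ^ m * (Rabs C * nrm u v ^ (2 * q))).
      * apply Rmult_le_compat; [apply pow_le, Rabs_pos|apply Rabs_pos| |].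
        -- apply pow_incr. split; [apply Rabs_pos|]. apply H'. lra.
        -- eapply Rle_trans; [apply H; lra|]. apply Rmult_le_compat_r; [now apply pow_le|apply Rle_abs].
      * right. rewrite Rpow_mult_distr, <- pow_mult, (pow_add (nrm u v)). ring.
  - reflexivity.
Qed.

Lemma sm_half m : IZR (sm m) / 2 = INR p / 2 + INR m.
Proof.
  unfold sm. rewrite plus_IZR, mult_IZR, <- !INR_IZR_INZ. field.
Qed.

(** * Errors of the pieces against terms of the correction *)

Section Cutoff.

Variables (eta : R -> R -> R) (del B : R).
Hypothesis Hdel : 0 < del.
Hypothesis HB : del < B.
Hypothesis HBa : B < a.
Hypothesis eta_cut : cutoff eta.
Hypothesis eta1 : forall x y, nrm x y <= del -> eta x y = 1.
Hypothesis eta0 : forall x y, B <= nrm x y -> eta x y = 0.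
Hypothesis eta01 : forall x y, 0 <= eta x y <= 1.

Let pc (m j l : nat) : R -> R -> R := cutg (piece Q (sm m) (j - l) l) eta.
Let dg (m j l : nat) : Z := (Z.of_nat (j - l + l) - sm m)%Z.
Let eg (m j l : nat) (h : R) : R := errg (piece Q (sm m) (j - l) l) eta (dg m j l) del B h.
Let err (m j l N : nat) : R := if Nat.odd j then 0 else eg m j l (a / INR N).

Lemma Smooth_eta : Smooth eta.
Proof. intros n. apply smooth_on_Cn, eta_cut. Qed.

Lemma pc_smooth m i l n : Cn n (fun x y => 0 < nrm x y) (piece Q (sm m) i l).
Proof. apply piece_smooth; [apply Smooth_Qform|exact Q_pos]. Qed.

Lemma pc_homogeneous m j l t x y : 0 < t -> 0 < nrm x y ->
  piece Q (sm m) (j - l) l (t * x) (t * y) = powerRZ t (dg m j l) * piece Q (sm m) (j - l) l x y.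
Proof. apply piece_homogeneous; [apply Qform_homogeneous|exact Q_pos]. Qed.

Lemma dg_neq m j l : Nat.odd j = false -> (l <= j)%nat -> (dg m j l + 2 <> 0)%Z.
Proof.
  intros Hj Hl. destruct Hp as [k Hk]. unfold dg, sm.
  rewrite <- Nat.negb_even, Bool.negb_false_iff, Nat.even_spec in Hj. destruct Hj as [i Hi]. lia.
Qed.

(** Odd numerators give an odd function under the even cutoff; for even [j] the exponent [D] is odd
    because [p] is, hence nonzero, and [errg] is the error. *)
Lemma has_error_piece a' m j l : a < a' -> (l <= j)%nat -> has_error a a' (pc m j l) (err m j l).
Proof.
  intros Ha' Hl. unfold err. destruct (Nat.odd j) eqn:Hj.
  - apply (has_error_odd a a' Ha Ha' a' _ _ B); auto; try lra.
    + apply acont_cutg; [intros; apply pc_smooth|apply Smooth_eta].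
    + intros x y. unfold pc, cutg. destruct eta_cut as (_ & _ & Hev & _). rewrite Hev.
      rewrite piece_odd; [ring|apply Qform_homogeneous|]. replace (j - l + l)%nat with j by lia. auto.
    + intros x y h. apply (cutg_eq0 _ _ B); auto.
  - split; [apply acont_cutg; [intros; apply pc_smooth|apply Smooth_eta]|].
    exists (fpv (piece Q (sm m) (j - l) l) eta (dg m j l) del B). split.
    + apply fp_cutg; auto using Smooth_eta, dg_neq; try lra.
      * intros; apply pc_smooth.
      * intros; now apply pc_homogeneous.
    + intros N HN. assert (0 < INR N) by (apply lt_0_INR; lia).
      apply trap_sum_errg; auto; try lia.
      * now apply Rdiv_lt_0_compat.
      * rewrite <- INR_IZR_INZ. replace (INR N * (a / INR N)) with a by (field; lra). lra.
Qed.

Let UM (m j l : nat) : R := Usum (K1m q (Z.of_nat m)) (K2m P p (Z.of_nat m))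
  (fun mu nu => IZR mu ^ (j - l) * IZR nu ^ l * tau (Z.of_nat m) mu nu).
Let ce (m : nat) : Z := (2 - Z.of_nat p - 2 * Z.of_nat m)%Z.
(** The term of [Ccorr] that belongs to the Taylor monomial [(j, l)] of [fm m], without its
    coefficient. Its power of [h] is the exponent [D] of the corresponding piece. *)
Let cor (m j l N : nat) : R :=
  if (m <? n0)%nat then powerRZ (a / INR N) (ce m + Z.of_nat j) * UM m j l else 0.

Lemma errg_piece_small m j l : Nat.odd j = false -> (l <= j)%nat -> (Z.of_nat P <= dg m j l + 2)%Z ->
  exists C, forall h, 0 < h <= 1 ->
    Rabs (eg m j l h) <= C * h ^ P.
Proof.
  intros Hj Hl HD. apply errg_small; auto using Smooth_eta; try lia.
  - intros; apply pc_smooth.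
  - intros; now apply pc_homogeneous.
Qed.

(** For odd [j] the piece has no error, and [UM] vanishes by the symmetry of the weights. For
    [j = 2 k], [m <= M] and [k <= K2], the order condition gives [k >= K1], so the moment condition
    makes [- UM] the Wigner limit and [h^D] cancels. In all other cases [D >= P] and each term is
    small by itself. *)
Lemma piece_matches_correction m j l : (l <= j)%nat -> (3 * m + 2 * q <= j)%nat ->
  bigO a P (fun N => err m j l N + cor m j l N).
Proof.
  intros Hl Hjm.
  assert (EO : (ce m + Z.of_nat j)%Z = (dg m j l + 2)%Z).
  { unfold ce, dg, sm. replace (j - l + l)%nat with j by lia. lia. }
  assert (Hc : (Z.of_nat (P + p) <= 2 * cP P p <= Z.of_nat (P + p) + 1)%Z).
  { unfold cP. generalize (Z.div_mod (Z.of_nat (P + p) + 1) 2 ltac:(lia))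
      (Z.mod_pos_bound (Z.of_nat (P + p) + 1) 2 ltac:(lia)). lia. }
  unfold err, cor. destruct (Nat.odd j) eqn:Hj.
  - apply (bigO_ext _ _ (fun _ => 0)); [|apply bigO_0]. intros N HN.
    destruct (Nat.ltb_spec m n0) as [Hm|Hm]; [|ring].
    assert (Z : UM m j l = 0); [|rewrite Z; ring].
    assert (Hm' : (0 <= Z.of_nat m <= Mmax P p q)%Z) by (unfold n0 in Hm; lia).
    destruct (Hw _ Hm') as (_ & Hs & _). apply Usum_odd. intros mu nu HU.
    rewrite <- (Hs mu nu HU), !opp_IZR.
    replace (- IZR mu) with ((-1) * IZR mu) by ring. replace (- IZR nu) with ((-1) * IZR nu) by ring.
    rewrite !Rpow_mult_distr.
    replace ((-1) ^ (j - l) * IZR mu ^ (j - l) * ((-1) ^ l * IZR nu ^ l) * tau (Z.of_nat m) mu nu)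
      with ((-1) ^ (j - l + l) * (IZR mu ^ (j - l) * IZR nu ^ l * tau (Z.of_nat m) mu nu))
      by (rewrite pow_add; ring).
    replace (j - l + l)%nat with j by lia. apply Nat.odd_spec in Hj. destruct Hj as [k ->].
    rewrite Nat.add_1_r, pow_1_odd. ring.
  - generalize (dg_neq m j l Hj Hl). intros HD.
    assert (Ej : exists k, j = (2 * k)%nat).
    { rewrite <- Nat.negb_even, Bool.negb_false_iff, Nat.even_spec in Hj. exact Hj. }
    destruct Ej as [k Ek].
    assert (Edg : dg m j l = (2 * Z.of_nat k - Z.of_nat p - 2 * Z.of_nat m)%Z).
    { unfold dg, sm. replace (j - l + l)%nat with j by lia. lia. }
    destruct (Nat.ltb_spec m n0) as [Hm|Hm].
    + assert (Hm' : (0 <= Z.of_nat m <= Mmax P p q)%Z) by (unfold n0 in Hm; lia).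
      destruct (Z_le_gt_dec (Z.of_nat k) (K2m P p (Z.of_nat m))) as [Hk|Hk].
      * assert (HK1 : (K1m q (Z.of_nat m) <= Z.of_nat k)%Z).
        { unfold K1m. generalize (Z.div_mod (3 * Z.of_nat m + 1) 2 ltac:(lia))
            (Z.mod_pos_bound (3 * Z.of_nat m + 1) 2 ltac:(lia)). lia. }
        destruct (Hw _ Hm') as (Hmom & _).
        assert (HWg := Hmom k l (conj HK1 Hk) ltac:(lia)).
        replace (2 * k - l)%nat with (j - l)%nat in HWg by lia. fold (UM m j l) in HWg.
        (* An order above [D], as telescoping asks, and at least [P]. *)
        set (Mo := (P + Z.to_nat (dg m j l + 3))%nat).
        destruct (errg_limit (piece Q (sm m) (j - l) l) eta (dg m j l) del B Hdel HB) with (M := Mo) (L := - UM m j l)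
          as [C HC]; auto using Smooth_eta; try (unfold Mo; lia).
        -- intros; apply pc_smooth.
        -- intros; now apply pc_homogeneous.
        -- apply (errg_wigner _ eta _ del B) with (Q := Q) (s := 2 * IZR (Z.of_nat m) + INR p)
             (f := fun x y => x ^ (j - l) * y ^ l); auto using Smooth_eta.
           ++ intros; apply pc_smooth.
           ++ intros; now apply pc_homogeneous.
           ++ intros x y. unfold piece. do 3 f_equal. unfold sm.
              rewrite plus_IZR, mult_IZR, <- !INR_IZR_INZ. ring.
        -- apply (bigO_of_small a Ha P (fun h => eg m j l h +
              powerRZ h (ce m + Z.of_nat j) * UM m j l) (Rabs C) 1 Rlt_0_1).
           intros h Hh. rewrite EO.
           replace (eg m j l h + powerRZ h (dg m j l + 2) * UM m j l)
             with (eg m j l h - powerRZ h (dg m j l + 2) * - UM m j l) by ring.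
           eapply Rle_trans; [now apply HC|].
           generalize (powerRZ_le_pow P h (Z.of_nat Mo) Hh ltac:(unfold Mo; lia)). rewrite <- pow_powerRZ. intros [h1 h2].
           apply Rle_trans with (Rabs C * h ^ Mo).
           ++ apply Rmult_le_compat_r; auto. apply Rle_abs.
           ++ apply Rmult_le_compat_l; auto using Rabs_pos.
      * assert (HPD : (Z.of_nat P <= dg m j l + 2)%Z) by (unfold K2m in Hk; lia).
        destruct (errg_piece_small m j l Hj Hl HPD) as [C HC].
        apply bigO_plus.
        -- apply (bigO_of_small a Ha P _ C 1 Rlt_0_1 HC).
        -- apply (bigO_of_small a Ha P (fun h => powerRZ h (ce m + Z.of_nat j) * UM m j l) (Rabs (UM m j l)) 1 Rlt_0_1).
           intros h Hh. rewrite EO. destruct (powerRZ_le_pow P h (dg m j l + 2) Hh HPD) as [h1 h2].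
           rewrite Rabs_mult, (Rabs_pos_eq (powerRZ _ _)), Rmult_comm by auto.
           apply Rmult_le_compat_l; auto using Rabs_pos.
    (* From [2 k >= 3 m + 2 q] and [m >= M + 1] follows [2 k - 2 m + 2 >= 2 cP - 1]. The left side
       is even, so it is at least [2 cP], which is at least [P + p]. *)
    + assert (HPD : (Z.of_nat P <= dg m j l + 2)%Z).
      { unfold n0, Mmax in Hm. lia. }
      destruct (errg_piece_small m j l Hj Hl HPD) as [C HC].
      apply (bigO_ext _ _ (fun N => eg m j l (a / INR N))); [intros; ring|].
      apply (bigO_of_small a Ha P _ C 1 Rlt_0_1 HC).
Qed.

Let crem (m N : nat) : R := if (m <? n0)%nat then
  powerRZ (a / INR N) (ce m) * Usum (K1m q (Z.of_nat m)) (K2m P p (Z.of_nat m)) (fun mu nu =>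
    Rem JJ (fm m) (IZR mu * (a / INR N)) (IZR nu * (a / INR N)) * tau (Z.of_nat m) mu nu) else 0.

(** The stencil is fixed while [h] shrinks: for [h <= 1 / (nn + 1)] the scaled point lies in the
    unit square, where [Rem_bound] holds, and the order [JJ] outweighs the negative exponent
    [ce m]. *)
Lemma correction_remainder m : (m < MM)%nat -> bigO a P (crem m).
Proof.
  intros HmM. unfold crem. destruct (m <? n0)%nat; [|apply bigO_0].
  apply (bigO_ext _ _ (fun N => Usum (K1m q (Z.of_nat m)) (K2m P p (Z.of_nat m)) (fun mu nu =>
    powerRZ (a / INR N) (ce m) *
    (Rem JJ (fm m) (IZR mu * (a / INR N)) (IZR nu * (a / INR N)) * tau (Z.of_nat m) mu nu)))).
  { intros N _. apply Usum_scal. }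
  apply (bigO_Usum a P _ _ (fun mu nu N => powerRZ (a / INR N) (ce m) *
    (Rem JJ (fm m) (IZR mu * (a / INR N)) (IZR nu * (a / INR N)) * tau (Z.of_nat m) mu nu))).
  intros mu nu. destruct (Rem_bound JJ (fm m) (Smooth_fm m)) as [C HC].
  set (nn := nrm (IZR mu) (IZR nu)). assert (nn0 : 0 <= nn) by apply nrm_ge0.
  set (t := tau (Z.of_nat m) mu nu).
  apply (bigO_of_small a Ha P (fun h => powerRZ h (ce m) * (Rem JJ (fm m) (IZR mu * h) (IZR nu * h) * t))
     (Rabs C * nn ^ JJ * Rabs t) (/ (nn + 1))).
  { apply Rinv_0_lt_compat; lra. }
  intros h Hh.
  assert (Hh1 : h * (nn + 1) <= 1).
  { apply Rle_trans with (/ (nn + 1) * (nn + 1)); [apply Rmult_le_compat_r; lra|right; field; lra]. }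
  assert (Hn : nrm (IZR mu * h) (IZR nu * h) = h * nn).
  { rewrite (Rmult_comm (IZR mu)), (Rmult_comm (IZR nu)), nrm_mult, Rabs_pos_eq by lra. reflexivity. }
  assert (h1 : h <= 1) by nra.
  generalize (HC (IZR mu * h) (IZR nu * h)). rewrite Hn. intros HR. specialize (HR ltac:(nra)).
  rewrite !Rabs_mult, (Rabs_pos_eq (powerRZ _ _)) by (apply powerRZ_le; lra).
  assert (HR' : Rabs (Rem JJ (fm m) (IZR mu * h) (IZR nu * h)) <= Rabs C * nn ^ JJ * h ^ JJ).
  { eapply Rle_trans; [exact HR|]. rewrite Rpow_mult_distr.
    replace (Rabs C * nn ^ JJ * h ^ JJ) with (Rabs C * (h ^ JJ * nn ^ JJ)) by ring.
    apply Rmult_le_compat_r; [|apply Rle_abs]. apply Rmult_le_pos; apply pow_le; lra. }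
  apply Rle_trans with (powerRZ h (ce m) * (Rabs C * nn ^ JJ * h ^ JJ * Rabs t)).
  { apply Rmult_le_compat_l; [apply powerRZ_le; lra|]. apply Rmult_le_compat_r; auto using Rabs_pos. }
  replace (powerRZ h (ce m) * (Rabs C * nn ^ JJ * h ^ JJ * Rabs t)) with
    (Rabs C * nn ^ JJ * Rabs t * powerRZ h (ce m + Z.of_nat JJ)).
  2: { rewrite powerRZ_add, <- pow_powerRZ by lra. ring. }
  apply Rmult_le_compat_l.
  - apply Rmult_le_pos; [|apply Rabs_pos]. apply Rmult_le_pos; [apply Rabs_pos|now apply pow_le].
  - apply powerRZ_le_pow; [lra|]. unfold ce, JJ. lia.
Qed.

(** The correction is indexed by the same [m], [j], [l] as the pieces, so that the two can be
    compared term by term; as [n0 <= MM], the sum over [m] is padded by zeros. *)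
Lemma Ccorr_expansion N : (1 <= N)%nat -> Ccorr rx ry rz phi p q P tau (a / INR N) =
  rsum MM (fun m => bp m *
    (rsum JJ (fun j => rsum (S j) (fun l => tcf m j l * cor m j l N)) + crem m N)).
Proof.
  intros HN. set (h := a / INR N).
  assert (Hh : 0 < h) by (apply Rdiv_lt_0_compat; auto; apply lt_0_INR; lia).
  unfold Ccorr. rewrite zsum_rsum. fold n0.
  assert (Hc : (2 * cP P p <= Z.of_nat (P + p) + 1)%Z).
  { unfold cP. generalize (Z.div_mod (Z.of_nat (P + p) + 1) 2 ltac:(lia))
      (Z.mod_pos_bound (Z.of_nat (P + p) + 1) 2 ltac:(lia)). lia. }
  rewrite <- (rsum_pad n0 MM) by (unfold n0, MM, Mmax; lia).
  apply rsum_ext. intros m Hm. unfold cor, crem. destruct (m <? n0)%nat.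
  2: { rewrite (rsum_eq0 JJ); [ring|]. intros j _. apply rsum_eq0. intros; ring. }
  rewrite Z.add_0_l, Nat2Z.id. fold (bp m) h.
  rewrite (Usum_ext _ _ _ (fun mu nu => (bp m * powerRZ h (ce m)) *
    (rsum JJ (fun j => rsum (S j) (fun l => (tcf m j l * h ^ j) *
       (IZR mu ^ (j - l) * IZR nu ^ l * tau (Z.of_nat m) mu nu)))
     + Rem JJ (fm m) (IZR mu * h) (IZR nu * h) * tau (Z.of_nat m) mu nu))).
  - rewrite Usum_scal, Usum_plus.
    rewrite (Usum_rsum _ _ JJ (fun j mu nu => rsum (S j) (fun l => (tcf m j l * h ^ j) *
       (IZR mu ^ (j - l) * IZR nu ^ l * tau (Z.of_nat m) mu nu)))).
    rewrite !Rmult_assoc. f_equal. rewrite Rmult_plus_distr_l. f_equal.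
    rewrite <- rsum_scal. apply rsum_ext. intros j Hj.
    rewrite (Usum_rsum _ _ (S j) (fun l mu nu => (tcf m j l * h ^ j) *
       (IZR mu ^ (j - l) * IZR nu ^ l * tau (Z.of_nat m) mu nu))).
    rewrite <- rsum_scal. apply rsum_ext. intros l Hl. rewrite Usum_scal.
    fold (UM m j l). rewrite powerRZ_add, <- pow_powerRZ by lra. ring.
  - intros mu nu. rewrite rdist_pow2. fold X. fold Q. fold (Sd (IZR mu * h) (IZR nu * h)).
    fold (fm m (IZR mu * h) (IZR nu * h)). fold (ce m).
    replace (rsum JJ (fun j => rsum (S j) (fun l => tcf m j l * h ^ j *
       (IZR mu ^ (j - l) * IZR nu ^ l * tau (Z.of_nat m) mu nu)))) with
      (tau (Z.of_nat m) mu nu * rsum JJ (fun j => T j (fm m) (IZR mu * h) (IZR nu * h))).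
    + unfold Rem. ring.
    + rewrite <- rsum_scal. apply rsum_ext. intros j Hj. rewrite T_fm, <- rsum_scal.
      apply rsum_ext. intros l Hl. rewrite !Rpow_mult_distr.
      replace (h ^ j) with (h ^ (j - l) * h ^ l) by (rewrite <- pow_add; f_equal; lia). ring.
Qed.

(** * The regular remainder *)

Variables (a' : R) (Ft : R -> R -> R).
(** [Ft] continues the integrand beyond the square, by 0 or by periodicity, so that its derivatives
    on the boundary are two-sided and can be matched. *)
Hypothesis Ha' : a < a'.
Hypothesis Ft_smooth : forall n, Cn n (pball a') Ft.
Hypothesis Ft_matching : matching a P Ft.
Hypothesis Ft_eq : forall x y, 0 < nrm x y <= a -> Ft x y = phi x y / rdist rx ry rz x y ^ p.
Hypothesis X_pos : forall x y, 0 < nrm x y <= a -> 0 < X x y.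

Let sumP (x y : R) : R := rsum MM (fun m => bp m *
  rsum JJ (fun j => rsum (S j) (fun l => tcf m j l * pc m j l x y))).
(** The value 0 at the origin fills the removable singularity and agrees with the trapezoidal sum,
    which leaves that point out. *)
Let Rf (x y : R) : R := if Rlt_dec 0 (nrm x y) then Ft x y - sumP x y else 0.

Lemma Rpower_sm m x y : 0 < Q x y ->
  Rpower (Q x y) (IZR (sm m) / 2) = Rpower (Q x y) (INR p / 2) * Q x y ^ m.
Proof. intros h. rewrite sm_half, Rpower_plus, Rpower_pow by auto. reflexivity. Qed.

(** Where [eta = 1], the Taylor polynomials of [fm m] cancel between [Ft] and [sumP]. What remains
    is the tail of the binomial series in [Sd / Q] and, for each [m], a Taylor remainder over
    [Q^(p/2 + m)]. *)
Lemma Rf_near_0 x y : 0 < nrm x y <= del -> nrm x y <= a -> -1 < Sd x y / Q x y ->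
  Rf x y = phi x y * Rpower (Q x y) (IZR (- sm 0) / 2) * rho (- INR p / 2) MM (Sd x y / Q x y)
    + rsum MM (fun m => bp m * (Rem JJ (fm m) x y * Rpower (Q x y) (IZR (- sm m) / 2))).
Proof.
  intros h ha hz. assert (q0 : 0 < Q x y) by (apply Q_pos; lra).
  assert (x0 : 0 < X x y) by (apply X_pos; lra).
  unfold Rf. destruct Rlt_dec as [_|n]; [|lra].
  set (z := Sd x y / Q x y) in *.
  assert (w0 : forall m, 0 < Rpower (Q x y) (IZR (sm m) / 2)) by (intros; apply exp_pos).
  assert (wN : forall m, Rpower (Q x y) (IZR (- sm m) / 2) = / Rpower (Q x y) (IZR (sm m) / 2)).
  { intros m. rewrite <- Rpower_Ropp. f_equal. rewrite opp_IZR. field. }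
  assert (EF : Ft x y = phi x y * Rpower (Q x y) (IZR (- sm 0) / 2) * Rpower (1 + z) (- INR p / 2)).
  { rewrite Ft_eq by lra. rewrite rdist_pow by exact x0. fold X.
    replace (X x y) with (Q x y * (1 + z)) by (unfold z, Sd; field; lra).
    rewrite <- Rpower_mult_distr by (auto; lra). rewrite wN, sm_half.
    replace (- INR p / 2) with (- (INR p / 2)) by field. rewrite Rpower_Ropp.
    simpl (INR 0). rewrite Rplus_0_r.
    field. split; apply Rgt_not_eq, exp_pos. }
  rewrite EF. replace (Rpower (1 + z) (- INR p / 2)) with
    (rho (- INR p / 2) MM z + rsum MM (fun m => bp m * z ^ m)) by (unfold rho, bp; ring).
  rewrite Rmult_plus_distr_l. unfold Rminus. rewrite Rplus_assoc. f_equal.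
  rewrite <- rsum_scal. unfold sumP.
  replace (- rsum MM (fun m => bp m * rsum JJ (fun j => rsum (S j) (fun l => tcf m j l * pc m j l x y))))
    with ((-1) * rsum MM (fun m => bp m * rsum JJ (fun j => rsum (S j) (fun l => tcf m j l * pc m j l x y))))
    by ring.
  rewrite <- rsum_scal, <- rsum_plus. apply rsum_ext. intros m Hm.
  replace (rsum JJ (fun j => rsum (S j) (fun l => tcf m j l * pc m j l x y)))
    with (/ Rpower (Q x y) (IZR (sm m) / 2) * rsum JJ (fun j => T j (fm m) x y)).
  - unfold Rem. rewrite !wN, (Rpower_sm 0), (Rpower_sm m) by auto.
    unfold fm at 2, z, Rdiv. rewrite Rpow_mult_distr, pow_inv. simpl (_ ^ 0). field.
    split; [apply pow_nonzero; lra|apply Rgt_not_eq, exp_pos].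
  - rewrite <- rsum_scal. apply rsum_ext. intros j Hj. rewrite T_fm, <- rsum_scal.
    apply rsum_ext. intros l Hl. unfold pc, cutg, piece. rewrite eta1 by lra. unfold Rdiv. ring.
Qed.

(** [Sd / Q] has weight 3 - 2 = 1, so the binomial tail has weight [MM - p]; the Taylor remainders
    have weight [JJ - p - 2 m]. Both are at least [P + 1], which is what [Gn_extends_at_0] asks for
    class [C^P]. *)
Lemma Rf_smooth_at_0 : exists r, 0 < r /\ Cn P (fun x y => nrm x y < r) Rf.
Proof.
  destruct (Qform_equivalent rx ry rz Hind) as (lo & hi & Hlo & HQ). fold Q in HQ.
  destruct (sqdist_Qform_cubic rx ry rz Hrx Hry Hrz) as (C & C0 & HS). fold X Q in HS.
  (* The last entry makes [C |u| <= lo / 2], hence [|Sd / Q| <= 1/2]; the others ensure [nrm <= 1],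
     [eta = 1] and a point of the square. *)
  set (r := Rmin (Rmin 1 del) (Rmin a (lo / (2 * (C + 1))))).
  assert (Hr0 : 0 < r).
  { repeat apply Rmin_pos; try lra. apply Rdiv_lt_0_compat; lra. }
  assert (Hr1 : r <= 1 /\ r <= del /\ r <= a /\ r <= lo / (2 * (C + 1))).
  { unfold r. generalize (Rmin_l (Rmin 1 del) (Rmin a (lo / (2 * (C + 1)))))
      (Rmin_r (Rmin 1 del) (Rmin a (lo / (2 * (C + 1))))) (Rmin_l 1 del) (Rmin_r 1 del)
      (Rmin_l a (lo / (2 * (C + 1)))) (Rmin_r a (lo / (2 * (C + 1)))). lra. }
  destruct Hr1 as (r1 & r2 & r3 & r4).
  assert (O := open2_pball r).
  assert (Hpos : forall x y, pball r x y -> 0 < nrm x y <= 1) by (unfold pball; intros; lra).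
  assert (Up : True -> forall x y, pball r x y -> 0 < nrm x y <= 1) by auto.
  assert (Sub : forall x y, pball r x y -> pball 1 x y) by (unfold pball; intros; lra).
  assert (Hz : forall x y, pball r x y -> Rabs (Sd x y / Q x y) <= 1 / 2).
  { intros x y [h1 h2]. assert (q0 : 0 < Q x y) by now apply Q_pos.
    unfold Rdiv at 1. rewrite Rabs_mult, (Rabs_pos_eq (/ _)) by (left; now apply Rinv_0_lt_compat).
    apply Rle_div_l; auto.
    eapply Rle_trans; [apply HS; lra|]. destruct (HQ x y) as [h3 _].
    assert (n2 : 0 < nrm x y ^ 2) by now apply pow_lt.
    assert (h4 : nrm x y * (2 * (C + 1)) <= lo).
    { apply Rle_trans with (lo / (2 * (C + 1)) * (2 * (C + 1))); [|right; field; lra].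
      apply Rmult_le_compat_r; lra. }
    replace (C * nrm x y ^ 3) with (C * nrm x y * nrm x y ^ 2) by ring.
    assert (C * nrm x y <= lo / 2) by nra. nra. }
  assert (GQ : Gn True P 2 (pball r) Q).
  { apply (Gn_mono _ (pball 1)); auto.
    apply (Gn_ext True (pball 1) (open2_pball 1) P 2 (Rem 2 Q)).
    - intros x y _. apply (Rem_eq_of_bound Q 2 hi 1); [apply Smooth_Qform|lra|].
      intros u v _. destruct (HQ u v) as [h1 h2].
      assert (0 <= nrm u v ^ 2) by apply pow2_ge_0. rewrite Rabs_pos_eq; [auto|]. nra.
    - apply Gn_Rem; [apply Smooth_Qform|lia]. }
  assert (GQp : forall d, Gn True P d (pball r) (fun x y => Rpower (Q x y) (IZR d / 2))).
  { intros d. apply (Gn_Rpower_half (pball r) lo hi); auto. }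
  assert (GRem : forall k f, Smooth f -> Gn True P (Z.of_nat k) (pball r) (Rem k f)).
  { intros k f Hf. apply (Gn_mono _ (pball 1)); auto. apply Gn_Rem; auto. lia. }
  assert (GS : Gn True P 3 (pball r) Sd).
  { apply (Gn_ext True (pball r) O P 3 (Rem 3 Sd)).
    - intros x y _. apply (Rem_eq_of_bound Sd 3 C 1); [apply Smooth_Sd|lra|].
      intros u v h. apply HS. lra.
    - apply (GRem 3%nat). apply Smooth_Sd. }
  assert (GZ : Gn True P 1 (pball r) (fun x y => Sd x y / Q x y)).
  { apply (Gn_ext True (pball r) O P 1 (fun x y => Sd x y * Rpower (Q x y) (IZR (-2) / 2))).
    - intros x y h. unfold Rdiv at 2. f_equal. replace (IZR (-2) / 2) with (- (1)) by field.
      rewrite Rpower_Ropp, Rpower_1; auto. apply Q_pos. apply h.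
    - apply (Gn_mult True (pball r) O Up P 3 (-2)); auto. }
  exists r. split; auto.
  apply (Gn_extends_at_0 r P Hr0 (Z.of_nat P + 1)); [lia| |].
  - unfold Rf. rewrite nrm_00. destruct Rlt_dec; [lra|reflexivity].
  - apply (Gn_ext True (pball r) O P _
      (fun x y => phi x y * Rpower (Q x y) (IZR (- sm 0) / 2) * rho (- INR p / 2) MM (Sd x y / Q x y)
    + rsum MM (fun m => bp m * (Rem JJ (fm m) x y * Rpower (Q x y) (IZR (- sm m) / 2))))).
    + intros x y h. symmetry. generalize (Hz x y h). intros hz. apply Rabs_le_between in hz.
      unfold pball in h. apply Rf_near_0; lra.
    + apply Gn_plus; auto.
      * apply (Gn_weight True (pball r) Up P (0 + - sm 0 + Z.of_nat MM)).
        { left. unfold sm, MM. lia. }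
        apply Gn_mult; auto; [apply Gn_mult; auto|].
        -- apply (Gn_ext True (pball r) O P 0 (Rem 0 phi)).
           ++ intros x y _. unfold Rem. rewrite rsum_0. ring.
           ++ apply (GRem 0%nat); auto.
        -- apply Gn_rho; auto.
      * apply (Gn_rsum True (pball r) O P _ MM (fun m x y =>
           bp m * (Rem JJ (fm m) x y * Rpower (Q x y) (IZR (- sm m) / 2)))).
        intros m Hm. apply Gn_scal; auto.
        apply (Gn_weight True (pball r) Up P (Z.of_nat JJ + - sm m)).
        { left. unfold sm, JJ. lia. }
        apply Gn_mult; auto. apply GRem. apply Smooth_fm.
Qed.

Lemma sumP_smooth n : Cn n (fun x y => 0 < nrm x y) sumP.
Proof.
  assert (O := open2_nrm_gt 0).
  apply Cn_rsum; auto. intros m Hm. apply Cn_scal; auto.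
  apply Cn_rsum; auto. intros j Hj. apply Cn_rsum; auto. intros l Hl. apply Cn_scal; auto.
  apply Cn_cutg; [intros; apply pc_smooth|apply Smooth_eta].
Qed.

Lemma Rf_smooth : Cn P (fun x y => nrm x y < a') Rf.
Proof.
  destruct Rf_smooth_at_0 as (r & Hr & HC).
  assert (H1 : Cn P (pball a') Rf).
  { assert (O := open2_pball a').
    apply (Cn_ext _ O P (fun x y => Ft x y - sumP x y)).
    - intros x y [h _]. unfold Rf. destruct Rlt_dec; [reflexivity|lra].
    - apply Cn_minus; auto. apply (Cn_mono (fun x y => 0 < nrm x y)); [unfold pball; intros; lra|].
      apply sumP_smooth. }
  eapply Cn_mono; [|exact (Cn_union P _ _ _ H1 HC)]. intros x y h. simpl.
  destruct (Rlt_dec 0 (nrm x y)); [left; split; auto|right]. lra.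
Qed.

(** Near the boundary the cutoff has removed [sumP], so [Rf] has the germs of [Ft] there. *)
Lemma Rf_matching : matching a P Rf.
Proof.
  set (V := fun x y => B < nrm x y /\ nrm x y < a').
  assert (OV : open2 V) by (apply open2_and; [apply open2_nrm_gt|apply open2_nrm_lt]).
  assert (E : forall x y, V x y -> Rf x y = Ft x y).
  { intros x y [h1 h2]. unfold Rf. destruct Rlt_dec; [|lra].
    replace (sumP x y) with 0; [ring|]. symmetry. apply rsum_eq0. intros m Hm.
    rewrite (rsum_eq0 JJ); [ring|]. intros j Hj. apply rsum_eq0. intros l Hl.
    unfold pc. rewrite (cutg_eq0 _ _ B) by (auto; lra). ring. }
  intros k s Hk Hs.
  assert (Va : V (- a) s /\ V a s /\ V s (- a) /\ V s a).
  { assert (A : forall t, Rabs t = a -> V t s /\ V s t).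
    { intros t Ht. unfold V. assert (nrm t s = a) by (unfold nrm; rewrite Ht; apply Rmax_left; lra).
      assert (nrm s t = a) by (unfold nrm; rewrite Ht; apply Rmax_right; lra). lra. }
    generalize (A (- a)) (A a). rewrite Rabs_Ropp, (Rabs_pos_eq a) by lra. intuition. }
  destruct Va as (v1 & v2 & v3 & v4). destruct (Ft_matching k s Hk Hs) as [m1 m2].
  rewrite !(dxn_ext V Rf Ft OV E) by auto. rewrite !(dyn_ext V Rf Ft OV E) by auto. auto.
Qed.

Lemma has_error_Rf : exists e, has_error a a' Rf e /\ bigO a P e.
Proof.
  assert (HC := Rf_smooth).
  assert (Hcont : forall x y, nrm x y < a' -> continuity_2d_pt Rf x y).
  { intros x y h. exact (Cn_continuity P _ Rf x y HC h). }
  set (I := iint Rf (- a) a (- a) a).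
  exists (fun N => trap_sum Rf (Z.of_nat N) (a / INR N) - I). split.
  - split; [intros x y [_ h]; auto|]. exists I. split; [|reflexivity].
    apply fp_continuous; auto. intros x y hx hy. apply Hcont.
    apply Rle_lt_trans with a; auto. apply nrm_le; apply Rabs_le; lra.
  - destruct (dxn_dyn_bound P Rf a a' Ha Ha' HC) as (Bd & Bd0 & HBd).
    exists (2 ^ S P * (2 * a) ^ 2 * Bd), 0%nat. intros N _ HN.
    assert (HN0 : 0 < INR N) by (apply lt_0_INR; lia).
    rewrite trap_sum_grid_sum.
    2: { unfold Rf. rewrite nrm_00. destruct Rlt_dec; [lra|reflexivity]. }
    assert (E : INR N * (a / INR N) = a) by (field; lra).
    generalize (trapezoidal_error_2d P Rf N (a / INR N) a' Bd HP). rewrite E. intros H. unfold I.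
    apply H; auto.
    + now apply Rdiv_lt_0_compat.
    + apply Rf_matching.
Qed.

(** Away from the origin [Ft = Rf + sumP], and errors add. That of [Rf] is [O(h^P)]; those of the
    pieces are paired with the terms of [Ccorr], the factor [tcf] being 0 below the order that the
    pairing requires. *)
Lemma quadrature_with_cutoff : exists I : R,
    fp_square_int (fun x y => phi x y / rdist rx ry rz x y ^ p) a I /\
    exists (C : R) (N0 : nat), forall N : nat, (N0 <= N)%nat -> (1 <= N)%nat ->
      Rabs (I - (trap_sum (fun x y => phi x y / rdist rx ry rz x y ^ p) (Z.of_nat N) (a / INR N)
                 + Ccorr rx ry rz phi p q P tau (a / INR N)))
        <= C * (a / INR N) ^ P.
Proof.
  destruct has_error_Rf as (eR & HR & HO).
  set (eP := fun N => rsum MM (fun m => bp m * rsum JJ (fun j => rsum (S j) (fun l => tcf m j l * err m j l N)))).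
  assert (HPs : has_error a a' sumP eP).
  { apply (has_error_rsum a a' Ha Ha' MM (fun m x y => bp m * rsum JJ (fun j => rsum (S j) (fun l => tcf m j l * pc m j l x y)))
      (fun m N => bp m * rsum JJ (fun j => rsum (S j) (fun l => tcf m j l * err m j l N)))).
    intros m Hm. apply has_error_scal; auto.
    apply (has_error_rsum a a' Ha Ha' JJ (fun j x y => rsum (S j) (fun l => tcf m j l * pc m j l x y))
      (fun j N => rsum (S j) (fun l => tcf m j l * err m j l N))).
    intros j Hj.
    apply (has_error_rsum a a' Ha Ha' (S j) (fun l x y => tcf m j l * pc m j l x y)
      (fun l N => tcf m j l * err m j l N)).
    intros l Hl. apply has_error_scal; auto. apply has_error_piece; auto. lia. }
  assert (HF : has_error a a' Ft (fun N => eR N + eP N)).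
  { apply (has_error_ext a a' Ha (fun x y => Rf x y + sumP x y)).
    - intros x y h. exact (Cn_continuity 0 _ Ft x y (Ft_smooth 0) h).
    - intros x y h. unfold Rf. destruct Rlt_dec; [ring|lra].
    - now apply has_error_plus. }
  destruct HF as (_ & I & HI & HT). exists I. split.
  { apply (fp_ext Ft); auto. intros x y h. apply Ft_eq. lra. }
  assert (Htot : bigO a P (fun N => (eR N + eP N) + Ccorr rx ry rz phi p q P tau (a / INR N))).
  { apply (bigO_ext _ _ (fun N => eR N + rsum MM (fun m => bp m *
       (rsum JJ (fun j => rsum (S j) (fun l => tcf m j l * (err m j l N + cor m j l N))) + crem m N)))).
    - intros N HN. rewrite Ccorr_expansion by auto. rewrite Rplus_assoc. f_equal. unfold eP.
      rewrite <- rsum_plus. apply rsum_ext. intros m Hm. rewrite <- Rmult_plus_distr_l. f_equal.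
      rewrite <- Rplus_assoc. f_equal. rewrite <- rsum_plus. apply rsum_ext. intros j Hj.
      rewrite <- rsum_plus. apply rsum_ext. intros l Hl. ring.
    - apply bigO_plus; auto.
      apply (bigO_rsum a P MM (fun m N => bp m * (rsum JJ (fun j => rsum (S j)
         (fun l => tcf m j l * (err m j l N + cor m j l N))) + crem m N))).
      intros m Hm. apply bigO_scal. apply bigO_plus; [|now apply correction_remainder].
      apply (bigO_rsum a P JJ (fun j N => rsum (S j) (fun l => tcf m j l * (err m j l N + cor m j l N)))).
      intros j Hj.
      apply (bigO_rsum a P (S j) (fun l N => tcf m j l * (err m j l N + cor m j l N))).
      intros l Hl. unfold tcf. destruct (Nat.ltb_spec j (3 * m + 2 * q)) as [h|h].
      + apply (bigO_ext _ _ (fun _ => 0)); [intros; ring|apply bigO_0].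
      + apply bigO_scal. apply piece_matches_correction; lia. }
  destruct Htot as (C & N0 & HC). exists C, N0. intros N HN HN'.
  assert (HN0 : 0 < INR N) by (apply lt_0_INR; lia).
  rewrite (trap_sum_ext (fun x y => phi x y / rdist rx ry rz x y ^ p) Ft).
  - replace (I - (trap_sum Ft (Z.of_nat N) (a / INR N) + Ccorr rx ry rz phi p q P tau (a / INR N)))
      with (- ((trap_sum Ft (Z.of_nat N) (a / INR N) - I) + Ccorr rx ry rz phi p q P tau (a / INR N))) by ring.
    rewrite Rabs_Ropp, HT by auto. now apply HC.
  - now apply Rdiv_lt_0_compat.
  - intros x y h1 h2. symmetry. apply Ft_eq.
    rewrite <- INR_IZR_INZ in h2. replace (INR N * (a / INR N)) with a in h2 by (field; lra). lra.
Qed.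

End Cutoff.

End Main.

(** * Periodicity of derivatives, and the two boundary conditions *)

Lemma dxn_periodic c f : (forall x y, f (x + c) y = f x y) -> forall k x y, dxn k f (x + c) y = dxn k f x y.
Proof.
  (* [Derive] is by definition the [Lim] of difference quotients, so periodicity passes to it
     directly, also at points where [f] is not differentiable. *)
  intros H. induction k as [|k IH]; intros x y; simpl; auto. unfold dx, Derive. f_equal.
  apply Lim_ext. intros h. rewrite IH. replace (x + c + h) with (x + h + c) by ring. now rewrite IH.
Qed.

Lemma dyn_periodic c f : (forall x y, f x (y + c) = f x y) -> forall k x y, dyn k f x (y + c) = dyn k f x y.
Proof.
  intros H. induction k as [|k IH]; intros x y; simpl; auto. unfold dy, Derive. f_equal.
  apply Lim_ext. intros h. rewrite IH. replace (y + c + h) with (y + h + c) by ring. now rewrite IH.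
Qed.

Theorem theorem4
  (a : R) (rx ry rz : R -> R -> R) (phi : R -> R -> R) (p q P : nat)
  (tau : Z -> Z -> Z -> R) :
  0 < a ->
  smooth rx -> smooth ry -> smooth rz ->
  (forall al be : R,
     al * du rx + be * dv rx = 0 -> al * du ry + be * dv ry = 0 ->
     al * du rz + be * dv rz = 0 -> al = 0 /\ be = 0) ->
  (forall u v, Rabs u <= a -> Rabs v <= a -> (u, v) <> (0, 0) ->
     (rx u v, ry u v, rz u v) <> (rx 0 0, ry 0 0, rz 0 0)) ->
  Nat.Odd p -> (0 < P)%nat ->
  smooth phi ->
  ((exists b, 0 <= b < a /\
      forall x y, b < Rmax (Rabs x) (Rabs y) -> phi x y = 0)
   \/
   (exists g : R -> R -> R,
      (forall x y, g (x + 2 * a) y = g x y /\ g x (y + 2 * a) = g x y) /\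
      smooth_on (fun x y => ~ exists i j : Z, x = 2 * a * IZR i /\ y = 2 * a * IZR j) g /\
      (forall x y, Rabs x <= a -> Rabs y <= a -> (x, y) <> (0, 0) ->
         g x y = phi x y / rdist rx ry rz x y ^ p))) ->
  (exists C delta, 0 < delta /\
     forall x y, Rmax (Rabs x) (Rabs y) < delta ->
       Rabs (phi x y) <= C * Rmax (Rabs x) (Rabs y) ^ (2 * q)) ->
  (forall m : Z, (0 <= m <= Mmax P p q)%Z ->
     weight_system (Qform rx ry rz) (2 * IZR m + INR p) (K1m q m) (K2m P p m) (tau m) /\
     (forall tau' : Z -> Z -> R,
        weight_system (Qform rx ry rz) (2 * IZR m + INR p) (K1m q m) (K2m P p m) tau' ->
        forall mu nu, inU (K1m q m) (K2m P p m) mu nu = true -> tau' mu nu = tau m mu nu)) ->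
  exists I : R,
    fp_square_int (fun x y => phi x y / rdist rx ry rz x y ^ p) a I /\
    exists (C : R) (N0 : nat), forall N : nat, (N0 <= N)%nat -> (1 <= N)%nat ->
      Rabs (I - (trap_sum (fun x y => phi x y / rdist rx ry rz x y ^ p) (Z.of_nat N) (a / INR N)
                 + Ccorr rx ry rz phi p q P tau (a / INR N)))
        <= C * (a / INR N) ^ P.
Proof.
  intros Ha Hrx Hry Hrz Hind Hinj Hp HP Hphi Hper Hord Hw.
  assert (Sx : Smooth rx) by (intros n; now apply smooth_on_Cn).
  assert (Sy : Smooth ry) by (intros n; now apply smooth_on_Cn).
  assert (Sz : Smooth rz) by (intros n; now apply smooth_on_Cn).
  assert (Sphi : Smooth phi) by (intros n; now apply smooth_on_Cn).
  assert (Xpos : forall x y, 0 < nrm x y <= a -> 0 < sqdist rx ry rz x y).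
  { intros x y [h1 h2]. generalize (Rabs_le_nrm_l x y) (Rabs_le_nrm_r x y). intros.
    apply sqdist_pos, Hinj; try lra. now apply nrm_pos_neq. }
  (* The radii are a free choice between 0 and [a]; the second below [a] keeps the cutoff away from
     the boundary. *)
  destruct (cutoff_exists (a / 3) (a / 2)) as (eta & Hcut & eta1 & eta0 & eta01); try lra.
  assert (Main := fun a' Ft => quadrature_with_cutoff a rx ry rz phi p q P tau Ha Sx Sy Sz Sphi Hind Hp HP Hord
    (fun m Hm => proj1 (Hw m Hm)) eta (a / 3) (a / 2) ltac:(lra) ltac:(lra) ltac:(lra) Hcut eta1 eta0 eta01 a' Ft).
  destruct Hper as [(b & Hb & Hsupp)|(g & Hg1 & Hg2 & Hg3)].
  (* Continuation by 0. Smoothness is checked on two open sets: inside the square without the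
     origin, where [r > 0], and beyond [b], where the function vanishes. *)
  - set (Ft := fun x y => if Rlt_dec (nrm x y) a then phi x y / rdist rx ry rz x y ^ p else 0).
    assert (Ft0 : forall x y, b < nrm x y -> Ft x y = 0).
    { intros x y h. unfold Ft. destruct Rlt_dec; auto. rewrite Hsupp by exact h. unfold Rdiv. ring. }
    apply (Main (a + 1) Ft); auto; try lra.
    + intros n.
      assert (H1 : Cn n (pball a) Ft).
      { assert (O := open2_pball a).
        apply (Cn_ext _ O n (fun x y => phi x y * Rpower (sqdist rx ry rz x y) (- (INR p / 2)))).
        - intros x y [h1 h2]. unfold Ft. destruct Rlt_dec; [|lra].
          rewrite rdist_pow, Rpower_Ropp; [reflexivity|]. apply Xpos; lra.
        - apply Cn_mult; auto; [apply (Cn_mono (fun _ _ => True)); auto; apply Sphi|].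
          apply Cn_Rpower; auto.
          + intros x y [h1 h2]. apply Xpos; lra.
          + apply (Cn_mono (fun _ _ => True)); auto. now apply Smooth_sqdist. }
      assert (H2 : Cn n (fun x y => b < nrm x y) Ft).
      { apply (Cn_ext _ (open2_nrm_gt b) n (fun _ _ => 0)).
        - intros x y h. symmetry. now apply Ft0.
        - apply Cn_const, open2_nrm_gt. }
      eapply Cn_mono; [|exact (Cn_union n _ _ _ H1 H2)].
      intros x y [h1 h2]. simpl. destruct (Rlt_dec (nrm x y) a); [left; split; auto|right; lra].
    + apply (matching_of_support a b); auto. lra.
    + intros x y [h1 h2]. unfold Ft. destruct Rlt_dec; auto.
      rewrite Hsupp by (change (b < nrm x y); lra). unfold Rdiv. ring.
  (* As [3 a / 2 < 2 a], the origin is the only point of the period lattice in this larger square,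
     so [g] is smooth on the rest of it. *)
  - apply (Main (3 * a / 2) g); auto; try lra.
    + intros n. eapply Cn_mono; [|exact (smooth_on_Cn _ g Hg2 n)].
      intros x y [h1 h2] (i & j & Hi & Hj).
      assert (L : forall k z, z = 2 * a * IZR k -> Rabs z < 3 * a / 2 -> z = 0).
      { intros k z Hz hz. rewrite Hz, Rabs_mult, Rabs_pos_eq, <- abs_IZR in hz by lra.
        assert (IZR (Z.abs k) < 1) by nra. apply lt_IZR in H.
        assert (k = 0%Z) by lia. subst k. lra. }
      generalize (Rabs_le_nrm_l x y) (Rabs_le_nrm_r x y). intros.
      rewrite (L i x Hi), (L j y Hj), nrm_00 in h1 by lra. lra.
    (* Opposite sides of the square differ by one period [2 a]. *)
    + intros k s Hk Hs. replace a with (- a + 2 * a) at 2 4 by ring. split; symmetry.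
      * apply dxn_periodic. intros; apply Hg1.
      * apply dyn_periodic. intros; apply Hg1.
    + intros x y [h1 h2]. generalize (Rabs_le_nrm_l x y) (Rabs_le_nrm_r x y). intros.
      apply Hg3; try lra. now apply nrm_pos_neq.
Qed.
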